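(* Let $(X,\mathcal{B},\mu,T)$ be a non-trivial invertible probability measure preserving weakly mixing system on a standard probability space. Then for any $d\in\mathbb{N}$ with $d\ge 1$ and any non-constant integer-valued polynomials $p_{1},p_{2},\dots,p_{d}$ such that $p_{i}-p_{j}$ is also non-constant for all $i\neq j$: (i) there is $A\in\mathcal{B}$ such that the set $$\{n\in\mathbb{N}\colon\mu(A\cap T^{p_{1}(n)}A\cap\dots\cap T^{p_{d}(n)}A)<\mu(A)^{d+1}\}$$ is of density $1$; (ii) there is $A\in\mathcal{B}$ such that the set $$\{n\in\mathbb{N}\colon\mu(A\cap T^{p_{1}(n)}A\cap\dots\cap T^{p_{d}(n)}A)>\mu(A)^{d+1}\}$$ is of density $1$.
   Context: A set $E\subseteq\mathbb{N}$ is of density $1$ if $\lim_{N\to\infty}\frac{|E\cap\{0,1,\dots,N-1\}|}{N}=1$. The system $(X,\mathcal{B},\mu,T)$ is weakly mixing if for all $A\in\mathcal{B}$ there exists $E\subseteq\mathbb{N}$ of density $1$ such that $\lim_{n\to\infty,\,n\in E}\mu(A\cap T^{-n}A)=\mu(A)^2$. A standard probability space is one isomorphic mod $0$ to a disjoint union of finitely many atoms with an interval equipped with Lebesgue measure. Non-trivial means that $\mathcal{B}$ contains a set of measure strictly between $0$ and $1$. A polynomial is integer-valued if it takes integer values on the integers. *)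

(* Defs.v *)
From mathcomp Require Export all_boot all_order all_algebra.
From mathcomp Require Export all_classical all_reals all_analysis.
Set Implicit Arguments.
Unset Strict Implicit.
Unset Printing Implicit Defensive.
Export Order.TTheory GRing.Theory Num.Theory.
Export numFieldNormedType.Exports.
Local Open Scope classical_set_scope.
Local Open Scope ring_scope.

Definition density_one (R : realType) (E : set nat) : Prop :=
  (#|[pred i : 'I_N | (i : nat) \in E]|%:R / N%:R : R) @[N --> \oo] --> (1 : R).

(* The image T^z A for z : int; T^(-n) A is a preimage, so no inverse function
   of T has to be named. *)
Definition zimage (X : Type) (T : X -> X) (z : int) (A : set X) : set X :=
  match z with
  | Posz n => iter n T @` A
  | Negz n => iter n.+1 T @^-1` A
  end.

Section MeasurePreserving.
Context (disp : measure_display) (X : measurableType disp) (R : realType).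
Variables (mu : set X -> \bar R) (T : X -> X).

Definition invertible_measure_preserving : Prop :=
  [/\ bijective T,
      measurable_fun [set: X] T,
      (forall A : set X, measurable A -> measurable (T @` A)) &
      (forall A : set X, measurable A -> mu (T @^-1` A) = mu A)].

Definition weakly_mixing : Prop :=
  forall A : set X, measurable A ->
    exists E : set nat, density_one R E /\
      mu (A `&` zimage T (- n%:Z) A) @[n --> within E \oo] --> (mu A ^+ 2)%E.

Definition nontrivial_space : Prop :=
  exists B : set X, measurable B /\ (0 < mu B < 1)%E.

End MeasurePreserving.

Section StandardSpace.
Context (R : realType).

(* Sets are compared up to negligible sets, so f is measure preserving between
   the completions.  The notion of isomorphism below is therefore the same
   whether the sigma-algebras are completed or not, although the measurable
   sets of R in the library are the Borel ones. *)
Definition measure_preserving_mod0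
    (d1 d2 : measure_display) (X : measurableType d1) (Y : measurableType d2)
    (mu : set X -> \bar R) (nu : set Y -> \bar R) (f : X -> Y) : Prop :=
  forall B : set Y, measurable B ->
    exists A : set X, [/\ measurable A, mu A = nu B &
      mu.-negligible ((f @^-1` B) `+` A)].

(* f restricts to a bijection from [set x | g (f x) = x] onto
   [set y | f (g y) = y], and these two sets are conull. *)
Definition isomorphic_mod0
    (d1 d2 : measure_display) (X : measurableType d1) (Y : measurableType d2)
    (mu : set X -> \bar R) (nu : set Y -> \bar R) : Prop :=
  exists (f : X -> Y) (g : Y -> X),
    [/\ measure_preserving_mod0 mu nu f,
        measure_preserving_mod0 nu mu g,
        (\forall x \ae mu, g (f x) = x) &
        (\forall y \ae nu, f (g y) = y)].

(* The disjoint union of the interval [0, c] and of k atoms of masses w i,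
   realized inside R with the atoms at -1, ..., -k. *)
Definition interval_atoms (c : R) (k : nat) (w : 'I_k -> R) (B : set R)
    : \bar R :=
  (lebesgue_measure (B `&` `[0%R, c]) +
   \sum_(i < k) (w i)%:E * \d_(- i.+1%:R : R)%R B)%E.

Definition standard_space (disp : measure_display) (X : measurableType disp)
    (mu : set X -> \bar R) : Prop :=
  exists (c : R) (k : nat) (w : 'I_k -> R),
    [/\ 0 <= c, (forall i, 0 < w i) &
        isomorphic_mod0 mu (interval_atoms c w)].

End StandardSpace.

Definition integer_valued (R : realType) (p : {poly R}) : Prop :=
  forall z : int, p.[z%:~R] \is a Num.int.

Definition nonconstant (R : realType) (p : {poly R}) : Prop :=
  (1 < size p)%N.

(* For an integer-valued p the floor is exact. *)
Definition int_value (R : realType) (p : {poly R}) (n : nat) : int :=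
  Num.floor p.[n%:R].

Definition poly_return (X : Type) (R : realType) (T : X -> X) (d : nat)
    (p : 'I_d -> {poly R}) (n : nat) (A : set X) : set X :=
  A `&` \bigcap_(i in [set: 'I_d]) zimage T (int_value (p i) n) A.

(* Main.v *)
Require Import Defs.
From mathcomp Require Import measurable_realfun ring lra zify.
(** Write [D = d + 1] and [c(A, n)] for the measure of the intersection of the
    translates of [A] by [0, p_1(n), ..., p_d(n)].

    The starting point is Bergelson's theorem [polynomial_mixing]: for a weakly
    mixing system and essentially distinct polynomials, [c(A, n)] tends to
    [mu(A) ^ D] along a set of density one.  It is proved by induction on
    families of polynomials, each step being a differencing by the inequality
    [van_der_Corput].  Any deviation from independence is thus transient, and a
    set with a strict inequality at almost all times must deviate at every
    scale of time, by amounts tending to zero.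

    It is built as a limit of sets [A_j] of measure one half.  The basic move,
    [splice], replaces [A_j] by a set [Q_j] inside a nearly invariant set of
    small measure [t_j] that is nearly independent of everything in sight.
    Then [c(A_(j+1), n)] is, up to any prescribed time, the average of
    [c(A_j, n)] and [c(Q_j, n)] with weights [1 - t_j] and [t_j].  So it is
    enough to find sets [Q] whose correlations deviate in the right direction
    up to any prescribed time.  For over-independence a nearly invariant set
    will do ([over_supply]).  For under-independence ([under_supply]) take the
    union of a fixed set [Y] and of a nearly periodic set [C] of large period
    [q], which exists by [nearly_periodic]: when the shifts are distinct modulo
    [q], the translates of [C] avoid one another, and the correlation is the
    first order part of the expansion of a [D]-th power.  The gain is of order
    [1 / q ^ 2], and by [rarely_divisible] the shifts are distinct modulo [q]
    for all [n] outside a set of times whose density tends to zero as [q]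
    grows through the powers of 2.

    The difficulty is that there is a gap between the time [M_j] up to which
    layer [j] is controlled and the time [M_(j+1)] from which [A_(j+1)] is
    nearly independent, and nothing can be said of the effect of layer [j] at
    the times in between.  There its cost is at most a multiple of [t_j], while
    the later layers are all controlled at least up to [M_(j+1)] and can bring
    a gain.  With [t_j] of order [1 / j ^ 2] and [q] growing very slowly with
    [j], the layers from [j + 1] to [j ^ 2] gain more than layer [j] and all
    layers beyond [j ^ 2] can cost ([gain_exceeds_cost]).  Only finitely many
    values of [q], hence only finitely many sets [Y], occur in the layers up to
    [j ^ 2], and [M_j] can be chosen so large that they all have nearly
    independent translates at almost all later times.  This is
    [layered_construction]. *)

Set Implicit Arguments.
Unset Strict Implicit.
Unset Printing Implicit Defensive.
Local Open Scope classical_set_scope.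
Local Open Scope ring_scope.

(** * Null sequences in the sense of averages *)
Section CesaroNull.
Context {R : realType}.
Implicit Types (a b : nat -> R) (e : R).

Definition cesaro_null a := forall e, 0 < e ->
  exists N0, forall N, (N0 <= N)%N -> \sum_(n < N) `|a n| <= e * N%:R.

Lemma cesaro_null_le a b :
  cesaro_null b -> (forall n, `|a n| <= `|b n|) -> cesaro_null a.
Proof.
move=> nb ab e e0; have [N0 hN0] := nb e e0; exists N0 => N /hN0.
by apply: le_trans; apply: ler_sum.
Qed.

Lemma eq_cesaro_null a b : cesaro_null b -> a =1 b -> cesaro_null a.
Proof. by move=> nb ab; apply: (cesaro_null_le nb) => n; rewrite ab. Qed.

Lemma cesaro_null0 : cesaro_null (fun=> 0).
Proof.
move=> e e0; exists 0%N => N _.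
by rewrite big1 => [|i _]; rewrite ?normr0// mulr_ge0// ltW.
Qed.

Lemma cesaro_nullD a b :
  cesaro_null a -> cesaro_null b -> cesaro_null (fun n => a n + b n).
Proof.
move=> na nb e e0.
have e2 : 0 < e / 2 by rewrite divr_gt0.
have [N1 h1] := na _ e2; have [N2 h2] := nb _ e2.
exists (maxn N1 N2) => N; rewrite geq_max => /andP[/h1 {}h1 /h2 {}h2].
rewrite (le_trans (ler_sum _ (fun i _ => ler_normD _ _)))// big_split/=.
by rewrite (le_trans (lerD h1 h2))// -mulrDl -splitr.
Qed.

Lemma cesaro_nullZ (c : R) a : cesaro_null a -> cesaro_null (fun n => c * a n).
Proof.
move=> na e e0; have c1 : 0 < `|c| + 1 by rewrite ltr_wpDl.
have [N0 h0] := na (e / (`|c| + 1)) (divr_gt0 e0 c1).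
exists N0 => N /h0 {}h0.
under eq_bigr do rewrite normrM.
rewrite -mulr_sumr.
have [s0|] := leP 0 (\sum_(n < N) `|a n|); last first.
  by rewrite ltNge sumr_ge0.
rewrite (@le_trans _ _ ((`|c| + 1) * \sum_(n < N) `|a n|))//.
  by rewrite ler_wpM2r// lerDl.
by rewrite mulrC -ler_pdivlMr// (le_trans h0)// mulrAC.
Qed.

Lemma cesaro_null_sum (I : Type) (s : seq I) (a : I -> nat -> R) :
  (forall i, cesaro_null (a i)) -> cesaro_null (fun n => \sum_(i <- s) a i n).
Proof.
move=> na; elim: s => [|i s IH].
  by apply: (eq_cesaro_null cesaro_null0) => n; rewrite big_nil.
by apply: (eq_cesaro_null (cesaro_nullD (na i) IH)) => n; rewrite big_cons.
Qed.

(** Since [|a| <= e/2 + a^2/(2e)], small averages of squares force small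
    averages. *)
Lemma cesaro_null_sqr a : cesaro_null (fun n => a n ^+ 2) -> cesaro_null a.
Proof.
move=> na e e0; have [N0 h0] := na (e ^+ 2) (exprn_gt0 _ e0).
exists N0 => N /h0 {}h0.
have le1 n : `|a n| <= e / 2 + `|a n ^+ 2| / (2 * e).
  rewrite normrX; set t := `|a n|; have : 0 <= (t - e) ^+ 2 by exact: sqr_ge0.
  have -> : e / 2 + t ^+ 2 / (2 * e) = t + (t - e) ^+ 2 / (2 * e).
    by field; rewrite gt_eqF.
  by move=> ?; rewrite lerDl divr_ge0// mulr_ge0// ltW.
rewrite (le_trans (ler_sum _ (fun (i : 'I_N) _ => le1 i)))// big_split/=.
rewrite sumr_const card_ord -mulr_suml -(mulr_natr (e / 2)).
rewrite [leRHS](_ : _ = e / 2 * N%:R + e ^+ 2 * N%:R / (2 * e)).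
  by rewrite lerD2l// ler_wpM2r// invr_ge0 mulr_ge0// ltW.
by field; rewrite gt_eqF.
Qed.

Lemma cesaro_null_bounded_sum (C : R) a :
  (forall N, \sum_(n < N) `|a n| <= C) -> cesaro_null a.
Proof.
move=> aC e e0; have C0 : 0 <= C by have := aC 0%N; rewrite big_ord0.
exists (Num.bound (C / e)) => N hN; rewrite (le_trans (aC N))//.
rewrite -ler_pdivrMl// mulrC.
have : C / e < (Num.bound (C / e))%:R by rewrite archi_boundP// divr_ge0// ltW.
by move=> /ltW/le_trans; apply; rewrite ler_nat.
Qed.

(** The sum over the first [N] multiples of [c] is at most the sum over the
    first [c * N] integers. *)
Lemma cesaro_null_dilate (c : nat) a :
  (0 < c)%N -> cesaro_null a -> cesaro_null (fun n => a (c * n)%N).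
Proof.
move=> c0 na e e0.
have cR : 0 < c%:R :> R by rewrite ltr0n.
have [N0 h0] := na (e / c%:R) (divr_gt0 e0 cR).
have sub N : \sum_(n < N) `|a (c * n)%N| <= \sum_(m < c * N) `|a m|.
  elim: N => [|N IH]; first by rewrite muln0 !big_ord0.
  rewrite big_ord_recr/= mulnS addnC big_split_ord/= lerD//.
  case: c c0 {h0 cR IH} => // c _; rewrite big_ord_recl/= addn0 lerDl.
  exact: sumr_ge0.
exists N0 => N hN; rewrite (le_trans (sub N))// (le_trans (h0 _ _))//.
  by rewrite (leq_trans hN)// leq_pmull.
by rewrite natrM mulrA divfK// gt_eqF.
Qed.

Lemma cesaro_null_small (a : nat -> R) (e : R) : cesaro_null a -> 0 < e ->
  exists n, `|a n| < e.
Proof.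
move=> na e0; have e2 : 0 < e / 2 by rewrite divr_gt0.
have [N0 /(_ N0.+1 (leqnSn _))] := na _ e2.
apply: contraPP => /forallNP big; apply/negP; rewrite -ltNge.
apply: (@lt_le_trans _ _ (\sum_(n < N0.+1) e)); last first.
  by apply: ler_sum => n _; rewrite leNgt; apply/negP; exact: big.
rewrite sumr_const card_ord -(mulr_natr e) ltr_pM2r ?ltr0n//.
by rewrite ltr_pdivrMr// ltr_pMr// ltr1n.
Qed.

End CesaroNull.

(** * Simple functions and their means *)
Section Simple.
Context {disp : measure_display} {X : measurableType disp} {R : realType}.
Context (mu : probability X R).
Implicit Types (A B : set X) (f g : X -> R).

Definition mass A : R := fine (mu A).

Lemma massE A : measurable A -> mu A = (mass A)%:E.
Proof. by move=> mA; rewrite fineK// fin_num_measure. Qed.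

(** The algebra spanned by the indicators of measurable sets.  It is closed
    under products and translations, hence large enough for polynomial
    mixing, and mixing passes to it from sets by linearity alone. *)
Inductive simple : (X -> R) -> Prop :=
| simple_indic A : measurable A -> simple (\1_A)
| simpleD f g : simple f -> simple g -> simple (fun x => f x + g x)
| simpleZ (c : R) f : simple f -> simple (fun x => c * f x).

Definition mean f : R := \int[mu]_x f x.

Lemma simple_ext f g : simple f -> f =1 g -> simple g.
Proof. by move=> sf /funext <-. Qed.

Lemma simple_cst (c : R) : simple (fun=> c).
Proof.
have := simpleZ c (simple_indic (@measurableT _ X)).
by move/simple_ext; apply => x; rewrite indicT/= mulr1.
Qed.

Lemma simpleB f g : simple f -> simple g -> simple (fun x => f x - g x).
Proof.
move=> sf sg; have := simpleD sf (simpleZ (-1) sg).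
by move/simple_ext; apply => x; rewrite mulN1r.
Qed.

Lemma simpleM f g : simple f -> simple g -> simple (fun x => f x * g x).
Proof.
elim=> [A mA|f1 f2 _ IH1 _ IH2|c f1 _ IH1] sg.
- elim: sg => [B mB|g1 g2 _ IH1 _ IH2|c g1 _ IH1].
  + by apply: simple_ext (simple_indic (measurableI _ _ mA mB)) _ => x;
      rewrite indicI.
  + by apply: simple_ext (simpleD IH1 IH2) _ => x /=; rewrite mulrDr.
  + by apply: simple_ext (simpleZ c IH1) _ => x /=; rewrite mulrCA.
- by apply: simple_ext (simpleD (IH1 sg) (IH2 sg)) _ => x /=; rewrite mulrDl.
- by apply: simple_ext (simpleZ c (IH1 sg)) _ => x /=; rewrite mulrA.
Qed.

Lemma simple_sum (I : Type) (s : seq I) (P : pred I) (f : I -> X -> R) :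
  (forall i, P i -> simple (f i)) ->
  simple (fun x => \sum_(i <- s | P i) f i x).
Proof.
move=> sf; elim: s => [|i s IH].
  by apply: simple_ext (simple_cst 0) _ => x; rewrite big_nil.
have [Pi|/negbTE Pi] := boolP (P i).
  by apply: simple_ext (simpleD (sf i Pi) IH) _ => x /=; rewrite big_cons Pi.
by apply: simple_ext IH _ => x; rewrite big_cons Pi.
Qed.

Lemma simple_prod (I : Type) (s : seq I) (P : pred I) (f : I -> X -> R) :
  (forall i, P i -> simple (f i)) ->
  simple (fun x => \prod_(i <- s | P i) f i x).
Proof.
move=> sf; elim: s => [|i s IH].
  by apply: simple_ext (simple_cst 1) _ => x; rewrite big_nil.
have [Pi|/negbTE Pi] := boolP (P i).
  by apply: simple_ext (simpleM (sf i Pi) IH) _ => x /=; rewrite big_cons Pi.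
by apply: simple_ext IH _ => x; rewrite big_cons Pi.
Qed.

Lemma simple_measurable f : simple f -> measurable_fun setT f.
Proof.
elim=> [A mA|f1 f2 _ IH1 _ IH2|c f1 _ IH1].
- exact: measurable_indic.
- exact: measurable_funD.
- exact: measurable_funM.
Qed.

Lemma simple_bounded f : simple f -> exists C, forall x, `|f x| <= C.
Proof.
elim=> [A mA|f1 f2 _ [C1 h1] _ [C2 h2]|c f1 _ [C1 h1]].
- by exists 1 => x; rewrite indicE; case: (_ \in _); rewrite ?normr0 ?normr1.
- by exists (C1 + C2) => x; rewrite (le_trans (ler_normD _ _))// lerD.
- by exists (`|c| * C1) => x; rewrite normrM ler_wpM2l.
Qed.

Lemma simple_integrable f : simple f -> mu.-integrable setT (EFin \o f).
Proof.
move=> sf; have [C hC] := simple_bounded sf.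
apply: measurable_bounded_integrable => //.
- by rewrite -ge0_fin_numE ?measure_ge0// fin_num_measure.
- exact: simple_measurable.
- exists C; split; first exact: num_real.
  by move=> M CM x _; rewrite /= (le_trans (hC x))// ltW.
Qed.

Lemma mean_ext f g : f =1 g -> mean f = mean g.
Proof. by move=> /funext ->. Qed.

Lemma meanD f g : simple f -> simple g -> mean (fun x => f x + g x) = mean f + mean g.
Proof. by move=> sf sg; apply: RintegralD => //; exact: simple_integrable. Qed.

Lemma meanZ c f : simple f -> mean (fun x => c * f x) = c * mean f.
Proof. by move=> sf; apply: RintegralZl => //; exact: simple_integrable. Qed.

Lemma meanB f g : simple f -> simple g -> mean (fun x => f x - g x) = mean f - mean g.
Proof. by move=> sf sg; apply: RintegralB => //; exact: simple_integrable. Qed.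

Lemma mean_indic A : measurable A -> mean (\1_A) = mass A.
Proof.
by move=> mA; rewrite /mean /Rintegral integral_indic// setIT.
Qed.

Lemma massT : mass setT = 1.
Proof. by rewrite /mass probability_setT. Qed.

Lemma mean_cst c : mean (fun=> c) = c.
Proof. by rewrite /mean Rintegral_cst// -[fine _]/(mass setT) massT mulr1. Qed.

Lemma mean_sum (I : Type) (s : seq I) (P : pred I) (f : I -> X -> R) :
  (forall i, P i -> simple (f i)) ->
  mean (fun x => \sum_(i <- s | P i) f i x) = \sum_(i <- s | P i) mean (f i).
Proof.
move=> sf; elim: s => [|i s IH].
  by rewrite (mean_ext (g := fun=> 0)) ?mean_cst ?big_nil// => x; rewrite big_nil.
rewrite big_cons; have [Pi|/negbTE Pi] := boolP (P i).
  rewrite -IH -meanD; [|exact: sf|exact: simple_sum].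
  by apply: mean_ext => x; rewrite big_cons Pi.
by rewrite -IH; apply: mean_ext => x; rewrite big_cons Pi.
Qed.

Lemma mean_ge0 f : (forall x, 0 <= f x) -> 0 <= mean f.
Proof. by move=> f0; apply: Rintegral_ge0. Qed.

Lemma mean_le f g : simple f -> simple g -> (forall x, f x <= g x) -> mean f <= mean g.
Proof.
by move=> sf sg fg; apply: le_Rintegral => //; exact: simple_integrable.
Qed.

Lemma mean_norm_le C f : simple f -> (forall x, `|f x| <= C) -> `|mean f| <= C.
Proof.
move=> sf fC; rewrite ler_norml -{2}(mean_cst C) -(mean_cst (- C)).
by rewrite !mean_le//; try exact: simple_cst; move=> x;
  have := fC x; rewrite ler_norml => /andP[].
Qed.

(** The mean of [(g - c f) ^ 2] is nonnegative; take for [c] the mean of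
    [f g]. *)
Lemma mean_CauchySchwarz f g : simple f -> simple g ->
  (forall x, `|f x| <= 1) ->
  mean (fun x => f x * g x) ^+ 2 <= mean (fun x => g x ^+ 2).
Proof.
move=> sf sg f1; set c := mean (fun x => f x * g x).
have sfg := simpleM sf sg.
have : 0 <= mean (fun x => (g x - c * f x) ^+ 2) by apply: mean_ge0 => x; exact: sqr_ge0.
have -> : mean (fun x => (g x - c * f x) ^+ 2) =
    mean (fun x => g x ^+ 2 + (- 2 * c * (f x * g x) + c ^+ 2 * (f x * f x))).
  by apply: mean_ext => x; ring.
have [sgg sff] := (simpleM sg sg, simpleM sf sf).
rewrite meanD ?meanD ?meanZ//; do ?[exact: simpleZ|apply: simpleD].
rewrite -/c.
have f2 : mean (fun x => f x * f x) <= 1.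
  rewrite -(mean_cst 1); apply: mean_le; [exact: simpleM|exact: simple_cst|].
  by move=> x; rewrite -expr2 -real_normK ?num_real// expr_le1.
have : 0 <= c ^+ 2 by exact: sqr_ge0.
nra.
Qed.

End Simple.

(** * The van der Corput inequality *)
Section FiniteSums.
Context {R : realType}.

Lemma sum_shift_le (a : nat -> R) (h N : nat) : (forall n, 0 <= a n <= 1) ->
  `|\sum_(n < N) a (n + h)%N - \sum_(n < N) a n| <= h%:R.
Proof.
move=> a01; elim: h => [|h IH].
  by under eq_bigr do rewrite addn0; rewrite subrr normr0.
have -> : \sum_(n < N) a (n + h.+1)%N =
          \sum_(n < N) a (n + h)%N + (a (N + h)%N - a h).
  elim: N {IH} => [|N IHN]; first by rewrite !big_ord0 add0n subrr addr0.
  by rewrite !big_ord_recr/= IHN addSnnS; ring.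
rewrite addrAC (le_trans (ler_normD _ _))// -natr1 lerD//.
have /andP[? ?] := a01 (N + h)%N; have /andP[? ?] := a01 h.
by rewrite ler_norml; apply/andP; split; lra.
Qed.

Lemma sum_subn_le (a : nat -> R) (h H : nat) :
  (forall n, 0 <= a n) -> a 0%N = 0 -> (h < H)%N ->
  \sum_(j < H) a (h - j)%N <= \sum_(j < H) a j.
Proof.
move=> a0 a00 hH.
have -> : H = (h.+1 + (H - h.+1))%N by rewrite subnKC.
rewrite !big_split_ord/= (reindex_inj rev_ord_inj)/= lerD//.
  apply: ler_sum => i _; rewrite subSS subKn//.
  by rewrite -ltnS.
apply: ler_sum => i _.
by rewrite (_ : (h - _)%N = 0%N) ?a00//; lia.
Qed.

Lemma sum_nsub_le (a : nat -> R) (h H : nat) :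
  (forall n, 0 <= a n) -> a 0%N = 0 -> (h <= H)%N ->
  \sum_(j < H) a (j - h)%N <= \sum_(j < H) a j.
Proof.
move=> a0 a00 hH.
have -> : \sum_(j < H) a (j - h)%N = \sum_(j < h + (H - h)) a (j - h)%N.
  by rewrite subnKC.
have -> : \sum_(j < H) a j = \sum_(j < (H - h) + h) a j by rewrite subnK.
rewrite !big_split_ord/= addrC lerD//.
  by apply: ler_sum => i _; rewrite addKn.
rewrite big1 ?sumr_ge0// => i _.
by rewrite (_ : (_ - h)%N = 0%N) ?a00//; have := ltn_ord i; lia.
Qed.

Lemma sqr_sum_le (N : nat) (x : 'I_N -> R) :
  (\sum_(i < N) x i) ^+ 2 <= N%:R * \sum_(i < N) x i ^+ 2.
Proof.
elim: N x => [|N IH] x; first by rewrite !big_ord0 expr0n/= mulr0.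
rewrite !big_ord_recr/= -natr1.
set s := \sum_(i < N) _; set t := \sum_(i < N) _; set y := x ord_max.
have st : s ^+ 2 <= N%:R * t by exact: IH.
have t0 : 0 <= t by apply: sumr_ge0 => i _; exact: sqr_ge0.
have : 0 <= \sum_(i < N) (x (widen_ord (leqnSn N) i) - y) ^+ 2.
  by apply: sumr_ge0 => i _; exact: sqr_ge0.
have -> : \sum_(i < N) (x (widen_ord (leqnSn N) i) - y) ^+ 2 =
    t - 2 * y * s + N%:R * y ^+ 2.
  under eq_bigr do rewrite sqrrB.
  rewrite big_split/= sumrB sumr_const card_ord.
  congr (_ - _ + _); last by rewrite mulr_natl.
  by rewrite /s mulr_sumr; apply: eq_bigr => i _; ring.
nra.
Qed.

End FiniteSums.

Section VanDerCorput.
Context {disp : measure_display} {X : measurableType disp} {R : realType}.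
Context (mu : probability X R).

(** Put [c n] for the mean of [g v_n].  The sum of [c n ^ 2] over [n < N] is the
    mean of [g] times the sum of the [c n v_n], so by Cauchy-Schwarz it is
    controlled by the norm of that sum.  Replacing the sum by averages over
    [H] consecutive terms bounds this norm by the correlations of [v_(n + h)]
    and [v_(n + h')] for [h, h' < H] only, whatever the bounded weights [c n];
    for [h < h'] these tend on average to [L (h' - h)], and [L] is null.  The weights
    are what gives convergence of the averages of absolute values, with no
    recourse to the product system. *)
Lemma van_der_Corput (g : X -> R) (v : nat -> X -> R) (L : nat -> R) :
  simple g -> (forall x, `|g x| <= 1) ->
  (forall n, simple (v n)) -> (forall n x, `|v n x| <= 1) ->
  cesaro_null L ->
  (forall k, (0 < k)%N ->
     cesaro_null (fun n => mean mu (fun x => v n x * v (n + k)%N x) - L k)) ->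
  cesaro_null (fun n => mean mu (fun x => g x * v n x)).
Proof.
move=> sg g1 sv v1 L0 vL.
set c := fun n => mean mu (fun x => g x * v n x).
have sgv n : simple (fun x => g x * v n x) by exact: simpleM.
have c1 n : `|c n| <= 1.
  by apply: mean_norm_le => // x; rewrite normrM mulr_ile1.
have c2 n : 0 <= c n ^+ 2 <= 1.
  by rewrite sqr_ge0/= -real_normK ?num_real// expr_le1.
pose a k := if k == 0%N then 0 else `|L k|.
have a0 k : 0 <= a k by rewrite /a; case: ifP.
pose r i j := `|mean mu (fun x => v i x * v j x)|.
have svv i j : simple (fun x => v i x * v j x) by exact: simpleM.
have r01 i j : 0 <= r i j <= 1.
  rewrite normr_ge0/=; apply: mean_norm_le => // x.
  by rewrite normrM mulr_ile1.
have rC i j : r i j = r j i.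
  by congr `|_|; apply: mean_ext => x; rewrite mulrC.
apply: cesaro_null_sqr => e e0.
pose t := e / 2; have t0 : 0 < t by rewrite divr_gt0.
pose e1 := Num.min (t ^+ 2 / 5) t.
have e10 : 0 < e1 by rewrite lt_min t0 divr_gt0// exprn_gt0.
have [H0 hH0] := L0 _ e10.
pose H := maxn H0 (Num.bound e1^-1).
have H1 : 1 <= e1 * H%:R.
  rewrite -ler_pdivrMl// mulr1.
  have : e1^-1 < (Num.bound e1^-1)%:R by rewrite archi_boundP// invr_ge0 ltW.
  by move=> /ltW/le_trans; apply; rewrite ler_nat leq_maxr.
have aH : \sum_(k < H) a k <= e1 * H%:R.
  apply: le_trans (hH0 _ (leq_maxl _ _)); apply: ler_sum => k _.
  by rewrite /a; case: ifP.
have /choice[N1 hN1] : forall k, exists N0, (0 < k)%N -> forall N, (N0 <= N)%N ->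
    \sum_(n < N) r n (n + k)%N <= e1 * N%:R + a k * N%:R.
  move=> [|k]; first by exists 0%N.
  have [N0 hN0] := vL k.+1 isT _ e10.
  exists N0 => _ N /hN0 hN; rewrite -lerBlDr (le_trans _ hN)//.
  rewrite lerBlDr mulr_natr -[X in _ *+ X]card_ord -sumr_const -big_split/=.
  apply: ler_sum => n _; rewrite /a/= /r.
  by set m := mean _ _; rewrite -{1}(subrK (L k.+1) m) ler_normD.
pose N2 := (\max_(k < H) N1 k)%N.
exists (maxn N2 (Num.bound (H%:R / e1))) => N; rewrite geq_max => /andP[N2N bN].
have HN : H%:R <= e1 * N%:R.
  rewrite -ler_pdivrMl// mulrC.
  have : H%:R / e1 < (Num.bound (H%:R / e1))%:R.
    by rewrite archi_boundP// divr_ge0// ltW.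
  by move=> /ltW/le_trans; apply; rewrite ler_nat.
have rlt h h' : (h < h')%N -> (h' < H)%N ->
    \sum_(n < N) r (n + h)%N (n + h')%N <=
    e1 * N%:R + a (h' - h)%N * N%:R + H%:R.
  move=> hh' h'H.
  have Nk : (N1 (h' - h)%N <= N)%N.
    have kH : (h' - h < H)%N by lia.
    by apply: leq_trans N2N; exact: (leq_bigmax (Ordinal kH)).
  have k0 : (0 < h' - h)%N by lia.
  have := hN1 _ k0 _ Nk.
  have := @sum_shift_le R (fun n => r n (n + (h' - h))%N) h N (fun n => r01 _ _).
  rewrite ler_norml => /andP[_].
  have -> : \sum_(n < N) r (n + h)%N (n + h + (h' - h))%N =
            \sum_(n < N) r (n + h)%N (n + h')%N.
    by apply: eq_bigr => n _; rewrite -addnA subnKC// ltnW.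
  have : h%:R <= H%:R :> R by rewrite ler_nat; lia.
  lra.
have rle h h' : (h < H)%N -> (h' < H)%N ->
    \sum_(n < N) r (n + h)%N (n + h')%N <=
    (h == h')%:R * N%:R + e1 * N%:R + (a (h' - h)%N + a (h - h')%N) * N%:R + H%:R.
  move=> hH h'H.
  have NR : 0 <= N%:R :> R by [].
  have HR : 0 <= H%:R :> R by [].
  have [a1 a2] := (mulr_ge0 (a0 (h - h')%N) NR, mulr_ge0 (a0 (h' - h)%N) NR).
  have eN : 0 <= e1 * N%:R by rewrite mulr_ge0// ltW.
  rewrite mulrDl; have [hh'|hh'|hh'] := ltngtP h h';
    rewrite /= ?mulr0n ?mulr1n ?mul0r ?mul1r ?add0r.
  - have := rlt _ _ hh' h'H; lra.
  - under eq_bigr do rewrite rC.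
    have := rlt _ _ hh' hH; lra.
  - have : \sum_(n < N) r (n + h)%N (n + h)%N <= N%:R.
      rewrite -[N in leRHS]card_ord -sum1_card natr_sum.
      by apply: ler_sum => n _; have /andP[] := r01 (n + h)%N (n + h)%N.
    by move: a1 a2; rewrite -hh'; lra.
pose S := \sum_(h < H) \sum_(h' < H) \sum_(n < N) r (n + h)%N (n + h')%N.
have S5 : S <= 5 * e1 * H%:R ^+ 2 * N%:R.
  have Sh (h : 'I_H) : \sum_(h' < H) \sum_(n < N) r (n + h)%N (n + h')%N <=
      N%:R + H%:R * (e1 * N%:R) + 2 * (e1 * H%:R) * N%:R + H%:R * H%:R.
    have := @ler_sum R _ (index_enum 'I_H) predT _ _
      (fun h' _ => rle h h' (ltn_ord h) (ltn_ord h')).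
    move=> /le_trans; apply; rewrite !big_split/= -!mulr_suml big_split/=.
    have cst (b : R) : \sum_(h' < H) b = H%:R * b.
      by rewrite sumr_const card_ord mulr_natl.
    rewrite !cst.
    have -> : \sum_(h' < H) ((h : nat) == h')%:R = 1 :> R.
      rewrite (bigD1 h)//= eqxx big1 ?addr0// => j jh.
      by rewrite val_eqE eq_sym (negbTE jh).
    have b1 := sum_subn_le a0 (erefl : a 0%N = 0) (ltn_ord h).
    have b2 := sum_nsub_le a0 (erefl : a 0%N = 0) (ltnW (ltn_ord h)).
    rewrite mul1r mulrA lerD2r lerD2l ler_wpM2r//; lra.
  have -> : 5 * e1 * H%:R ^+ 2 * N%:R =
    H%:R * (5 * e1 * H%:R * N%:R) by ring.
  rewrite -[X in X%:R * _]card_ord mulr_natl -sumr_const.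
  apply: ler_sum => h _; apply: le_trans (Sh h) _.
  have NR : 0 <= N%:R :> R by [].
  have HR : 0 <= H%:R :> R by [].
  nra.
pose W x := \sum_(n < N) \sum_(h < H) c (n + h)%N * v (n + h)%N x.
have scv n : simple (fun x => c n * v n x) by exact: simpleZ.
have sW1 n : simple (fun x => \sum_(h < H) c (n + h)%N * v (n + h)%N x).
  exact: simple_sum.
have sW : simple W by exact: simple_sum.
pose Q := \sum_(n < N) \sum_(h < H) c (n + h)%N ^+ 2.
have QE : Q = mean mu (fun x => g x * W x).
  transitivity (mean mu (fun x => \sum_(n < N) \sum_(h < H)
      c (n + h)%N * (g x * v (n + h)%N x))).
    rewrite mean_sum => [|n _]; last by apply: simple_sum => h _; exact: simpleZ.
    apply: eq_bigr => n _; rewrite mean_sum => [|h _]; last exact: simpleZ.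
    by apply: eq_bigr => h _; rewrite meanZ// expr2.
  apply: mean_ext => x; rewrite /W mulr_sumr; apply: eq_bigr => n _.
  by rewrite mulr_sumr; apply: eq_bigr => h _; rewrite mulrCA.
have QS : Q ^+ 2 <= N%:R * S.
  rewrite QE; apply: le_trans (mean_CauchySchwarz mu sg sW g1) _.
  pose V x := N%:R * \sum_(n < N) (\sum_(h < H) c (n + h)%N * v (n + h)%N x) ^+ 2.
  have sV2 n : simple (fun x => (\sum_(h < H) c (n + h)%N * v (n + h)%N x) ^+ 2).
    exact: simpleM.
  have sV : simple V by apply: simpleZ; exact: simple_sum.
  apply: (@le_trans _ _ (mean mu V)).
    by apply: mean_le => //; [exact: simpleM|move=> x; exact: sqr_sum_le].
  rewrite meanZ ?ler_wpM2l//; last exact: simple_sum.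
  have scc i j : simple (fun x => c i * c j * (v i x * v j x)) by exact: simpleZ.
  have -> : mean mu (fun x => \sum_(n < N)
      (\sum_(h < H) c (n + h)%N * v (n + h)%N x) ^+ 2) =
      \sum_(n < N) \sum_(h < H) \sum_(h' < H) c (n + h)%N * c (n + h')%N *
        mean mu (fun x => v (n + h)%N x * v (n + h')%N x).
    rewrite mean_sum//; apply: eq_bigr => n _.
    transitivity (mean mu (fun x => \sum_(h < H) \sum_(h' < H)
      c (n + h)%N * c (n + h')%N * (v (n + h)%N x * v (n + h')%N x))).
      apply: mean_ext => x; rewrite expr2 mulr_suml; apply: eq_bigr => h _.
      by rewrite mulr_sumr; apply: eq_bigr => h' _; ring.
    rewrite mean_sum => [|h _]; last exact: simple_sum.
    apply: eq_bigr => h _; rewrite mean_sum//.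
    by apply: eq_bigr => h' _; rewrite meanZ.
  rewrite exchange_big/=; apply: ler_sum => h _.
  rewrite exchange_big/=; apply: ler_sum => h' _.
  apply: ler_sum => n _; apply: le_trans (ler_norm _) _.
  by rewrite normrM ler_piMl// normrM mulr_ile1.
(* Each of the [H] shifted sums of squares loses at most [H]. *)
have QH : H%:R * (\sum_(n < N) c n ^+ 2 - H%:R) <= Q.
  rewrite /Q exchange_big/= -[X in X%:R * _]card_ord mulr_natl -sumr_const.
  apply: ler_sum => h _.
  have := @sum_shift_le R (fun n => c n ^+ 2) h N c2.
  rewrite ler_norml => /andP[+ _].
  have : h%:R <= H%:R :> R by rewrite ler_nat ltnW.
  lra.
have HR : 0 < H%:R :> R.
  by rewrite -(pmulr_rgt0 _ e10) (lt_le_trans _ H1).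
have NR : 0 <= N%:R :> R by [].
have e1t : e1 <= t by rewrite ge_min lexx orbT.
have e1t2 : 5 * e1 <= t ^+ 2.
  by rewrite mulrC -ler_pdivlMr// ge_min lexx.
have Qt : Q <= t * H%:R * N%:R.
  rewrite -(@ler_pXn2r _ 2) ?nnegrE//; first last.
  - by rewrite !mulr_ge0// ltW.
  - by apply: sumr_ge0 => n _; apply: sumr_ge0 => h _; exact: sqr_ge0.
  apply: le_trans QS _; apply: le_trans (ler_wpM2l NR S5) _.
  rewrite [leLHS](_ : _ = 5 * e1 * (H%:R * N%:R) ^+ 2); last by ring.
  by rewrite -[X in _ <= X ^+ 2]mulrA [in leRHS]exprMn ler_wpM2r// sqr_ge0.
have -> : \sum_(i < N) `|c i ^+ 2| = \sum_(n < N) c n ^+ 2.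
  by apply: eq_bigr => i _; rewrite ger0_norm// sqr_ge0.
have : H%:R * (\sum_(n < N) c n ^+ 2 - H%:R) <= H%:R * (t * N%:R).
  by apply: le_trans QH _; rewrite mulrCA mulrA.
rewrite ler_pM2l// => h1.
have -> : e = t + t by rewrite /t -splitr.
nra.
Qed.

End VanDerCorput.

(** * Actions of the integers and weak mixing of pairs *)
Section Action.
Context {disp : measure_display} {X : measurableType disp} {R : realType}.
Context (mu : probability X R).

Record mp_action (th : int -> X -> X) : Prop := MpAction {
  act0 : forall x, th 0 x = x;
  actD : forall a b x, th (a + b) x = th a (th b x);
  act_measurable : forall z A, measurable A -> measurable (th z @^-1` A);
  act_mass : forall z A, measurable A -> mass mu (th z @^-1` A) = mass mu A }.

Definition mixing_action (th : int -> X -> X) : Prop :=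
  forall A, measurable A ->
    cesaro_null (fun n => mass mu (A `&` th n%:Z @^-1` A) - mass mu A ^+ 2).

Context (th : int -> X -> X) (thP : mp_action th).

Lemma indic_preimage A z x : \1_(th z @^-1` A) x = \1_A (th z x) :> R.
Proof. by rewrite !indicE; congr (nat_of_bool _)%:R; apply/idP/idP; rewrite !inE. Qed.

Lemma actDC a b x : th (a + b) x = th b (th a x).
Proof. by rewrite addrC (actD thP). Qed.

Lemma simple_act f z : simple f -> simple (fun x => f (th z x) : R).
Proof.
elim=> [A mA|f1 f2 _ IH1 _ IH2|c f1 _ IH1].
- apply: simple_ext (simple_indic (act_measurable thP z mA)) _ => x.
  exact: indic_preimage.
- exact: simpleD.
- exact: simpleZ.
Qed.

Lemma mean_act f z : simple f -> mean mu (fun x => f (th z x)) = mean mu f.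
Proof.
elim=> [A mA|f1 f2 s1 IH1 s2 IH2|c f1 s1 IH1].
- rewrite mean_indic// -(act_mass thP z mA) -mean_indic.
    by apply: mean_ext => x; rewrite indic_preimage.
  exact: act_measurable thP _ _ mA.
- rewrite (meanD mu s1 s2) -IH1 -IH2 -meanD//; exact: simple_act.
- rewrite (meanZ mu _ s1) -IH1 -meanZ//; exact: simple_act.
Qed.

(** Translate the argument by [z]. *)
Lemma mean_actN f z : simple f ->
  mean mu (fun x => f x * f (th (- z) x)) = mean mu (fun x => f x * f (th z x)).
Proof.
move=> sf; rewrite -(@mean_act (fun x => f x * f (th (- z) x)) z); last first.
  by apply: simpleM => //; exact: simple_act.
by apply: mean_ext => x; rewrite -(actD thP) addNr (act0 thP) mulrC.
Qed.

Lemma indic_01 (A : set X) x : 0 <= (\1_A x : R) <= 1.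
Proof. by rewrite indicE; case: (_ \in _); rewrite /= ?lexx ?ler01. Qed.

Lemma mass_ge0 (A : set X) : 0 <= mass mu A.
Proof. by rewrite fine_ge0. Qed.

Lemma mass_le1 A : measurable A -> mass mu A <= 1.
Proof. by move=> mA; rewrite -lee_fin -massE// probability_le1. Qed.

Context (thM : mixing_action th).

(** Weak mixing is a statement on the autocorrelation of a set.  The van der
    Corput inequality turns it into one on correlations with every [g]. *)
Lemma mixing_indic_unit A g : measurable A -> simple g ->
  (forall x, `|g x| <= 1) ->
  cesaro_null (fun n => mean mu (fun x => g x * (\1_A (th n%:Z x) - mass mu A))).
Proof.
move=> mA sg g1; have s1 := simple_indic mA : simple (\1_A : X -> R).
have sc c := @simple_cst _ X R c.
apply: (@van_der_Corput _ _ _ mu g _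
    (fun k => mass mu (A `&` th k%:Z @^-1` A) - mass mu A ^+ 2)) => //.
- move=> n; apply: simpleB => //; exact: (@simple_act _ n%:Z s1).
- move=> n x; have /andP[? ?] := indic_01 A (th n%:Z x).
  have := mass_ge0 A; have := mass_le1 mA.
  by rewrite ler_norml => *; apply/andP; split; lra.
- exact: thM.
move=> k k0; apply: (eq_cesaro_null cesaro_null0) => n.
pose w x := (\1_A x - mass mu A) * (\1_A (th k%:Z x) - mass mu A).
have s1k := simple_act k%:Z s1.
have sw : simple w by apply: simpleM; exact: simpleB.
have -> : mean mu (fun x => (\1_A (th n%:Z x) - mass mu A) *
    (\1_A (th (n + k)%N%:Z x) - mass mu A)) = mean mu w.
  by rewrite -(mean_act n%:Z sw); apply: mean_ext => x; rewrite /w PoszD actDC.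
have -> : mean mu w = mean mu (fun x => \1_A x * \1_A (th k%:Z x) +
    (- mass mu A * \1_A x + (- mass mu A * \1_A (th k%:Z x) + mass mu A ^+ 2))).
  by apply: mean_ext => x; rewrite /w; ring.
rewrite meanD ?meanD ?meanZ ?(mean_act _ s1) ?mean_cst ?mean_indic//.
  have -> : mean mu (fun x => \1_A x * \1_A (th k%:Z x)) =
            mass mu (A `&` th k%:Z @^-1` A).
    rewrite -mean_indic; first by apply: mean_ext => x; rewrite indicI/= indic_preimage.
    by apply: measurableI => //; exact: (act_measurable thP).
  by ring.
all: do ?[exact: simpleZ|exact: simpleM|exact: simple_cst|apply: simpleD].
Qed.

Lemma mixing_simple f g : simple f -> simple g ->
  cesaro_null (fun n =>
    mean mu (fun x => g x * f (th n%:Z x)) - mean mu g * mean mu f).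
Proof.
move=> sf sg; elim: sf => [A mA|f1 f2 s1 IH1 s2 IH2|c f1 s1 IH1].
- have s1 := simple_indic mA : simple (\1_A : X -> R).
  have [C hC] := simple_bounded sg.
  pose C1 := `|C| + 1; have C10 : 0 < C1 by rewrite ltr_wpDl.
  have g1 x : `|C1^-1 * g x| <= 1.
    rewrite normrM gtr0_norm ?invr_gt0// ler_pdivrMl// mulr1.
    by rewrite (le_trans (hC x))// (le_trans (ler_norm _))// lerDl.
  have := cesaro_nullZ C1 (mixing_indic_unit mA (simpleZ C1^-1 sg) g1).
  move/eq_cesaro_null; apply => n /=.
  have s1n := simple_act n%:Z s1.
  transitivity (mean mu (fun x => g x * \1_A (th n%:Z x) + - mass mu A * g x)).
    rewrite meanD ?meanZ ?mean_indic//; last exact: simpleZ.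
      by rewrite mulNr mulrC.
    exact: simpleM.
  rewrite -meanZ; last first.
    by apply: simpleM; [exact: simpleZ|apply: simpleB => //; exact: simple_cst].
  by apply: mean_ext => x; field; rewrite gt_eqF.
- have := cesaro_nullD IH1 IH2; move/eq_cesaro_null; apply => n /=.
  have [s1n s2n] := (simple_act n%:Z s1, simple_act n%:Z s2).
  have -> : mean mu (fun x => g x * (f1 (th n x) + f2 (th n x))) =
      mean mu (fun x => g x * f1 (th n x)) + mean mu (fun x => g x * f2 (th n x)).
    by rewrite -meanD; [apply: mean_ext => x; rewrite mulrDr|exact: simpleM..].
  by rewrite meanD//; ring.
- have := cesaro_nullZ c IH1; move/eq_cesaro_null; apply => n /=.
  have -> : mean mu (fun x => g x * (c * f1 (th n x))) =
      c * mean mu (fun x => g x * f1 (th n x)).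
    rewrite -meanZ; first by apply: mean_ext => x; rewrite mulrCA.
    by apply: simpleM => //; exact: simple_act.
  by rewrite meanZ//; ring.
Qed.

Lemma mixing_pair A B : measurable A -> measurable B ->
  cesaro_null (fun n => mass mu (B `&` th n%:Z @^-1` A) - mass mu B * mass mu A).
Proof.
move=> mA mB.
have := @mixing_simple \1_A \1_B (simple_indic mA) (simple_indic mB).
move/eq_cesaro_null; apply => n /=; rewrite !mean_indic//; congr (_ - _).
rewrite -mean_indic; first by apply: mean_ext => x; rewrite indicI/= indic_preimage.
by apply: measurableI => //; exact: (act_measurable thP).
Qed.

End Action.

(** * Families of polynomials *)
Section Polynomials.
Context {R : realType}.
Implicit Types (p q : {poly R}) (P : seq {poly R}).

Lemma int_valueE p n : integer_valued p -> (int_value p n)%:~R = p.[n%:R] :> R.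
Proof. by move=> /(_ n%:Z) /floorK. Qed.

Lemma int_value0 n : int_value (0 : {poly R}) n = 0.
Proof. by rewrite /int_value horner0 floor0. Qed.

Lemma integer_valuedB p q :
  integer_valued p -> integer_valued q -> integer_valued (p - q).
Proof. by move=> pz qz z; rewrite hornerD hornerN rpredB. Qed.

Lemma int_valueB p q n : integer_valued p -> integer_valued q ->
  int_value (p - q) n = int_value p n - int_value q n.
Proof.
move=> pz qz; apply: (@intr_inj R).
rewrite rmorphB/= !int_valueE//; last exact: integer_valuedB.
by rewrite hornerD hornerN.
Qed.

Lemma poly_eq0_on_multiples q (m : nat) :
  (0 < m)%N -> (forall j : nat, q.[(j * m)%:R] = 0) -> q = 0.
Proof.
move=> m0 q0; apply/eqP; apply/negPn/negP => qn0.
pose rs := [seq (j * m)%:R : R | j <- iota 0 (size q)].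
have : (size rs < size q)%N.
  apply: max_poly_roots => //.
    by apply/allP => _ /mapP[j _ ->]; rewrite rootE q0.
  rewrite map_inj_uniq ?iota_uniq// => i j /eqP.
  by rewrite eqr_nat eqn_pmul2r// => /eqP.
by rewrite size_map size_iota ltnn.
Qed.

(** Constants in the exponents are absorbed in the functions, so polynomials are
    normalized to vanish at 0 and families of them compared as plain lists. *)
Definition shiftp (k : nat) p := p \Po ('X + k%:R%:P) - p.[k%:R]%:P.

Lemma horner_shiftp k p x : (shiftp k p).[x] = p.[x + k%:R] - p.[k%:R].
Proof. by rewrite /shiftp hornerD hornerN horner_comp !hornerE. Qed.

Lemma shiftp_at0 k p : (shiftp k p).[0] = 0.
Proof. by rewrite horner_shiftp add0r subrr. Qed.

Lemma integer_valued_shiftp k p : integer_valued p -> integer_valued (shiftp k p).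
Proof.
move=> pz z; rewrite horner_shiftp rpredB//; last exact: (pz k%:Z).
by have := pz (z + k%:Z); rewrite rmorphD.
Qed.

Lemma int_value_shiftp k p n : integer_valued p ->
  int_value (shiftp k p) n = int_value p (n + k)%N - int_value p k.
Proof.
move=> pz; apply: (@intr_inj R).
rewrite rmorphB/= !int_valueE//; last exact: integer_valued_shiftp.
by rewrite horner_shiftp natrD.
Qed.

Let size_comp_shift k p : size (p \Po ('X + k%:R%:P)) = size p.
Proof. by rewrite size_comp_poly2// size_XaddC. Qed.

Lemma size_shiftp k p : (1 < size p)%N -> size (shiftp k p) = size p.
Proof.
move=> p1; rewrite /shiftp size_polyDl size_comp_shift// size_polyN.
by rewrite (leq_ltn_trans (size_polyC_leq1 _)).
Qed.

Lemma lead_coef_shiftp k p : (1 < size p)%N -> lead_coef (shiftp k p) = lead_coef p.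
Proof.
move=> p1; rewrite /shiftp lead_coefDl.
  by rewrite lead_coef_comp ?size_XaddC// lead_coefXaddC expr1n mulr1.
by rewrite size_comp_shift size_polyN (leq_ltn_trans (size_polyC_leq1 _)).
Qed.

Lemma size_gt1_normal p : p.[0] = 0 -> p != 0 -> (1 < size p)%N.
Proof.
move=> p00 p0; rewrite ltnNge; apply: contra p0 => /size1_polyC pE.
by move: p00; rewrite pE hornerC => ->.
Qed.

(** Only a polynomial of degree at most one differs from its translate by a
    constant: otherwise it would agree with an affine map on an arithmetic
    progression. *)
Lemma shiftp_inj p k l : (2 < size p)%N -> shiftp k p = shiftp l p -> k = l.
Proof.
move=> p2; wlog kl : k l / (k <= l)%N.
  move=> IH; have [kl|/ltnW kl] := leqP k l; first exact: IH.
  by move=> /esym/(IH _ _ kl)/esym.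
move=> e; apply/eqP; rewrite eqn_leq kl leqNgt; apply/negP => {}kl.
pose m := (l - k)%N; have m0 : (0 < m)%N by rewrite subn_gt0.
pose c := p.[l%:R] - p.[k%:R].
have pm y : p.[y + m%:R] = p.[y] + c.
  have := congr1 (fun q => q.[y - k%:R]) e; rewrite /= !horner_shiftp subrK.
  have -> : y - k%:R + l%:R = y + m%:R by rewrite /m natrB 1?ltnW//; ring.
  by rewrite /c => h; lra.
have pj (j : nat) : p.[(j * m)%:R] = p.[0] + j%:R * c.
  elim: j => [|j IH]; first by rewrite mul0n mul0r addr0.
  by rewrite mulSn addnC natrD pm IH -natr1; ring.
have m0R : m%:R != 0 :> R by rewrite pnatr_eq0 -lt0n.
pose q := p - (p.[0]%:P + (c / m%:R) *: 'X).
have q0 : q = 0.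
  apply: (poly_eq0_on_multiples m0) => j.
  rewrite /q !(hornerE, hornerZ) pj natrM.
  by field.
move: p2; have -> : p = p.[0]%:P + (c / m%:R) *: 'X by apply/eqP; rewrite -subr_eq0 -/q q0.
apply/negP; rewrite -leqNgt (leq_trans (size_polyD _ _))// geq_max.
by rewrite (leq_trans (size_polyC_leq1 _))//= (leq_trans (size_scale_leq _ _))// size_polyX.
Qed.

(** Bergelson's induction on families of polynomials is over the number of
    leading coefficients that occur in each degree, compared
    lexicographically from the highest degree down. *)
Definition lead_coefs r P := undup [seq lead_coef p | p <- P & size p == r.+1].

Definition weight P r := size (lead_coefs r P).

Definition weight_lt P' P := exists2 r, (weight P' r < weight P r)%N &
  forall r', (r < r')%N -> weight P' r' = weight P r'.

Lemma lead_coefsP r P c :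
  reflect (exists p, [/\ p \in P, size p = r.+1 & lead_coef p = c])
          (c \in lead_coefs r P).
Proof.
rewrite mem_undup; apply: (iffP mapP) => [[p]|[p [pP pr pc]]].
  by rewrite mem_filter => /andP[/eqP pr pP] ->; exists p.
by exists p => //; rewrite mem_filter pr eqxx.
Qed.

(** Induction on [D] shows that it is enough to go down at degrees at least
    [D], the number of leading coefficients in degree [D] serving for an inner
    induction; beyond the degrees of the family no descent is possible. *)
Lemma weight_ind (S : seq {poly R} -> Prop) :
  (forall P, (forall P', weight_lt P' P -> S P') -> S P) -> forall P, S P.
Proof.
move=> step.
have below D : forall P, (forall P' r, (D <= r)%N -> (weight P' r < weight P r)%N ->
    (forall r', (r < r')%N -> weight P' r' = weight P r') -> S P') -> S P.
  elim: D => [|D IHD] P hP.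
    by apply: step => P' [r r1 r2]; exact: (hP _ r).
  have [w] := ubnP (weight P D); elim: w => // w IHw in P hP *; rewrite ltnS => Pw.
  apply: IHD => P' r; rewrite leq_eqVlt => /predU1P[<-|Dr] r1 r2; last exact: (hP _ r).
  apply: IHw => [P'' r3 Dr3 r4 r5|]; last exact: leq_trans Pw.
  apply: (hP _ r3) => //; first by rewrite -(r2 _ Dr3).
  by move=> r' rr'; rewrite r5// r2// (ltn_trans _ rr').
move=> P; pose D := (\max_(p <- P) size p)%N.
apply: (below D) => P' r Dr; rewrite {2}/weight.
case lP: (lead_coefs r P) => [//|c s].
have /lead_coefsP[p [pP pr _]] : c \in lead_coefs r P by rewrite lP mem_head.
have := @leq_bigmax_seq _ _ predT (fun p : {poly R} => size p) _ pP isT.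
rewrite pr -/D => rD.
by rewrite ltnNge Dr in rD.
Qed.

(** The exponents, up to constants, in the correlation of the family at times
    [n] and [n + k], once [p1 n] has been subtracted by invariance. *)
Definition vdc_family p1 k (s : seq {poly R}) :=
  undup ([seq p - p1 | p <- s] ++ [seq shiftp k p - p1 | p <- s]).

(** Subtracting a member [p1] of minimal degree keeps the leading
    coefficients in higher degrees, and in the degree of [p1] it translates
    them by that of [p1], which itself disappears. *)
Lemma vdc_family_weight_lt p1 k P (s := [seq p <- P | p != 0]) :
  {in P, forall p, p.[0] = 0} -> p1 \in s ->
  {in s, forall p, (size p1 <= size p)%N} ->
  weight_lt (vdc_family p1 k s) P.
Proof.
move=> P0 p1s p1min.
have sgt p : p \in s -> (1 < size p)%N.
  by rewrite mem_filter => /andP[pn0 pP]; apply: size_gt1_normal => //; exact: P0.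
have fam q : q \in vdc_family p1 k s -> exists p p', [/\ p \in s, q = p' - p1,
    size p' = size p & lead_coef p' = lead_coef p].
  rewrite mem_undup mem_cat => /orP[|] /mapP[p ps ->].
    by exists p, p.
  by exists p, (shiftp k p); rewrite size_shiftp ?lead_coef_shiftp ?sgt.
have s1 : size p1 = (size p1).-1.+1 by have := sgt _ p1s; lia.
exists (size p1).-1.
  have p1l : lead_coef p1 \in lead_coefs (size p1).-1 P.
    apply/lead_coefsP; exists p1; split => //.
    by move: p1s; rewrite mem_filter => /andP[].
  have inj : injective (fun c : R => c + lead_coef p1) by exact: addIr.
  rewrite /weight -[X in (X < _)%N](size_map (fun c => c + lead_coef p1)).
  set t := map _ _.
  have ut : uniq (lead_coef p1 :: t).
    rewrite /= map_inj_uniq ?undup_uniq// andbT; apply/mapP => -[c].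
    move=> /lead_coefsP[q [_ qs <-]] /eqP; rewrite -subr_eq0 opprD addrC subrK oppr_eq0.
    by rewrite lead_coef_eq0 -size_poly_eq0 qs.
  apply: (uniq_leq_size ut) => c; rewrite inE => /predU1P[->//|].
  move=> /mapP[c' /lead_coefsP[q [qf qs <-]] ->].
  have [p [p' [ps qE p's p'l]]] := fam _ qf.
  have p1p : size p' = size p1.
    have := p1min _ ps; rewrite -p's leq_eqVlt => /predU1P[//|lt1].
    by move: qs; rewrite qE size_polyDl ?size_polyN// -s1.
  apply/lead_coefsP; exists p; split; first by move: ps; rewrite mem_filter => /andP[].
    by rewrite -p's p1p.
  rewrite -p'l qE /lead_coef -qE qs /= qE coefD coefN p1p.
  by rewrite subrK.
move=> r' lt1.
have s1r : (size p1 < r'.+1)%N by lia.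
apply: perm_size; apply: uniq_perm; rewrite ?undup_uniq// => c.
apply/lead_coefsP/lead_coefsP => -[q [qf qs <-]].
  have [p [p' [ps qE p's p'l]]] := fam _ qf.
  have lt' : (size p1 < size p')%N.
    rewrite ltnNge; apply/negP => le1; have := size_polyD p' (- p1).
    by rewrite -qE qs size_polyN leq_max => /orP[] le2;
      move: (leq_trans s1r le2); rewrite ltnNge ?le1 ?leqnn.
  exists p; split; first by move: ps; rewrite mem_filter => /andP[].
    by rewrite -p's -qs qE size_polyDl// size_polyN.
  by rewrite -p'l qE lead_coefDl// size_polyN.
exists (q - p1); split.
- rewrite mem_undup mem_cat (@map_f _ _ (fun p => p - p1))// mem_filter qf andbT.
  by rewrite -size_poly_eq0 qs.
- by rewrite size_polyDl// size_polyN qs.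
- by rewrite lead_coefDl// size_polyN qs.
Qed.

End Polynomials.

(** * Polynomial weak mixing *)
Lemma prod_fibers (R : comPzSemiRingType) (I J : eqType) (s : seq I) (t : seq J)
    (phi : I -> J) (G : I -> J -> R) :
  uniq t -> {in s, forall i, phi i \in t} ->
  \prod_(j <- t) \prod_(i <- s | phi i == j) G i j = \prod_(i <- s) G i (phi i).
Proof.
move=> ut st; rewrite (exchange_big_dep predT)//=.
apply: eq_big_seq => i si; rewrite -big_filter.
rewrite (eq_filter (a2 := pred1 (phi i))); last by move=> j; rewrite /= eq_sym.
by rewrite filter_pred1_uniq ?st// big_seq1.
Qed.

Section PolynomialMixing.
Context {disp : measure_display} {X : measurableType disp} {R : realType}.
Context (mu : probability X R) (th : int -> X -> X).
Context (thP : mp_action mu th) (thM : mixing_action mu th).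
Implicit Types (P s : seq {poly R}) (F : {poly R} -> X -> R).

Definition unit_simple (f : X -> R) := simple f /\ forall x, `|f x| <= 1.

Lemma norm_prod_le1 (I : Type) (s : seq I) (Q : pred I) (f : I -> R) :
  (forall i, `|f i| <= 1) -> `|\prod_(i <- s | Q i) f i| <= 1.
Proof.
by move=> f1; rewrite normr_prod; apply: prodr_ile1 => i _; rewrite normr_ge0 f1.
Qed.

Lemma unit_simple_prod (I : Type) (s : seq I) (Q : pred I) (f : I -> X -> R) :
  (forall i, unit_simple (f i)) ->
  unit_simple (fun x => \prod_(i <- s | Q i) f i x).
Proof.
move=> uf; split=> [|x]; first by apply: simple_prod => i _; exact: (uf i).1.
by apply: norm_prod_le1 => i; exact: (uf i).2.
Qed.

Lemma unit_simpleM f g :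
  unit_simple f -> unit_simple g -> unit_simple (fun x => f x * g x).
Proof.
move=> [sf f1] [sg g1]; split=> [|x]; first exact: simpleM.
by rewrite normrM mulr_ile1.
Qed.

Lemma unit_simple_act f z : unit_simple f -> unit_simple (fun x => f (th z x)).
Proof. by move=> [sf f1]; split=> //; exact: (simple_act thP). Qed.

Lemma unit_simple_cst c : `|c| <= 1 -> unit_simple (fun=> c).
Proof. by move=> c1; split=> //; exact: simple_cst. Qed.

Lemma unit_mean f : unit_simple f -> `|mean mu f| <= 1.
Proof. by move=> [sf f1]; exact: mean_norm_le. Qed.

Definition poly_mean F P n :=
  mean mu (fun x => \prod_(p <- P) F p (th (- int_value p n) x)).

Definition normal_family P :=
  {in P, forall p, integer_valued p /\ p.[0] = 0}.

Definition polynomially_mixing P := uniq P -> normal_family P ->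
  forall F, (forall p, unit_simple (F p)) ->
  cesaro_null (fun n => poly_mean F P n - \prod_(p <- P) mean mu (F p)).

Lemma linear_normalE (p : {poly R}) :
  size p = 2 -> p.[0] = 0 -> p = lead_coef p *: 'X.
Proof.
move=> p2 p0; apply/polyP => i; rewrite coefZ coefX lead_coefE p2/=.
case: i => [|[|i]]; rewrite ?mulr1 ?mulr0//.
  by rewrite -horner_coef0.
by rewrite nth_default// p2.
Qed.

Lemma shiftp_linear k (p : {poly R}) : size p = 2 -> p.[0] = 0 -> shiftp k p = p.
Proof.
move=> p2 p0; rewrite (linear_normalE p2 p0) /shiftp comp_polyZ comp_polyX.
by rewrite hornerZ hornerX scalerDr polyCM mul_polyC addrK.
Qed.

(** van der Corput differencing at step [k], after subtracting [p1] by
    invariance: factors that now share a polynomial are grouped into one. *)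
Definition vdc_function F p1 k s (q : {poly R}) (x : X) : R :=
  (\prod_(p <- s | p - p1 == q) F p x) *
  (\prod_(p <- s | shiftp k p - p1 == q) F p (th (- int_value p k) x)).

Lemma unit_vdc_function F p1 k s q :
  (forall p, unit_simple (F p)) -> unit_simple (vdc_function F p1 k s q).
Proof.
move=> uF; apply: unit_simpleM; apply: unit_simple_prod => // p.
exact: unit_simple_act.
Qed.

Lemma vdc_mean F p1 k s n : normal_family s -> p1 \in s ->
  (forall p, unit_simple (F p)) ->
  mean mu (fun x => (\prod_(p <- s) F p (th (- int_value p n) x)) *
                    (\prod_(p <- s) F p (th (- int_value p (n + k)) x))) =
  poly_mean (vdc_function F p1 k s) (vdc_family p1 k s) n.
Proof.
move=> ns p1s uF.
pose w x := (\prod_(p <- s) F p (th (- int_value p n) x)) *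
            (\prod_(p <- s) F p (th (- int_value p (n + k)) x)).
have [sw _] : unit_simple w.
  by apply: unit_simpleM; apply: unit_simple_prod => p; exact: unit_simple_act.
rewrite -[LHS](mean_act thP (int_value p1 n) sw); apply: mean_ext => x.
rewrite big_split/= (prod_fibers (phi := fun p => p - p1)) ?undup_uniq//; last first.
  by move=> p ps; rewrite mem_undup mem_cat (@map_f _ _ (fun p => p - p1)).
rewrite (prod_fibers (phi := fun p => shiftp k p - p1)
  (fun p q => F p (th (- int_value p k) (th (- int_value q n) x)))) ?undup_uniq//;
  last first.
  move=> p ps; rewrite mem_undup mem_cat; apply/orP; right.
  exact: (@map_f _ _ (fun p => shiftp k p - p1)).
have [p1z _] := ns _ p1s.
congr (_ * _); apply: eq_big_seq => p ps; have [pz _] := ns _ ps.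
  by rewrite int_valueB// opprB -!(actD thP) addrC.
rewrite int_valueB//; last exact: integer_valued_shiftp.
by rewrite int_value_shiftp// -!(actD thP); congr (F p (th _ x)); ring.
Qed.

(** The limit correlations of the differenced family are null in [k]: the
    polynomial [p0 - p1] carries the mean zero function [F p0], multiplied by
    a translate of [F p] only when [shiftp k p = p0].  For nonlinear [p0] this
    happens for at most one [k], and for linear [p0] it leaves the
    autocorrelation of [F p0], null by weak mixing. *)
Lemma vdc_limit_null F s p0 p1 : uniq s -> normal_family s ->
  {in s, forall p, p != 0} -> (forall p, unit_simple (F p)) ->
  p0 \in s -> mean mu (F p0) = 0 ->
  cesaro_null (fun k =>
    \prod_(q <- vdc_family p1 k s) mean mu (vdc_function F p1 k s q)).
Proof.
move=> us ns s0 uF p0s m0.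
have sgt p : p \in s -> (1 < size p)%N.
  by move=> ps; apply: size_gt1_normal; [exact: (ns _ ps).2|exact: s0].
pose h k x := F p0 x * \prod_(p <- s | shiftp k p == p0) F p (th (- int_value p k) x).
have hE k : mean mu (vdc_function F p1 k s (p0 - p1)) = mean mu (h k).
  apply: mean_ext => x; rewrite /vdc_function /h; congr (_ * _).
    rewrite -big_filter (eq_filter (a2 := pred1 p0)) ?filter_pred1_uniq ?big_seq1//.
    by move=> p /=; rewrite (inj_eq (@addIr _ _)).
  by apply: eq_bigl => p; rewrite (inj_eq (@addIr _ _)).
have Lh k : `|\prod_(q <- vdc_family p1 k s) mean mu (vdc_function F p1 k s q)|
    <= `|mean mu (h k)|.
  rewrite (bigD1_seq (p0 - p1))/=; first last.
  - exact: undup_uniq.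
  - by rewrite mem_undup mem_cat (@map_f _ _ (fun p => p - p1)).
  rewrite normrM hE ler_piMr// norm_prod_le1// => q.
  by apply: unit_mean; exact: unit_vdc_function.
have uh k : unit_simple (h k).
  by apply: unit_simpleM => //; apply: unit_simple_prod => p; exact: unit_simple_act.
apply: cesaro_null_le (_ : cesaro_null (fun k => mean mu (h k))) Lh.
have [s0F _] := uF p0.
have [p0z p00] := ns _ p0s.
have [p2|p2] := leqP (size p0) 2.
  have {}p2 : size p0 = 2 by apply/eqP; rewrite eqn_leq p2 sgt.
  have p0E := linear_normalE p2 p00.
  pose m := int_value p0 1.
  have mk k : int_value p0 k = m * k%:Z.
    apply: (@intr_inj R); rewrite rmorphM/= !int_valueE// p0E !hornerZ !hornerX.
    by rewrite mulr1.
  have m_gt0 : (0 < `|m|)%N.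
    rewrite absz_gt0; apply/eqP => me; have : lead_coef p0 = 0.
      have := int_valueE 1 p0z; rewrite -/m me {1}p0E hornerZ hornerX mulr1.
      by move=> <-.
    by move/eqP; rewrite lead_coef_eq0 -size_poly_eq0 p2.
  have := mixing_simple thP thM s0F s0F.
  move=> /(cesaro_null_dilate m_gt0)/eq_cesaro_null; apply => k /=.
  rewrite m0 mul0r subr0.
  transitivity (mean mu (fun x => F p0 x * F p0 (th (- int_value p0 k) x))).
    apply: mean_ext => x; rewrite /h; congr (_ * _).
    rewrite -big_filter (@eq_in_filter _ _ (pred1 p0)).
      by rewrite filter_pred1_uniq// big_seq1.
    move=> p ps /=; apply/eqP/eqP => [e|->].
      have ps2 : size p = 2 by rewrite -p2 -e size_shiftp// sgt.
      by rewrite -e shiftp_linear// (ns _ ps).2.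
    exact: shiftp_linear.
  rewrite mk PoszM; have [m0'|m0'] := leP 0 m.
    by rewrite (mean_actN thP)// gez0_abs.
  by rewrite ltz0_abs// mulNr.
pose a (p : {poly R}) k : R := ((2 < size p)%N && (shiftp k p == p0))%:R.
apply: (@cesaro_null_le _ _ (fun k => \sum_(p <- s) a p k)) => [|k].
  apply: cesaro_null_sum => p; apply: (@cesaro_null_bounded_sum _ 1) => N.
  have [[k0]|none] := pselect (exists k, (2 < size p)%N && (shiftp k p == p0)).
    move=> /andP[ps /eqP k0E].
    apply: (@le_trans _ _ (\sum_(k < N) ((k : nat) == k0)%:R)).
      apply: ler_sum => k _; rewrite /a normr_nat ler_nat ps/=.
      case: eqP => //= kE; case: eqP => //=; case.
      by apply: (shiftp_inj ps); rewrite k0E.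
    have [kN|kN] := ltnP k0 N.
      rewrite (bigD1 (Ordinal kN))//= eqxx big1 ?addr0// => k /negbTE.
      by rewrite -val_eqE/= => ->.
    rewrite big1// => k _; case: eqP => // kk0.
    by have := ltn_ord k; rewrite kk0 ltnNge kN.
  rewrite big1// => k _; rewrite /a; case: (boolP (_ && _)) => [hk|_]; rewrite ?normr0//.
  by case: none; exists k.
have a0 p : 0 <= a p k by [].
rewrite [leRHS]ger0_norm ?sumr_ge0//.
have [/hasP[p ps pk]|/hasPn none] := boolP (has (fun p => shiftp k p == p0) s).
  rewrite (big_rem p)//= (le_trans (unit_mean (uh k)))//.
  have ps2 : (2 < size p)%N by move/eqP: pk => pk; rewrite -(size_shiftp k) ?sgt ?pk.
  by rewrite {1}/a ps2 pk lerDl sumr_ge0.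
rewrite (_ : mean mu (h k) = 0) ?normr0 ?sumr_ge0//.
rewrite -m0; apply: mean_ext => x; rewrite /h -big_filter.
rewrite (@eq_in_filter _ _ pred0) ?filter_pred0 ?big_nil ?mulr1// => p ps.
exact/negbTE/none.
Qed.

(** The van der Corput inequality with the family differenced by a member [p1]
    of minimal degree, which has smaller weight. *)
Lemma poly_mean_null P F p0 :
  (forall P', weight_lt P' P -> polynomially_mixing P') ->
  uniq P -> normal_family P -> (forall p, unit_simple (F p)) ->
  p0 \in P -> p0 != 0 -> mean mu (F p0) = 0 -> cesaro_null (poly_mean F P).
Proof.
move=> IH uP nP uF p0P p00 m0.
pose s := [seq p <- P | p != 0].
have sP : {subset s <= P} by move=> p; rewrite mem_filter => /andP[].
have us : uniq s by rewrite filter_uniq.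
have ns : normal_family s by move=> p /sP; exact: nP.
have p0s : p0 \in s by rewrite mem_filter p00.
have s0 : {in s, forall p, p != 0} by move=> p; rewrite mem_filter => /andP[].
have [p1 p1s p1min] : exists2 p1, p1 \in s &
    {in s, forall p : {poly R}, (size p1 <= size p)%N}.
  have exm : exists m, has (fun p : {poly R} => size p == m) s.
    by exists (size p0); apply/hasP; exists p0.
  have [m /hasP[p1 p1s /eqP p1m] mmin] := ex_minnP exm.
  by exists p1 => // p ps; rewrite p1m mmin//; apply/hasP; exists p.
pose v n x := \prod_(p <- s) F p (th (- int_value p n) x).
pose g x := \prod_(p <- P | p == 0) F p x.
have [sg g1] : unit_simple g by exact: unit_simple_prod.
have uv n : unit_simple (v n).
  by apply: unit_simple_prod => p; exact: unit_simple_act.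
apply: (@eq_cesaro_null _ _ (fun n => mean mu (fun x => g x * v n x))); last first.
  move=> n; apply: mean_ext => x; rewrite (bigID (fun p => p == 0))/= /v big_filter.
  congr (_ * _); apply: eq_bigr => p /eqP ->.
  by rewrite int_value0 oppr0 (act0 thP).
apply: (van_der_Corput (mu := mu) sg g1 (fun n => (uv n).1) (fun n => (uv n).2)
  (vdc_limit_null p1 us ns s0 uF p0s m0)) => k k0.
have wlt := vdc_family_weight_lt k (fun p pP => (nP p pP).2) p1s p1min.
have nf : normal_family (vdc_family p1 k s).
  move=> q; have [p1z p10] := ns _ p1s.
  rewrite mem_undup mem_cat => /orP[|] /mapP[p /ns[pz p0'] ->].
    by split; [exact: integer_valuedB|rewrite !hornerE p0' p10 subrr].
  split; last by rewrite hornerD hornerN shiftp_at0 p10 subrr.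
  by apply: integer_valuedB => //; exact: integer_valued_shiftp.
have := IH _ wlt (undup_uniq _) nf _ (fun q => unit_vdc_function p1 k s q uF).
by move/eq_cesaro_null; apply => n; rewrite -(vdc_mean k n ns p1s uF).
Qed.

(** Replacing the functions one by one by their means reduces the claim to a
    mean zero function at one nonzero polynomial. *)
Theorem polynomial_mixing P : polynomially_mixing P.
Proof.
move: P; apply: weight_ind => P IH uP nP F uF.
pose m p := mean mu (F p).
have um p : unit_simple (fun=> m p).
  by apply: unit_simple_cst; exact: unit_mean.
pose Ft (t : seq {poly R}) p := if p \in t then (fun=> m p) else F p.
have uFt t p : unit_simple (Ft t p) by rewrite /Ft; case: ifP.
have repl (t : seq {poly R}) : {in t, forall p, p \in P /\ p != 0} ->
    cesaro_null (fun n => poly_mean F P n - poly_mean (Ft t) P n).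
  elim: t => [|p0 t IHt] tP.
    by apply: (eq_cesaro_null (cesaro_null0 (R := R))) => n; rewrite subrr.
  have [p0P p00] := tP p0 (mem_head _ _).
  have {}IHt := IHt (fun p pt => tP p (mem_behead (s := p0 :: t) pt)).
  have [p0t|p0t] := boolP (p0 \in t).
    move: IHt => /eq_cesaro_null; apply => n; rewrite (_ : Ft _ = Ft t)//.
    by apply/funext => p; rewrite /Ft inE; case: eqP => [->|//]; rewrite p0t.
  pose F0 p : X -> R := if p == p0 then (fun x => 2^-1 * (F p0 x - m p0)) else Ft t p.
  have s0 : simple (fun x => F p0 x - m p0).
    by apply: simpleB; [exact: (uF p0).1|exact: simple_cst].
  have uF0 p : unit_simple (F0 p).
    rewrite /F0; case: ifP => // _; split; first exact: simpleZ.
    move=> x; have [_ /(_ x)] := uF p0; have := unit_mean (uF p0).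
    rewrite -/(m p0) !ler_norml => /andP[? ?] /andP[? ?].
    by apply/andP; split; lra.
  have mF0 : mean mu (F0 p0) = 0.
    rewrite /F0 eqxx meanZ// meanB ?mean_cst ?subrr ?mulr0//; last exact: simple_cst.
    exact: (uF p0).1.
  have := cesaro_nullD IHt (cesaro_nullZ 2 (poly_mean_null IH uP nP uF0 p0P p00 mF0)).
  move/eq_cesaro_null; apply => n /=.
  rewrite -[LHS](subrKA (poly_mean (Ft t) P n)); congr (_ + _).
  have sm F' : (forall p, unit_simple (F' p)) ->
      simple (fun x => \prod_(p <- P) F' p (th (- int_value p n) x)).
    by move=> uF'; apply: (unit_simple_prod _ _ (fun p => unit_simple_act _ (uF' p))).1.
  have [s1 s2 s3] := And3 (sm _ (uFt t)) (sm _ (uFt (p0 :: t))) (sm _ uF0).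
  rewrite /poly_mean -(meanB mu s1 s2) -(meanZ mu _ s3); apply: mean_ext => x.
  have Ft1 : Ft t p0 = F p0 by rewrite /Ft (negbTE p0t).
  have Ft2 : Ft (p0 :: t) p0 = fun=> m p0 by rewrite /Ft mem_head.
  have F0E : F0 p0 = fun x => 2^-1 * (F p0 x - m p0) by rewrite /F0 eqxx.
  rewrite !(bigD1_seq p0)//= Ft1 Ft2 F0E.
  set a := \prod_(p <- P | p != p0) _; set b := \prod_(p <- P | p != p0) _.
  set c := \prod_(p <- P | p != p0) _.
  have -> : b = a by apply: eq_bigr => p pp; rewrite /Ft inE (negbTE pp).
  have -> : c = a by apply: eq_bigr => p pp; rewrite /F0 (negbTE pp).
  by field.
pose s := [seq p <- P | p != 0].
have := repl s; move=> /(_ _)/eq_cesaro_null; apply.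
  by move=> p; rewrite mem_filter => /andP[].
move=> n; congr (_ - _); rewrite /poly_mean.
have meanP0 : \prod_(p <- P | p == 0) mean mu (F p) =
    mean mu (fun x => \prod_(p <- P | p == 0) F p x).
  rewrite -big_filter; have [P0|P0] := boolP (0 \in P).
    rewrite (filter_pred1_uniq uP P0) big_seq1; apply: mean_ext => x.
    by rewrite -big_filter (filter_pred1_uniq uP P0) big_seq1.
  have P00 : [seq p <- P | p == 0] = [::].
    apply/eqP; rewrite -[_ == _]negbK -has_filter; apply: contra P0 => /hasP[p pP /eqP p0].
    by rewrite -p0.
  rewrite P00 big_nil -[LHS](mean_cst mu); apply: mean_ext => x.
  by rewrite -big_filter P00 big_nil.
rewrite (bigID (fun p => p == 0))/= meanP0 mulrC -meanZ; last first.
  by apply: simple_prod => p _; exact: (uF p).1.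
apply: mean_ext => x; rewrite [RHS](bigID (fun p => p == 0))/= [RHS]mulrC; congr (_ * _).
  rewrite big_seq_cond [RHS]big_seq_cond; apply: eq_bigr => p /andP[pP p0].
  by rewrite /Ft mem_filter p0 pP.
apply: eq_bigr => p /eqP->; rewrite /Ft mem_filter eqxx/=.
by rewrite int_value0 oppr0 (act0 thP).
Qed.

End PolynomialMixing.

(** * Divisibility of polynomial values *)
Section Divisibility.
Context {R : realType}.
Implicit Types (p q : {poly R}).

Lemma fact_multiple (W x y : nat) : x != y -> (x < W + y)%N -> (y < W + x)%N ->
  exists j : int, W`!%:R = j%:~R * (x%:R - y%:R) :> R.
Proof.
move=> xy xW yW; have [lt|gt|/eqP e] := ltngtP x y; last by rewrite e in xy.
- have /dvdnP[j jE] : (y - x %| W`!)%N by apply: dvdn_fact; lia.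
  by exists (- j%:Z); rewrite jE natrM natrB 1?ltnW// mulrNz; ring.
- have /dvdnP[j jE] : (x - y %| W`!)%N by apply: dvdn_fact; lia.
  by exists j%:Z; rewrite jE natrM natrB 1?ltnW.
Qed.

(** Divided differences: each difference quotient is integral up to the
    factor [W`!], because the nodes are at distance less than [W]. *)
Lemma lead_coef_multiple (Q W g : nat) p (s : seq nat) (w : nat) :
  size p = g.+1 -> uniq s -> size s = g.+1 ->
  {in s, forall x, (w <= x < w + W)%N} ->
  {in s, forall x, exists k : int, p.[x%:R] = Q%:R * k%:~R} ->
  exists k : int, lead_coef p * W`!%:R ^+ g = Q%:R * k%:~R.
Proof.
elim: g p s => [|g IH] p [//|x0 s] ps us [ss] sW sQ.
  have [k kE] := sQ x0 (mem_head _ _).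
  exists k; rewrite expr0 mulr1 -kE [in RHS](size1_polyC (eq_leq ps)) hornerC.
  by rewrite lead_coefE ps.
have /factor_theorem[q qE] : root (p - p.[x0%:R]%:P) x0%:R.
  by rewrite rootE !hornerE subrr.
have Xn0 : 'X - x0%:R%:P != 0 :> {poly R} by rewrite polyXsubC_eq0.
have sp : size (p - p.[x0%:R]%:P) = g.+2.
  by rewrite size_polyDl// size_polyN ps (leq_ltn_trans (size_polyC_leq1 _)).
have qn0 : q != 0.
  by apply/eqP => q0; move: sp; rewrite qE q0 mul0r size_poly0.
have sq : size q = g.+1.
  by move: sp; rewrite qE size_Mmonic ?monicXsubC// size_XsubC addn2 => -[].
have lq : lead_coef q = lead_coef p.
  rewrite -[RHS](@lead_coefDl _ p (- p.[x0%:R]%:P)); last first.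
    by rewrite size_polyN ps (leq_ltn_trans (size_polyC_leq1 _)).
  by rewrite qE lead_coef_Mmonic// monicXsubC.
have W0 : W`!%:R != 0 :> R by rewrite pnatr_eq0 -lt0n fact_gt0.
move: us => /= /andP[x0s us].
have [k kE] : exists k : int, lead_coef (W`!%:R *: q) * W`!%:R ^+ g = Q%:R * k%:~R.
  apply: (IH _ s) => //; first by rewrite size_scale.
    by move=> x xs; apply: sW; rewrite inE xs orbT.
  move=> x xs; have xx0 : x != x0 by apply: contraNneq x0s => <-.
  have /andP[wx xW] : (w <= x < w + W)%N by apply: sW; rewrite inE xs orbT.
  have /andP[wx0 x0W] : (w <= x0 < w + W)%N by apply: sW; rewrite mem_head.
  have [j jE] := @fact_multiple W x x0 xx0 ltac:(lia) ltac:(lia).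
  have [k1 k1E] : exists k : int, p.[x%:R] = Q%:R * k%:~R.
    by apply: sQ; rewrite inE xs orbT.
  have [k2 k2E] := sQ x0 (mem_head _ _).
  exists (j * (k1 - k2)); rewrite hornerZ jE -mulrA (mulrC _ q.[_]).
  have -> : q.[x%:R] * (x%:R - x0%:R) = p.[x%:R] - p.[x0%:R].
    by have := congr1 (fun r => r.[x%:R]) qE; rewrite /= !hornerE => ->.
  by rewrite k1E k2E rmorphM rmorphB/=; ring.
by exists k; rewrite -kE lead_coefZ lq exprS; ring.
Qed.

Lemma window_count (Q W g : nat) p (w : nat) : integer_valued p ->
  size p = g.+1 -> `|lead_coef p| * W`!%:R ^+ g < Q%:R ->
  (count (fun x => (Q%:Z %| int_value p x)%Z) (iota w W) <= g)%N.
Proof.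
move=> pz ps Qbig; rewrite leqNgt; apply/negP => cg.
pose s := take g.+1 [seq x <- iota w W | (Q%:Z %| int_value p x)%Z].
have sub : {subset s <= [seq x <- iota w W | (Q%:Z %| int_value p x)%Z]}.
  by move=> x; exact: mem_take.
have [k kE] : exists k : int, lead_coef p * W`!%:R ^+ g = Q%:R * k%:~R.
  apply: (@lead_coef_multiple _ _ _ _ s w) => //.
  - by rewrite take_uniq// filter_uniq// iota_uniq.
  - by rewrite size_takel// size_filter.
  - by move=> x /sub; rewrite mem_filter mem_iota => /andP[].
  - move=> x /sub; rewrite mem_filter => /andP[/dvdzP[k kE] _].
    by exists k; rewrite -int_valueE// kE rmorphM/= mulrC.
have W0 : 0 < W`!%:R :> R by rewrite ltr0n fact_gt0.
have kn0 : k != 0.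
  apply/eqP => k0; move/eqP: kE; rewrite k0 mulr0 mulf_eq0 lead_coef_eq0.
  rewrite -size_poly_eq0 ps/= expf_eq0 => /andP[_ /eqP W00].
  by rewrite W00 ltxx in W0.
move: Qbig; rewrite -[X in _ * X]ger0_norm ?exprn_ge0// -normrM kE normrM.
rewrite normr_nat ltNge ler_peMr//.
by rewrite -intr_norm ler1z -gtz0_ge1 normr_gt0 kn0.
Qed.

(** A window of length [W] contains at most [deg p] times with [2 ^ i] dividing
    the value of [p], once [2 ^ i] exceeds a bound depending on [p] and [W]
    only.  It remains to take [W] large. *)
Lemma rarely_divisible p (eta : R) : integer_valued p -> nonconstant p -> 0 < eta ->
  exists i N0, forall N, (N0 <= N)%N ->
    \sum_(n < N) (((2 ^ i)%N%:Z %| int_value p n)%Z)%:R <= eta * N%:R.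
Proof.
move=> pz p1 eta0; pose g := (size p).-1.
have ps : size p = g.+1 by move: p1; rewrite /nonconstant /g; case: size.
pose W := (Num.bound (2 * g%:R / eta)).+1.
have gW : 2 * g%:R / eta <= W%:R.
  have : 2 * g%:R / eta < (Num.bound (2 * g%:R / eta))%:R.
    by rewrite archi_boundP// divr_ge0 ?mulr_ge0// ltW.
  by move=> /ltW/le_trans; apply; rewrite ler_nat /W.
pose i := Num.bound (`|lead_coef p| * W`!%:R ^+ g).
exists i, W => N WN.
pose b n := ((2 ^ i)%N%:Z %| int_value p n)%Z.
have wc w : (count b (iota w W) <= g)%N.
  apply: window_count => //.
  apply: (@lt_trans _ _ i%:R); last by rewrite ltr_nat ltn_expl.
  by rewrite archi_boundP// mulr_ge0// exprn_ge0.
have blocks M : (\sum_(0 <= n < W * M) b n <= g * M)%N.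
  elim: M => [|M IH]; first by rewrite muln0 big_geq.
  rewrite mulnS addnC (@big_cat_nat _ _ _ (W * M)%N)//= ?leq_addr//.
  rewrite mulnS addnC leq_add//; apply: leq_trans (wc (W * M)%N).
  rewrite -sum1_count /index_iota addKn [leqRHS]big_mkcond/=.
  by apply: leq_sum => n _; case: (b n).
have : \sum_(n < N) (b n)%:R <= (g * (N %/ W).+1)%N%:R :> R.
  rewrite -natr_sum ler_nat; apply: leq_trans (blocks _).
  rewrite -(big_mkord predT (fun n => b n : nat)).
  rewrite (@big_cat_nat _ _ _ N 0 (W * (N %/ W).+1)%N)//= ?leq_addr//.
  by rewrite mulnC ltnW// ltn_ceil.
move=> /le_trans; apply.
have NW : (W * (N %/ W).+1)%N%:R <= 2 * N%:R :> R.
  rewrite -natrM ler_nat mulnS mulnC.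
  by have := leq_trunc_div N W; lia.
have W0 : 0 < W%:R :> R by rewrite ltr0n.
have g2 : 2 * g%:R <= eta * W%:R by rewrite (mulrC eta) -ler_pdivrMr.
have g0 : 0 <= g%:R :> R by [].
rewrite natrM; move: NW; rewrite natrM; set m := _.+1%:R => NW.
rewrite -(ler_pM2l W0) [leLHS](_ : _ = g%:R * (W%:R * m)); last by ring.
apply: le_trans (ler_wpM2l g0 NW) _.
rewrite [leLHS](_ : _ = 2 * g%:R * N%:R); last by ring.
by rewrite [leRHS](_ : _ = eta * W%:R * N%:R); [rewrite ler_wpM2r|ring].
Qed.

End Divisibility.

(** * The action generated by an invertible transformation *)

Section PowersOfT.
Context {disp : measure_display} {X : measurableType disp} {R : realType}.
Context (mu : probability X R).
Implicit Types (A : set X).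

Lemma action_of (T : X -> X) : invertible_measure_preserving mu T ->
  exists th : int -> X -> X, mp_action mu th /\
    forall z A, zimage T z A = th (- z) @^-1` A.
Proof.
move=> [[S TK SK] mT iT pT].
pose th (z : int) := match z with Posz n => iter n T | Negz n => iter n.+1 S end.
have th_succ z x : th (z + 1) x = T (th z x).
  case: z => [n|[|n]].
  - by rewrite -PoszD addn1.
  - by rewrite /= SK.
  - by rewrite (_ : Negz n.+1 + 1 = Negz n) /= ?SK//; lia.
have th_pred z x : th (z - 1) x = S (th z x).
  by rewrite -[in RHS](subrK 1 z) th_succ TK.
have thD a b x : th (a + b) x = th a (th b x).
  elim: a => [|n IH|n IH]; first by rewrite add0r.
  - by rewrite -addn1 PoszD addrAC !th_succ IH.
  - by rewrite -addn1 PoszD opprD addrAC !th_pred IH.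
have SE A : S @^-1` A = T @` A.
  apply/seteqP; split => [x Sx|x [y Ay <-]]; last by rewrite /= TK.
  by exists (S x); rewrite ?SK.
have measT A : measurable A -> measurable (T @^-1` A).
  by move=> mA; rewrite -[X in measurable X]setTI; exact: mT.
have measS A : measurable A -> measurable (S @^-1` A).
  by rewrite SE; exact: iT.
have pS A : measurable A -> mu (S @^-1` A) = mu A.
  move=> mA; rewrite -pT; last exact: measS.
  by congr (mu _); apply/seteqP; split=> x /=; rewrite TK.
exists th; split; last first.
  move=> z A; case: z => [n|n]; last by rewrite NegzE opprK.
  have iS m x : iter m S (iter m T x) = x.
    by elim: m x => // m IH x; rewrite iterS (iterSr m T) IH TK.
  have iT' m x : iter m T (iter m S x) = x.
    by elim: m x => // m IH x; rewrite iterS (iterSr m S) IH SK.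
  apply/seteqP; split => [_ [x Ax <-]|x].
    case: n => [//|n]; change (A (iter n.+1 S (iter n.+1 T x))).
    by rewrite iS.
  by case: n => [|n] Ax; [exists x|exists (iter n.+1 S x); rewrite ?iT'].
have iter_pres f n A : (forall A, measurable A -> measurable (f @^-1` A)) ->
    (forall A, measurable A -> mu (f @^-1` A) = mu A) -> measurable A ->
    measurable (iter n f @^-1` A) /\ mu (iter n f @^-1` A) = mu A.
  move=> mf pf; elim: n A => [|n IH] A mA; first by [].
  have [h1 h2] := IH _ (mf _ mA).
  by split; rewrite (_ : _ @^-1` A = iter n f @^-1` (f @^-1` A))// h2 pf.
split => // z A mA; rewrite /mass /th; case: z => n.
- exact: (iter_pres _ _ _ measT pT mA).1.
- exact: (iter_pres _ n.+1 _ measS pS mA).1.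
- by rewrite (iter_pres _ _ _ measT pT mA).2.
- by rewrite (iter_pres _ n.+1 _ measS pS mA).2.
Qed.

Lemma density_defect (E : set nat) N : (0 < N)%N ->
  `|1 - #|[pred i : 'I_N | (i : nat) \in E]|%:R / N%:R| =
  (\sum_(n < N) `|((n : nat) \notin E)%:R|) / N%:R :> R.
Proof.
move=> N0; have NR : 0 < N%:R :> R by rewrite ltr0n.
have -> : (#|[pred i : 'I_N | (i : nat) \in E]|)%:R =
    N%:R - \sum_(n < N) `|((n : nat) \notin E)%:R| :> R.
  have -> : N%:R = \sum_(n < N) 1 :> R by rewrite sumr_const card_ord.
  rewrite -sum1_card big_mkcond/= natr_sum -sumrB.
  apply: eq_bigr => i _; rewrite normr_nat inE/=.
  by case: ((i : nat) \in E); rewrite /= ?subr0 ?subrr.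
rewrite mulrBl divff ?gt_eqF// opprB addrC subrK ger0_norm//.
by rewrite divr_ge0// sumr_ge0.
Qed.

Lemma density_oneP (E : set nat) :
  density_one R E <-> cesaro_null (fun n => ((n : nat) \notin E)%:R : R).
Proof.
split=> dE.
  move=> e e0; have [N0 _ hN0] := (cvgrPdist_le _ _).1 dE _ e0.
  exists N0.+1 => N N0N; have := hN0 N (ltnW N0N).
  have NR : 0 < N%:R :> R by rewrite ltr0n (leq_trans _ N0N).
  by rewrite density_defect ?ler_pdivrMr// (leq_trans _ N0N).
apply/cvgrPdist_le => e e0; have [N0 hN0] := dE _ e0.
exists N0.+1 => // N /= N0N; have := hN0 N (ltnW N0N).
have NR : 0 < N%:R :> R by rewrite ltr0n (leq_trans _ N0N).
by rewrite density_defect ?ler_pdivrMr// (leq_trans _ N0N).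
Qed.

Lemma weakly_mixing_action (T : X -> X) (th : int -> X -> X) :
  mp_action mu th -> (forall z A, zimage T z A = th (- z) @^-1` A) ->
  weakly_mixing mu T -> mixing_action mu th.
Proof.
move=> thP thE wm A mA; have [E [dE]] := wm A mA.
have mAn n : measurable (A `&` th n%:Z @^-1` A).
  by apply: measurableI => //; exact: (act_measurable thP).
under eq_fun do rewrite thE opprK massE//.
rewrite massE// -EFin_expe => /fine_cvgP[_ cvE].
pose a n := mass mu (A `&` th n%:Z @^-1` A) - mass mu A ^+ 2.
have a1 n : `|a n| <= 1.
  have [? ?] := (mass_ge0 mu A, mass_le1 mu mA).
  have [? ?] := (mass_ge0 mu (A `&` th n%:Z @^-1` A), mass_le1 mu (mAn n)).
  by rewrite /a ler_norml; apply/andP; split; nra.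
move=> e e0; have e3 : 0 < e / 3 by rewrite divr_gt0.
have [N0 _ hN0] := (cvgrPdist_le _ _).1 cvE _ e3.
have /density_oneP dE' := dE; have [N1 hN1] := dE' _ e3.
exists (maxn N1 (Num.bound (N0%:R / (e / 3)))) => N; rewrite geq_max => /andP[N1N N2N].
have N0N : N0%:R <= e / 3 * N%:R.
  rewrite -ler_pdivrMl// mulrC.
  have : N0%:R / (e / 3) < (Num.bound (N0%:R / (e / 3)))%:R.
    by rewrite archi_boundP// divr_ge0// ltW.
  by move=> /ltW/le_trans; apply; rewrite ler_nat.
have an n : `|a n| <= (n < N0)%N%:R + (`|((n : nat) \notin E)%:R| + e / 3).
  have [nN0|nN0] := ltnP n N0.
    by apply: (le_trans (a1 n)); rewrite lerDl addr_ge0// ltW.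
  rewrite add0r; have [nE|nE] := boolP (n \in E); last first.
    by rewrite normr1 (le_trans (a1 n))// lerDl ltW.
  rewrite normr0 add0r distrC; apply: hN0 => //.
  exact: set_mem.
apply: (le_trans (ler_sum _ (fun (n : 'I_N) _ => an n))).
rewrite !big_split/= sumr_const card_ord -(mulr_natr (e / 3)).
have : \sum_(n < N) (n < N0)%N%:R <= N0%:R :> R.
  rewrite -natr_sum ler_nat; elim: N {N1N N2N N0N} => [|N IH]; first by rewrite big_ord0.
  rewrite big_ord_recr/=; case: (ltnP N N0) => [NN0|_]; last by rewrite addn0.
  rewrite addn1; apply: leq_ltn_trans NN0.
  rewrite -[leqRHS]card_ord -sum1_card leq_sum// => i _.
  by case: (_ < _)%N.
have := hN1 N N1N.
have -> : e * N%:R = e / 3 * N%:R + (e / 3 * N%:R + e / 3 * N%:R) by field.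
lra.
Qed.

End PowersOfT.

(** * Polynomial mixing for sets *)
Section ShiftedMeet.
Context {X : Type} (th : int -> X -> X) {D : nat}.

Definition shifted_meet (z : 'I_D -> int) (B : 'I_D -> set X) : set X :=
  \bigcap_(l in [set: 'I_D]) th (- z l) @^-1` B l.

End ShiftedMeet.

Section PolynomialMixingSets.
Context {disp : measure_display} {X : measurableType disp} {R : realType}.
Context (mu : probability X R) (th : int -> X -> X).
Context (thP : mp_action mu th) (thM : mixing_action mu th) (D : nat).

Lemma measurable_shifted_meet (z : 'I_D -> int) (B : 'I_D -> set X) :
  (forall l, measurable (B l)) -> measurable (shifted_meet th z B).
Proof.
move=> mB; apply: fin_bigcap_measurable => [|l _]; first exact: finite_finset.
exact: (act_measurable thP).
Qed.

Lemma indic_shifted_meet (z : 'I_D -> int) (B : 'I_D -> set X) x :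
  \1_(shifted_meet th z B) x = \prod_(l < D) \1_(B l) (th (- z l) x) :> R.
Proof.
have [xB|xB] := pselect (shifted_meet th z B x).
  rewrite indicE mem_set// big1// => l _.
  by rewrite indicE mem_set//; exact: xB.
rewrite indicE memNset//; have [l xl] : exists l, ~ B l (th (- z l) x).
  by apply: contra_notP xB => h l _ /=; apply: contra_notP h => ?; exists l.
by rewrite (bigD1 l)//= indicE memNset// mul0r.
Qed.

(** The constant terms of the polynomials are absorbed in the sets. *)
Lemma polynomial_mixing_sets (P : 'I_D -> {poly R}) (B : 'I_D -> set X) :
  (forall l, integer_valued (P l)) ->
  (forall l m, l != m -> nonconstant (P l - P m)) ->
  (forall l, measurable (B l)) ->
  cesaro_null (fun n => mass mu (shifted_meet th (fun l => int_value (P l) n) B) -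
                        \prod_(l < D) mass mu (B l)).
Proof.
move=> Pz Pd mB.
pose c l := int_value (P l) 0.
pose Q l := shiftp 0 (P l).
have Qinj : injective Q.
  move=> l m e; apply/eqP/negPn/negP => /Pd; rewrite /nonconstant.
  have comp0 p : p \Po ('X + 0%:R%:P) = p :> {poly R}.
    by rewrite addr0 comp_polyXr.
  have -> : P l - P m = ((P l).[0%:R] - (P m).[0%:R])%:P.
    have : Q l - Q m = 0 by rewrite e subrr.
    rewrite /Q /shiftp !comp0 polyCB => h; apply/eqP; rewrite -subr_eq0 -h.
    by apply/eqP; ring.
  by rewrite ltnNge size_polyC_leq1.
pose s := [seq Q l | l <- index_enum 'I_D].
have us : uniq s by rewrite map_inj_uniq// /index_enum -enumT enum_uniq.
have ns : normal_family s.
  move=> _ /mapP[l _ ->]; split; first exact: integer_valued_shiftp.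
  exact: shiftp_at0.
pose F q x : R := \prod_(l < D | Q l == q) \1_(B l) (th (- c l) x).
have uF q : unit_simple (F q).
  apply: unit_simple_prod => l; apply: (unit_simple_act thP); split.
    exact: simple_indic.
  by move=> x; have /andP[x0 x1] := indic_01 (R := R) (B l) x; rewrite ger0_norm.
have FQ l x : F (Q l) x = \1_(B l) (th (- c l) x).
  rewrite /F (eq_bigl (pred1 l)) ?big_pred1_eq// => m.
  by rewrite /= (inj_eq Qinj).
have := polynomial_mixing thP thM us ns uF.
move/eq_cesaro_null; apply => n; congr (_ - _).
  rewrite -mean_indic; last exact: measurable_shifted_meet.
  apply: mean_ext => x; rewrite indic_shifted_meet big_map.
  apply: eq_bigr => l _; rewrite FQ /Q int_value_shiftp// addn0 -(actD thP).
  by congr (\1_(B l) (th _ x)); rewrite /c; ring.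
rewrite big_map; apply: eq_bigr => l _.
rewrite -(mean_indic mu (mB l)) -(mean_act thP (- c l)); last exact: simple_indic.
by apply: mean_ext => x; rewrite FQ.
Qed.

End PolynomialMixingSets.

(** * Measures of sets *)
Section Mass.
Context {disp : measure_display} {X : measurableType disp} {R : realType}.
Context (mu : probability X R).
Implicit Types (A B C F : set X).

Lemma mass_le A B : measurable A -> measurable B -> A `<=` B ->
  mass mu A <= mass mu B.
Proof. by move=> mA mB AB; rewrite -lee_fin -!massE// le_measure ?inE. Qed.

Lemma massU A B : measurable A -> measurable B ->
  mass mu (A `|` B) <= mass mu A + mass mu B.
Proof.
move=> mA mB; rewrite -lee_fin EFinD -!massE//; last exact: measurableU.
exact: measureU2.
Qed.

Lemma massU_disjoint A B : measurable A -> measurable B -> A `&` B = set0 ->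
  mass mu (A `|` B) = mass mu A + mass mu B.
Proof.
move=> mA mB AB; apply: EFin_inj; rewrite EFinD -!massE//; last exact: measurableU.
exact: measureU.
Qed.

Lemma mass_setID A B : measurable A -> measurable B ->
  mass mu A = mass mu (A `&` B) + mass mu (A `\` B).
Proof.
move=> mA mB; rewrite -massU_disjoint ?setUIDK//.
- exact: measurableI.
- exact: measurableD.
- by apply/seteqP; split=> x //= [[? ?] []].
Qed.

Lemma mass_setC A : measurable A -> mass mu (~` A) = 1 - mass mu A.
Proof.
by move=> mA; rewrite -(massT mu) (mass_setID measurableT mA) setTI setTD addrC addKr.
Qed.

Lemma mass_cover A B C : measurable A -> measurable B -> measurable C ->
  A `<=` B `|` C -> mass mu A <= mass mu B + mass mu C.
Proof.
move=> mA mB mC AB; apply: le_trans (massU mB mC).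
by apply: mass_le => //; exact: measurableU.
Qed.

Lemma mass_bigcup_le (I : finType) (F : I -> set X) :
  (forall i, measurable (F i)) ->
  mass mu (\bigcup_(i in [set: I]) F i) <= \sum_i mass mu (F i).
Proof.
move=> mF.
have mU : measurable (\bigcup_(i in [set: I]) F i).
  by apply: fin_bigcup_measurable => //; exact: finite_finset.
under eq_bigr do rewrite -mean_indic//.
rewrite -mean_indic// -mean_sum => [|i _]; last exact: simple_indic.
apply: mean_le => [||x]; first exact: simple_indic.
  by apply: simple_sum => i _; exact: simple_indic.
have [[i _ Fix]|xF] := pselect ((\bigcup_(i in [set: I]) F i) x).
  rewrite (bigD1 i)//= [X in _ <= X + _]indicE mem_set// indicE.
  rewrite (le_trans (y := 1))//; first by case: (_ \in _).
  by rewrite lerDl sumr_ge0// => j _; have /andP[] := indic_01 (R := R) (F j) x.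
by rewrite indicE memNset// sumr_ge0.
Qed.

Lemma mass_nondecreasing (F : nat -> set X) (e : R) :
  (forall i, measurable (F i)) ->
  (forall i j, (i <= j)%N -> F i `<=` F j) -> 0 < e ->
  exists L, mass mu (\bigcup_i F i) - e <= mass mu (F L).
Proof.
move=> mF ndF e0; have mU : measurable (\bigcup_i F i) by exact: bigcup_measurable.
have homoF : {homo F : n m / (n <= m)%N >-> (n <= m)%O}.
  by move=> n m nm; apply/subsetPset; exact: ndF.
have := nondecreasing_cvg_mu (mu := mu) mF mU homoF.
rewrite [X in _ --> X](massE mu mU) => /fine_cvgP[_] /cvgrPdist_le/(_ _ e0)[L _ hL].
exists L; have := hL L (leqnn L); rewrite /= ler_norml => /andP[_].
by rewrite -[fine _]/(mass mu (F L)); lra.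
Qed.

Lemma mass_nonincreasing (F : nat -> set X) (t : R) :
  (forall i, measurable (F i)) ->
  (forall i j, (i <= j)%N -> F j `<=` F i) -> (forall i, t <= mass mu (F i)) ->
  t <= mass mu (\bigcap_i F i).
Proof.
move=> mF niF tF.
have mI : measurable (\bigcap_i F i) by exact: bigcap_measurable.
have mCF i : measurable (~` F i) by exact: measurableC.
apply/ler_addgt0Pr => e e0.
have [L] := @mass_nondecreasing (fun i => ~` F i) e mCF
  (fun i j ij => subsetC (niF i j ij)) e0.
rewrite -setC_bigcap (mass_setC mI) (mass_setC (mF L)).
by have := tF L; lra.
Qed.

(** The measure of the symmetric difference. *)
Definition set_dist A B : R := mass mu (A `\` B) + mass mu (B `\` A).

Lemma set_distC A B : set_dist A B = set_dist B A.
Proof. by rewrite /set_dist addrC. Qed.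

Lemma mass_dist A B : measurable A -> measurable B ->
  `|mass mu A - mass mu B| <= set_dist A B.
Proof.
move=> mA mB; rewrite (mass_setID mA mB) (mass_setID mB mA) (setIC B A) /set_dist.
have [? ?] := (mass_ge0 mu (A `\` B), mass_ge0 mu (B `\` A)).
by rewrite ler_norml; apply/andP; split; lra.
Qed.

Lemma set_dist_triangle A B C : measurable A -> measurable B -> measurable C ->
  set_dist A C <= set_dist A B + set_dist B C.
Proof.
move=> mA mB mC.
have cov A' B' C' : measurable A' -> measurable B' -> measurable C' ->
    mass mu (A' `\` C') <= mass mu (A' `\` B') + mass mu (B' `\` C').
  move=> mA' mB' mC'; apply: mass_cover; try exact: measurableD.
  by move=> x [Ax Cx]; have [Bx|Bx] := pselect (B' x); [right|left].
have := cov A B C mA mB mC; have := cov C B A mC mB mA.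
by rewrite /set_dist; lra.
Qed.

End Mass.

(** * Translates of a set *)

Section Translates.
Context {disp : measure_display} {X : measurableType disp} {R : realType}.
Context (mu : probability X R) (th : int -> X -> X).
Context (thP : mp_action mu th) (thM : mixing_action mu th).
Implicit Types (A B C F : set X).

Let mact z A : measurable A -> measurable (th z @^-1` A).
Proof. exact: (act_measurable thP). Qed.

Lemma set_dist_act z A B : measurable A -> measurable B ->
  set_dist mu (th z @^-1` A) (th z @^-1` B) = set_dist mu A B.
Proof.
move=> mA mB; rewrite /set_dist -(act_mass thP z (measurableD mA mB)).
by rewrite -(act_mass thP z (measurableD mB mA)).
Qed.

Lemma preimage_actC a b A : th a @^-1` (th b @^-1` A) = th b @^-1` (th a @^-1` A).
Proof. by apply/seteqP; split=> x /=; rewrite -!(actD thP) addrC. Qed.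

(** The deviations from independence for the finitely many sets add up to a
    null sequence, so some time makes them all small. *)
Lemma independent_translate (I : finType) (E : I -> set X) C (e : R) :
  measurable C -> (forall i, measurable (E i)) -> 0 < e ->
  exists t, forall i,
    `|mass mu (th t @^-1` C `&` E i) - mass mu C * mass mu (E i)| <= e.
Proof.
move=> mC mE e0.
pose a i n := `|mass mu (E i `&` th n%:Z @^-1` C) - mass mu (E i) * mass mu C|.
have na : cesaro_null (fun n => \sum_i a i n).
  apply: cesaro_null_sum => i.
  apply: (cesaro_null_le (mixing_pair thP thM mC (mE i))) => n.
  by rewrite normr_id.
have [t ht] := cesaro_null_small na e0; exists t%:Z => i.
rewrite setIC [X in _ - X]mulrC; apply: le_trans (ltW ht).
have a0 j : 0 <= a j t by exact: normr_ge0.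
rewrite [leRHS]ger0_norm ?sumr_ge0//.
by rewrite [leRHS](bigD1 i)//= -[leLHS]/(a i t) lerDl sumr_ge0.
Qed.

(** The union of the first [L] forward images of [F]. *)
Definition visited F (L : nat) : set X :=
  [set x | exists2 i, (i < L)%N & F (th (- i%:Z) x)].

Lemma measurable_visited F L : measurable F -> measurable (visited F L).
Proof.
move=> mF.
have -> : visited F L = \bigcup_(i in [set i | (i < L)%N]) th (- i%:Z) @^-1` F.
  by apply/seteqP; split=> x [i iL Fx]; exists i.
by apply: bigcup_measurable => i _; exact: mact.
Qed.

Lemma visited_mono F L L' : (L <= L')%N -> visited F L `<=` visited F L'.
Proof. by move=> LL' x [i iL Fx]; exists i => //; exact: leq_trans LL'. Qed.

Lemma visitedS F L :
  visited F L.+1 `<=` visited F L `|` th (- L%:Z) @^-1` F.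
Proof.
move=> x [i]; rewrite ltnS leq_eqVlt => /predU1P[->|iL] Fx; first by right.
by left; exists i.
Qed.

Lemma mass_visited_le F L : measurable F -> mass mu (visited F L) <= L%:R * mass mu F.
Proof.
move=> mF; elim: L => [|L IH].
  rewrite mul0r (_ : visited F 0 = set0) ?/mass ?measure0//.
  by apply/seteqP; split=> x // [].
rewrite -natr1 mulrDl mul1r -[X in _ + X](act_mass thP (- L%:Z) mF).
apply: (@le_trans _ _ (mass mu (visited F L) + mass mu (th (- L%:Z) @^-1` F)));
  last by rewrite lerD2r.
apply: (mass_cover _ _ _ _ (@visitedS F L)); do ?exact: measurable_visited.
exact: mact.
Qed.

Lemma mass_visited_total F : measurable F -> 0 < mass mu F ->
  mass mu (\bigcup_L visited F L) = 1.
Proof.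
move=> mF F0; set U := \bigcup_L _.
have mU : measurable U by apply: bigcup_measurable => L _; exact: measurable_visited.
suff : mass mu (~` U) = 0 by rewrite mass_setC//; lra.
(* No forward image of [F] meets the complement of [U], while mixing makes the
   correlations tend to the product of the measures. *)
apply/eqP/negPn/negP => U0.
have {}U0 : 0 < mass mu (~` U) by rewrite lt_neqAle eq_sym U0 mass_ge0.
have nE := mixing_pair thP thM (measurableC mU) mF.
have [n] := cesaro_null_small nE (mulr_gt0 F0 U0).
rewrite (_ : _ `&` _ = set0); last first.
  apply/seteqP; split=> x //= [Fx Ux]; apply: Ux; exists n.+1 => //; exists n => //.
  by rewrite -(actD thP) addNr (act0 thP).
rewrite /(mass mu set0) measure0 sub0r normrN gtr0_norm ?mulr_gt0//.
by rewrite ltxx.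
Qed.

End Translates.

(** * Sets of prescribed measure and nearly invariant sets *)
Section PrescribedMeasure.
Context {disp : measure_display} {X : measurableType disp} {R : realType}.
Context (mu : probability X R) (th : int -> X -> X).
Context (thP : mp_action mu th) (thM : mixing_action mu th).
Context (nontriv : nontrivial_space mu).
Implicit Types (A B C F : set X).

Let mact z A : measurable A -> measurable (th z @^-1` A).
Proof. exact: (act_measurable thP). Qed.

Let mvis F L : measurable F -> measurable (visited th F L).
Proof. exact: (measurable_visited thP). Qed.

(** Intersecting with a nearly independent translate of a fixed nontrivial set
    shrinks the measure by a definite factor but keeps it positive. *)
Lemma small_set (e : R) : 0 < e ->
  exists F, [/\ measurable F, 0 < mass mu F & mass mu F <= e].
Proof.
move=> e0; have [B [mB]] := nontriv; rewrite massE// !lte_fin => /andP[B0 B1].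
set b := mass mu B in B0 B1; pose r := (1 + b) / 2.
have r1 : `|r| < 1 by rewrite ger0_norm /r; lra.
have r0 : 0 < r by rewrite /r; lra.
have shrink k : exists F, [/\ measurable F, 0 < mass mu F & mass mu F <= r ^+ k].
  elim: k => [|k [F [mF F0 Fk]]].
    by exists B; rewrite expr0; split => //; exact: mass_le1.
  have nF := mixing_pair thP thM mB mF.
  have d0 : 0 < mass mu F * Num.min b ((1 - b) / 2).
    by rewrite mulr_gt0// lt_min B0/=; lra.
  have [n] := cesaro_null_small nF d0; rewrite ltr_norml -/b => /andP[n1 n2].
  have [m1 m2] : mass mu F * Num.min b ((1 - b) / 2) <= mass mu F * b /\
      mass mu F * Num.min b ((1 - b) / 2) <= mass mu F * ((1 - b) / 2).
    by split; rewrite ler_wpM2l ?mass_ge0// ge_min lexx ?orbT.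
  exists (F `&` th n%:Z @^-1` B); split; first by apply: measurableI => //; exact: mact.
    lra.
  rewrite exprS; apply: (@le_trans _ _ (r * mass mu F)); last by rewrite ler_wpM2l// ltW.
  by rewrite /r; lra.
have [N _ hN] := (cvgrPdist_le _ _).1 (cvg_expr r1) _ e0.
have [F [mF F0 FN]] := shrink N; exists F; split => //; apply: le_trans FN _.
have := hN N (leqnn N); rewrite /= sub0r normrN ger0_norm//.
by rewrite exprn_ge0// ltW.
Qed.

Lemma visited_almost_all F (e : R) : measurable F -> 0 < mass mu F -> 0 < e ->
  exists L, 1 - e <= mass mu (visited th F L).
Proof.
move=> mF F0 e0; rewrite -(mass_visited_total thP thM mF F0).
apply: mass_nondecreasing => // [L|L L']; first exact: mvis.
exact: visited_mono.
Qed.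

(** The intersections of [F] with unions of translates of a small set fill up
    [F] in small steps. *)
Lemma approximate_subset F (t e : R) : measurable F -> 0 <= t <= mass mu F -> 0 < e ->
  exists F', [/\ measurable F', F' `<=` F, t <= mass mu F' & mass mu F' <= t + e].
Proof.
move=> mF /andP[t0 tF] e0; have [S [mS S0 Se]] := small_set e0.
have [tFe|tFe] := leP (mass mu F) t; first by exists F; split=> //; lra.
have [|L hL] := @visited_almost_all S (mass mu F - t) mS S0; first by lra.
pose V L := F `&` visited th S L.
have mV L' : measurable (V L') by apply: measurableI => //; exact: mvis.
have exV : exists L, t <= mass mu (V L).
  exists L; have : mass mu F <= mass mu (V L) + mass mu (~` visited th S L).
    apply: mass_cover => //; first exact/measurableC/mvis.
    by move=> x Fx; have [?|?] := pselect (visited th S L x); [left|right].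
  by rewrite mass_setC; [lra|exact: mvis].
have exb : exists L, `[< t <= mass mu (V L) >].
  by have [L1 ?] := exV; exists L1; apply/asboolP.
have [L0 /asboolP tL0 L0min] := ex_minnP exb.
exists (V L0); split=> //; first exact: subIsetl.
case: L0 tL0 L0min => [|L0] tL0 L0min.
  rewrite (_ : V 0%N = set0) ?/mass ?measure0; first by rewrite addr_ge0// ltW.
  by apply/seteqP; split=> x // -[_ []].
have ltL0 : mass mu (V L0) < t.
  by rewrite ltNge; apply/negP => /asboolP/L0min; rewrite ltnn.
have : mass mu (V L0.+1) <= mass mu (V L0) + mass mu (th (- L0%:Z) @^-1` S).
  apply: mass_cover => //; first exact: mact.
  by move=> x [Fx /visitedS[?|?]]; [left|right].
by rewrite (act_mass thP)//; lra.
Qed.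

Lemma exact_subset F (t : R) : measurable F -> 0 <= t <= mass mu F ->
  exists F', [/\ measurable F', F' `<=` F & mass mu F' = t].
Proof.
move=> mF tF.
pose good A := measurable A /\ t <= mass mu A.
have step (k : nat) (A : {A | good A}) : {A' : {A | good A} |
    sval A' `<=` sval A /\ mass mu (sval A') <= t + k.+1%:R^-1}.
  apply: cid; case: A => A [mA tA].
  have [||A' [mA' A'A tA' A't]] := @approximate_subset A t k.+1%:R^-1 mA.
  - by rewrite tA andbT; case/andP: tF.
  - by [].
  - by exists (exist _ A' (conj mA' tA')).
have gF : good F by split=> //; case/andP: tF.
pose G := fix G k := if k is k'.+1 then sval (step k' (G k')) else exist _ F gF.
pose H k := sval (G k).
have mH k : measurable (H k) by exact: (svalP (G k)).1.
have tH k : t <= mass mu (H k) by exact: (svalP (G k)).2.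
have HS k : H k.+1 `<=` H k /\ mass mu (H k.+1) <= t + k.+1%:R^-1.
  exact: (svalP (step k (G k))).
have niH i j : (i <= j)%N -> H j `<=` H i.
  move=> /subnK <-; elim: (j - i)%N => // k IH.
  by apply: subset_trans IH; exact: (HS _).1.
have mI : measurable (\bigcap_i H i) by exact: bigcap_measurable.
exists (\bigcap_i H i); split => //; first by move=> x /(_ 0%N I).
apply/eqP; rewrite eq_le (mass_nonincreasing mH niH tH) andbT.
apply/ler_addgt0Pr => e e0; pose k := Num.bound e^-1.
apply: (@le_trans _ _ (mass mu (H k.+1))); first by apply: mass_le => // x /(_ k.+1 I).
apply: (le_trans (HS k).2); rewrite lerD2l invf_ple ?posrE//.
have : e^-1 < k%:R by rewrite archi_boundP// invr_ge0 ltW.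
by move=> /ltW/le_trans; apply; rewrite ler_nat.
Qed.

Lemma adjust_mass A (a : R) : measurable A -> 0 <= a <= 1 ->
  exists A', [/\ measurable A', mass mu A' = a &
    set_dist mu A A' <= `|mass mu A - a|].
Proof.
move=> mA /andP[a0 a1]; have [aA|Aa] := leP a (mass mu A).
  have [|A' [mA' A'A A'a]] := @exact_subset A a mA; first by rewrite a0.
  exists A'; split => //; rewrite /set_dist (_ : A' `\` A = set0); last first.
    by apply/seteqP; split=> x //= [/A'A].
  rewrite {2}/mass measure0 addr0 ger0_norm ?subr_ge0//.
  by have := mass_setID mu mA mA'; rewrite (setIidr A'A); lra.
have mCA := measurableC mA.
have [|B [mB BA Ba]] := @exact_subset (~` A) (a - mass mu A) mCA.
  by rewrite mass_setC//; apply/andP; split; lra.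
have AB : A `&` B = set0 by apply/seteqP; split=> x //= [Ax /BA].
exists (A `|` B); split; first exact: measurableU.
  by rewrite massU_disjoint// Ba; lra.
rewrite /set_dist (_ : A `\` _ = set0); last first.
  by apply/seteqP; split=> x //= [Ax]; case; left.
rewrite {1}/mass measure0 add0r setDUl setDv set0U (_ : B `\` A = B); last first.
  by apply/seteqP; split=> [x []//|x Bx]; split=> //; exact: BA.
by rewrite Ba ler0_norm ?opprB//; lra.
Qed.

(** A long union of translates of a small set is nearly invariant, and its
    measure passes through all values with small steps. *)
Lemma nearly_invariant (t e : R) (Z : nat) : 0 <= t <= 1 -> 0 < e ->
  exists N, [/\ measurable N, `|mass mu N - t| <= e &
    forall z : int, (`|z| <= Z)%N -> set_dist mu N (th z @^-1` N) <= e].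
Proof.
move=> /andP[t0 t1] e0.
have e1 : 0 < e / (2 * Z.+1%:R) by rewrite divr_gt0// mulr_gt0.
have [F [mF F0 Fe]] := small_set e1.
have ZF : 2 * Z%:R * mass mu F <= e.
  have : (2 * Z.+1%:R) * mass mu F <= e by rewrite mulrC -ler_pdivlMr// mulr_gt0.
  by apply: le_trans; rewrite ler_wpM2r ?mass_ge0// ler_wpM2l// ler_nat.
have Fe2 : mass mu F <= e.
  apply: (le_trans Fe); rewrite ler_pdivrMr ?mulr_gt0// ler_pMr//.
  by rewrite -natrM ler1n.
have inv L (z : int) : (`|z| <= Z)%N ->
    set_dist mu (visited th F L) (th z @^-1` (visited th F L)) <= e.
  move=> zZ; set V := visited th F L; have mV : measurable V by exact: mvis.
  wlog z0 : z zZ / exists k : nat, z = - k%:Z.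
    move=> IH; case: z zZ => [k|k] zZ; last by apply: IH => //; exists k.+1.
    rewrite set_distC -(set_dist_act thP (- k%:Z) (mact _ mV) mV).
    rewrite (_ : th (- k%:Z) @^-1` (th k @^-1` V) = V).
      by apply: IH; [rewrite abszN|exists k].
    by apply/seteqP; split=> x; rewrite /preimage/= -(actD thP) subrr (act0 thP).
  case: z0 => k zE; rewrite zE abszN /= in zZ *.
  have mVk : measurable (visited th F k) by exact: mvis.
  rewrite /set_dist.
  have h1 : mass mu (V `\` th (- k%:Z) @^-1` V) <= k%:R * mass mu F.
    apply: le_trans (mass_visited_le thP k mF).
    apply: mass_le => //; first by apply: measurableD => //; exact: mact.
    move=> x [[i iL Fx] Vk]; exists i => //; rewrite ltnNge; apply/negP => ki.
    apply: Vk; exists (i - k)%N; first by rewrite (leq_ltn_trans _ iL)// leq_subr.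
    by rewrite -(actD thP) -subzn// opprB addrAC subrr add0r.
  have h2 : mass mu (th (- k%:Z) @^-1` V `\` V) <= k%:R * mass mu F.
    rewrite (le_trans _ (mass_visited_le thP k mF))//.
    rewrite -[leRHS](act_mass thP (- L%:Z))//.
    apply: mass_le; [by apply: measurableD => //; exact: mact|exact: mact|].
    move=> x [[i iL Fx] Vx]; have {}Fx : F (th (- (i + k)%N%:Z) x).
      by move: Fx; rewrite -(actD thP) -opprD PoszD.
    have Lik : (L <= i + k)%N.
      by rewrite leqNgt; apply/negP => ikL; apply: Vx; exists (i + k)%N.
    exists (i + k - L)%N; first by lia.
    by rewrite -(actD thP) -opprD -PoszD subnK.
  have : k%:R * mass mu F <= Z%:R * mass mu F.
    by rewrite ler_wpM2r ?mass_ge0// ler_nat.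
  lra.
have [t1'|t1'] := leP 1 t.
  have [L hL] := visited_almost_all mF F0 e0.
  exists (visited th F L); split; [exact: mvis| |exact: inv].
  have := mass_le1 mu (mvis L mF); rewrite ler_norml => ?; apply/andP; split; lra.
have [|L hL] := @visited_almost_all F (1 - t) mF F0; first by lra.
have exb : exists L, t <= mass mu (visited th F L) by exists L; lra.
have [L0 tL0 L0min] := ex_minnP exb.
exists (visited th F L0); split; [exact: mvis| |exact: inv].
case: L0 tL0 L0min => [|L0] tL0 L0min.
  have := mass_visited_le thP 0 mF; rewrite mul0r => h.
  by rewrite ler_norml; apply/andP; split; lra.
have ltL0 : mass mu (visited th F L0) < t.
  by rewrite ltNge; apply/negP => /L0min; rewrite ltnn.
have := mass_cover mu (mvis L0.+1 mF) (mvis L0 mF) (mact (- L0%:Z) mF)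
  (visitedS (F := F) (L := L0)).
by rewrite (act_mass thP)// => h; rewrite ler_norml; apply/andP; split; lra.
Qed.

End PrescribedMeasure.

(** * Nearly periodic sets *)
Section Periodic.
Context {disp : measure_display} {X : measurableType disp} {R : realType}.
Context (mu : probability X R) (th : int -> X -> X).
Context (thP : mp_action mu th) (thM : mixing_action mu th).
Context (nontriv : nontrivial_space mu).
Implicit Types (A B C F : set X).

Let mact z A : measurable A -> measurable (th z @^-1` A).
Proof. exact: (act_measurable thP). Qed.

Let mvis F L : measurable F -> measurable (visited th F L).
Proof. exact: (measurable_visited thP). Qed.

(** [r] is the time elapsed since the orbit of [x] last visited [F]. *)
Definition last_visit F (x : X) (r : nat) :=
  F (th (- r%:Z) x) /\ ~ visited th F r x.

Lemma last_visit_uniq F x r r' : last_visit F x r -> last_visit F x r' -> r = r'.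
Proof.
move=> [Fr nr] [Fr' nr']; have [lt|lt|//] := ltngtP r r'.
  by case: nr'; exists r.
by case: nr; exists r'.
Qed.

Lemma last_visit_shift F x r k : last_visit F (th (- k%:Z) x) r ->
  visited th F k x \/ last_visit F x (r + k).
Proof.
move=> [Fr nr]; have [Vk|Vk] := pselect (visited th F k x); [by left|right].
have e i : th (- i%:Z) (th (- k%:Z) x) = th (- (i + k)%N%:Z) x.
  by rewrite -(actD thP) -opprD PoszD.
split; first by rewrite -e.
move=> [i ir Fi]; have [ik|ki] := ltnP i k; first by apply: Vk; exists i.
by apply: nr; exists (i - k)%N; [lia|rewrite e subnK].
Qed.

Lemma last_visit_unshift F x r k : (k <= r)%N -> last_visit F x r ->
  last_visit F (th (- k%:Z) x) (r - k)%N.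
Proof.
move=> kr [Fr nr].
have e i : th (- i%:Z) (th (- k%:Z) x) = th (- (i + k)%N%:Z) x.
  by rewrite -(actD thP) -opprD PoszD.
split; first by rewrite e subnK.
by move=> [i ir]; rewrite e => Fi; apply: nr; exists (i + k)%N => //; lia.
Qed.

Definition phase F (q s : nat) : set X :=
  [set x | exists2 r, last_visit F x r & (r %% q)%N = s].

Lemma measurable_phase F q s : measurable F -> measurable (phase F q s).
Proof.
move=> mF.
have -> : phase F q s = \bigcup_(r in [set r | (r %% q)%N = s])
    (th (- r%:Z) @^-1` F `\` visited th F r).
  by apply/seteqP; split=> x [r h1 h2]; exists r.
apply: bigcup_measurable => r _; apply: measurableD; first exact: mact.
exact: mvis.
Qed.

(** Outside a small set [F] the time since the last visit to [F] increases by
    one at each step, so its residue modulo [q] is nearly periodic.  The [q]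
    phases have nearly the same measure. *)
Lemma nearly_periodic (q Z : nat) (e : R) : (0 < q)%N -> 0 < e ->
  exists C, [/\ measurable C, `|mass mu C - q%:R^-1| <= e &
    forall z : int, (`|z| <= Z)%N -> ~~ (q%:Z %| z)%Z ->
      mass mu (C `&` th z @^-1` C) <= e].
Proof.
move=> q0 e0; pose Z1 := maxn Z q.
have e1 : 0 < e / Z1.+1%:R by rewrite divr_gt0.
have [F [mF F0 Fe]] := small_set thP thM nontriv e1.
have ZF k : (k <= Z1)%N -> k%:R * mass mu F <= e.
  move=> kZ; have : Z1.+1%:R * mass mu F <= e by rewrite mulrC -ler_pdivlMr.
  by apply: le_trans; rewrite ler_wpM2r ?mass_ge0// ler_nat ltnW.
pose C := phase F q.
have mC s : measurable (C s) by exact: measurable_phase.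
have C0s s : (s < q)%N -> mass mu (C s) <= mass mu (C 0%N) <= mass mu (C s) + e.
  move=> sq; rewrite -(act_mass thP (- s%:Z) (mC 0%N)).
  have mCs := mact (- s%:Z) (mC 0%N); apply/andP; split.
    apply: mass_le => // x [r rx rs]; exists (r - s)%N.
      by apply: last_visit_unshift => //; rewrite -rs leq_mod.
    rewrite (divn_eq r q) rs addnK; exact: modnMl.
  apply: (le_trans (y := mass mu (C s) + mass mu (visited th F s))); last first.
    rewrite lerD2l (le_trans (mass_visited_le thP s mF))// ZF//.
    by rewrite (leq_trans (ltnW sq))// leq_maxr.
  apply: mass_cover => //; first exact: mvis.
  move=> x [r rx r0]; have [|rx'] := last_visit_shift rx; first by right.
  by left; exists (r + s)%N => //; rewrite -modnDml r0 add0n modn_small.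
have sumC : \sum_(s < q) mass mu (C s) = 1.
  rewrite -(mass_visited_total thP thM mF F0).
  have mU : measurable (\bigcup_L visited th F L).
    by apply: bigcup_measurable => L _; exact: mvis.
  rewrite -mean_indic//; under eq_bigr do rewrite -mean_indic//.
  rewrite -mean_sum => [|s _]; last exact: simple_indic.
  apply: mean_ext => x.
  have [[r rx]|none] := pselect (exists r, last_visit F x r).
    have rq : (r %% q < q)%N by rewrite ltn_pmod.
    rewrite (bigD1 (Ordinal rq))//= !indicE !mem_set ?big1 ?addr0//.
    - move=> s sr; rewrite indicE memNset// => -[r' rx' r's].
      move: sr; rewrite -val_eqE/= => /eqP; apply.
      by rewrite -r's (last_visit_uniq rx rx').
    - by exists r.+1 => //; exists r => //; case: rx.
    - by exists r.
  rewrite big1 => [|s _]; last first.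
    by rewrite indicE memNset// => -[r rx _]; apply: none; exists r.
  rewrite indicE memNset// => -[L _ [i iL Fi]]; apply: none.
  have exr : exists r, `[< F (th (- r%:Z) x) >] by exists i; apply/asboolP.
  have [r /asboolP Fr rmin] := ex_minnP exr; exists r; split=> // -[j jr Fj].
  by have := rmin j (asboolT Fj); rewrite leqNgt jr.
exists (C 0%N); split=> //.
  have qR : 0 < q%:R :> R by rewrite ltr0n.
  have cst (c : R) : \sum_(s < q) c = q%:R * c by rewrite sumr_const card_ord mulr_natl.
  have lo : 1 <= q%:R * mass mu (C 0%N).
    rewrite -[X in X <= _]sumC -(cst (mass mu (C 0%N))); apply: ler_sum => s _.
    by have /andP[] := C0s s (ltn_ord s).
  have hi : q%:R * mass mu (C 0%N) <= 1 + q%:R * e.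
    rewrite -[X in _ <= X + _]sumC -(cst (mass mu (C 0%N))) -(cst e).
    rewrite -big_split/=; apply: ler_sum => s _.
    by have /andP[] := C0s s (ltn_ord s).
  have qE : q%:R * q%:R^-1 = 1 :> R by rewrite divff// gt_eqF.
  rewrite ler_norml -(ler_pM2l qR) -[X in _ && X](ler_pM2l qR) !mulrBr qE.
  by apply/andP; split; nra.
have main (k : nat) : (k <= Z)%N -> ~~ (q %| k)%N ->
    mass mu (C 0%N `&` th (- k%:Z) @^-1` C 0%N) <= e.
  move=> kZ qk; apply: (le_trans _ (ZF k _)); last by rewrite (leq_trans kZ) ?leq_maxl.
  apply: le_trans (mass_visited_le thP k mF).
  apply: mass_le; [by apply: measurableI => //; exact: mact|exact: mvis|].
  move=> x [[r rx r0] [r' rx' r'0]]; have [//|rx''] := last_visit_shift rx'.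
  move: qk; rewrite /dvdn; have := congr1 (fun m => (m %% q)%N) (last_visit_uniq rx rx'').
  by rewrite /= r0 -modnDml r'0 add0n => <-.
move=> z zZ qz; case: z => [k|k] in zZ qz *; last by rewrite NegzE; exact: main.
rewrite -(act_mass thP (- k%:Z)); last by apply: measurableI => //; exact: mact.
rewrite (_ : _ @^-1` _ = C 0%N `&` th (- k%:Z) @^-1` C 0%N); first exact: main.
rewrite setIC; apply/seteqP; split=> x [xC yC]; split=> //; move: xC yC;
  by rewrite /preimage/= -(actD thP) subrr (act0 thP).
Qed.

End Periodic.

(** * Splicing sets *)
Section Layers.
Context {disp : measure_display} {X : measurableType disp} {R : realType}.
Context (mu : probability X R) (th : int -> X -> X).
Context (thP : mp_action mu th) (thM : mixing_action mu th).
Context (nontriv : nontrivial_space mu) (D : nat) (z : nat -> 'I_D -> int).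
Implicit Types (A B C Q N : set X).

Let mact w A : measurable A -> measurable (th w @^-1` A).
Proof. exact: (act_measurable thP). Qed.

Let mmeet n (B : 'I_D -> set X) :
  (forall l, measurable (B l)) -> measurable (shifted_meet th (z n) B).
Proof. exact: (measurable_shifted_meet thP). Qed.

Definition correlation A n := mass mu (shifted_meet th (z n) (fun=> A)).

Lemma correlation_dist A B n : measurable A -> measurable B ->
  `|correlation A n - correlation B n| <= D%:R * set_dist mu A B.
Proof.
move=> mA mB.
have half A' B' : measurable A' -> measurable B' ->
    correlation A' n <= correlation B' n + D%:R * mass mu (A' `\` B').
  move=> mA' mB'; rewrite /correlation.
  have mAB := measurableD mA' mB'.
  apply: le_trans (lerD (lexx _) (_ : mass mu (\bigcup_(l in [set: 'I_D])
      th (- z n l) @^-1` (A' `\` B')) <= _)); last first.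
    apply: le_trans (mass_bigcup_le mu (fun l => mact (- z n l) mAB)) _.
    under eq_bigr do rewrite (act_mass thP)//.
    by rewrite sumr_const card_ord mulr_natl.
  apply: mass_cover.
  - exact: mmeet.
  - exact: mmeet.
  - by apply: fin_bigcup_measurable => [|l _]; [exact: finite_finset|exact: mact].
  move=> x xA; have [xB|] := pselect (shifted_meet th (z n) (fun=> B') x); first by left.
  move=> /existsNP[l /not_implyP[_ xl]]; right; exists l => //; split=> //.
  exact: xA.
have := half A B mA mB; have := half B A mB mA; rewrite /set_dist mulrDr.
have D0 : 0 <= D%:R :> R by [].
have [p1 p2] := (mulr_ge0 D0 (mass_ge0 mu (A `\` B)), mulr_ge0 D0 (mass_ge0 mu (B `\` A))).
by move=> h1 h2; rewrite ler_norml; apply/andP; split; lra.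
Qed.

Lemma shifts_bounded (w : nat -> 'I_D -> 'I_D -> int) M :
  exists Z, forall n l m, (n < M)%N -> (`|w n l m| <= Z)%N.
Proof.
exists (\max_(i : 'I_M * ('I_D * 'I_D)) `|w i.1 i.2.1 i.2.2|)%N => n l m nM.
exact: (leq_bigmax (F := fun i : 'I_M * ('I_D * 'I_D) => `|w i.1 i.2.1 i.2.2|%N)
  (Ordinal nM, (l, m))).
Qed.

(** Replace [A] by [Q] on a nearly invariant set [N] of measure [t].  The
    finitely many relevant translates of a point lie either all in [N] or all
    outside, up to a small error, so each correlation splits into one of [Q]
    inside [N] and one of [A] outside; near independence of [N] from all the
    sets involved gives the weights [t] and [1 - t]. *)
Lemma splice A Q (t e : R) (M : nat) : measurable A -> measurable Q ->
  0 <= t <= 1 -> 0 < e ->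
  exists A', [/\ measurable A', set_dist mu A A' <= 2 * t + e,
    `|mass mu A' - ((1 - t) * mass mu A + t * mass mu Q)| <= e &
    forall n, (n < M)%N ->
      `|correlation A' n - ((1 - t) * correlation A n + t * correlation Q n)| <= e].
Proof.
move=> mA mQ t01 e0; pose v := e / (D + 4)%:R.
have v0 : 0 < v by rewrite divr_gt0// ltr0n addn4.
have vE : D%:R * v + 4 * v = e.
  by rewrite /v natrD; field; rewrite -natrD pnatr_eq0 addn4.
have D0 : 0 <= D%:R * v by rewrite mulr_ge0// ltW.
have [Z hZ] := shifts_bounded (fun n l m => z n l) M.
have [N0 [mN0 N0t N0inv]] := nearly_invariant thP thM nontriv Z t01 v0.
pose E (i : 'I_M * bool + bool) : set X := match i with
  | inl (n, b) => shifted_meet th (z n) (fun=> if b then A else Q)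
  | inr b => if b then A else Q end.
have mE i : measurable (E i).
  by case: i => [[n b]|b] /=; [apply: mmeet => l|]; case: b.
have [w hw] := independent_translate thP thM mN0 mE v0.
pose N := th w @^-1` N0; have mN : measurable N by exact: mact.
have massN : mass mu N = mass mu N0 by exact: (act_mass thP).
have Ninv (y : int) : (`|y| <= Z)%N -> set_dist mu N (th y @^-1` N) <= v.
  by move=> yZ; rewrite /N (preimage_actC thP) (set_dist_act thP)//;
    [exact: N0inv|exact: mact].
have mix i j : let W := (E i `\` N) `|` (E j `&` N) in
    `|mass mu W - ((1 - t) * mass mu (E i) + t * mass mu (E j))| <= 4 * v.
  move=> W; have hW : mass mu W = mass mu (E i) - mass mu (N `&` E i) + mass mu (N `&` E j).
    rewrite massU_disjoint.
    - by rewrite (mass_setID mu (mE i) mN) (setIC N (E i)) (setIC N (E j)); ring.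
    - exact: measurableD.
    - exact: measurableI.
    - by apply/seteqP; split=> x //= [[_ ?] []].
  have ind k : `|mass mu (N `&` E k) - t * mass mu (E k)| <= 2 * v.
    have := hw k; have [m0 m1] := (mass_ge0 mu (E k), mass_le1 mu (mE k)).
    move: N0t; rewrite !ler_norml => /andP[? ?] /andP[? ?].
    by apply/andP; split; nra.
  move: (ind i) (ind j); rewrite hW !ler_norml => /andP[? ?] /andP[? ?].
  by apply/andP; split; lra.
pose A' := (A `\` N) `|` (Q `&` N).
have mA' : measurable A'.
  by apply: measurableU; [exact: measurableD|exact: measurableI].
exists A'; split => //.
- have hN : mass mu N <= t + v.
    by move: N0t; rewrite massN ler_norml => /andP[_]; lra.
  have h1 : mass mu (A `\` A') <= mass mu N.
    apply: mass_le => //; first exact: measurableD.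
    by move=> x [Ax A'x]; apply: contra_notP A'x => Nx; left.
  have h2 : mass mu (A' `\` A) <= mass mu N.
    apply: mass_le => //; first exact: measurableD.
    by move=> x [[[Ax _]|[_ Nx]] nAx].
  by rewrite /set_dist; lra.
- by have := mix (inr true) (inr false) => /= h; rewrite (le_trans h)//; lra.
move=> n nM.
pose W := (E (inl (Ordinal nM, true)) `\` N) `|` (E (inl (Ordinal nM, false)) `&` N).
have mW : measurable W.
  by apply: measurableU; [exact: measurableD|exact: measurableI].
pose err := \bigcup_(l in [set: 'I_D])
  ((N `\` th (- z n l) @^-1` N) `|` (th (- z n l) @^-1` N `\` N)).
have merr l : measurable ((N `\` th (- z n l) @^-1` N) `|` (th (- z n l) @^-1` N `\` N)).
  by apply: measurableU; apply: measurableD => //; exact: mact.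
have Merr : measurable err by apply: fin_bigcup_measurable => //; exact: finite_finset.
have errD : mass mu err <= D%:R * v.
  apply: le_trans (mass_bigcup_le mu merr) _.
  rewrite -[D in leRHS]card_ord mulr_natl -sumr_const; apply: ler_sum => l _.
  apply: (@le_trans _ _ (set_dist mu N (th (- z n l) @^-1` N))).
    by apply: massU; apply: measurableD => //; exact: mact.
  by apply: Ninv; rewrite abszN; exact: hZ.
have mA'n : measurable (shifted_meet th (z n) (fun=> A')) by exact: mmeet.
have same x : ~ err x -> forall l, N (th (- z n l) x) <-> N x.
  move=> xe l; split=> Nx.
    by apply: contra_notP xe => nN; exists l => //; right.
  by apply: contra_notP xe => nN; exists l => //; left.
have c1 : correlation A' n <= mass mu W + mass mu err.
  apply: mass_cover => // x xA'; have [|xe] := pselect (err x); first by right.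
  left; have [Nx|Nx] := pselect (N x); [right|left]; split=> // l _ /=.
    by have [[_ nN]|[]//] := xA' l I; case: nN; apply/(same _ xe).
  by have [[]//|[_ nN]] := xA' l I; case: Nx; apply/(same _ xe l).
have c2 : mass mu W <= correlation A' n + mass mu err.
  apply: mass_cover => // x xW; have [|xe] := pselect (err x); first by right.
  left => l _; case: xW => [[xA Nx]|[xQ Nx]]; [left|right]; split.
  - exact: (xA l I).
  - by move=> Nl; apply: Nx; apply/(same _ xe l).
  - exact: (xQ l I).
  - by apply/(same _ xe l).
have := mix (inl (Ordinal nM, true)) (inl (Ordinal nM, false)); rewrite /= -/W.
rewrite -!/(correlation _ n) !ler_norml => /andP[? ?].
by apply/andP; split; lra.
Qed.

(** The sets that are spliced in.  The sign [s] is [1] for over-independence and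
    [-1] for under-independence.  Such a set may depend on the horizon [M], the
    gain [gamma] and the set [G] of good times may not. *)
Definition supply (s gamma : R) (G : nat -> Prop) := forall M (e : R), 0 < e ->
  exists Q, [/\ measurable Q, `|mass mu Q - 2^-1| <= e &
    forall n, (n < M)%N -> G n -> gamma <= s * (correlation Q n - 2^-1 ^+ D)].

(** After splicing, the measure is corrected to be exactly one half, so that
    the correlations of all the sets of the construction are compared with one
    and the same number. *)
Lemma layer (s gamma : R) (G : nat -> Prop) A (t : R) (M : nat) :
  `|s| = 1 -> 0 < gamma -> supply s gamma G ->
  measurable A -> mass mu A = 2^-1 -> 0 < t <= 1 ->
  exists A', [/\ measurable A', mass mu A' = 2^-1, set_dist mu A A' <= 3 * t &
    forall n, (n < M)%N -> G n ->
      (1 - t) * (s * (correlation A n - 2^-1 ^+ D)) + t * (gamma / 2) <=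
      s * (correlation A' n - 2^-1 ^+ D)].
Proof.
move=> s1 g0 sup mA A2 /andP[t0 t1].
have K0 : 0 < 2 * D%:R + 1 :> R by rewrite ltr_wpDl// mulr_ge0.
pose e := Num.min (t * (gamma / 2) / (2 * D%:R + 1)) (t / 3).
have e0 : 0 < e by rewrite lt_min !divr_gt0// mulr_gt0// divr_gt0.
have et : 3 * e <= t by rewrite mulrC -ler_pdivlMr// ge_min lexx orbT.
have eg : (2 * D%:R + 1) * e <= t * (gamma / 2).
  by rewrite mulrC -ler_pdivlMr// ge_min lexx.
have [Q [mQ Q2 hQ]] := sup M _ e0.
have t01 : 0 <= t <= 1 by rewrite ltW.
have [A1 [mA1 dA1 massA1 cA1]] := @splice A Q t e M mA mQ t01 e0.
have A1e : `|mass mu A1 - 2^-1| <= 2 * e.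
  move: massA1 Q2; rewrite A2 !ler_norml => /andP[? ?] /andP[? ?].
  by apply/andP; split; nra.
have a01 : 0 <= (2^-1 : R) <= 1 by apply/andP; split; lra.
have [A' [mA' A'2 dA']] := adjust_mass thP thM nontriv mA1 a01.
have dA'e := le_trans dA' A1e.
exists A'; split => //.
  apply: (le_trans (set_dist_triangle mu mA mA1 mA')); lra.
move=> n nM Gn; have := hQ n nM Gn; have := cA1 n nM.
have := correlation_dist n mA1 mA'.
have De : D%:R * set_dist mu A1 A' <= D%:R * (2 * e) by rewrite ler_wpM2l.
set c := correlation A n; set c1 := correlation A1 n; set c' := correlation A' n.
set cQ := correlation Q n; set p := 2^-1 ^+ D => h1 h2 h3.
have : `|s * (c' - ((1 - t) * c + t * cQ))| <= (2 * D%:R + 1) * e.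
  rewrite normrM s1 mul1r; move: h1 h2; rewrite !ler_norml => /andP[? ?] /andP[? ?].
  by apply/andP; split; lra.
rewrite ler_norml => /andP[h4 _].
have : t * gamma <= t * (s * (cQ - p)) by rewrite ler_wpM2l// ltW.
have -> : s * (c' - p) = s * (c' - ((1 - t) * c + t * cQ)) +
  (1 - t) * (s * (c - p)) + t * (s * (cQ - p)) by ring.
lra.
Qed.

(** A nearly invariant set of measure one half returns almost to itself, while
    [2 ^- D] is at most one quarter. *)
Lemma over_supply : (2 <= D)%N -> supply 1 8^-1 (fun=> True).
Proof.
move=> D2 M e e0; pose v := Num.min e (8^-1 / (D + 1)%:R).
have v0 : 0 < v by rewrite lt_min e0 divr_gt0// ltr0n addn1.
have vD : D%:R * v + v <= 8^-1.
  have : (D + 1)%:R * v <= 8^-1.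
    by rewrite mulrC -ler_pdivlMr ?ge_min ?lexx ?orbT// ltr0n addn1.
  by rewrite natrD; lra.
have [Z hZ] := shifts_bounded (fun n l m => z n l) M.
have h01 : 0 <= (2^-1 : R) <= 1 by apply/andP; split; lra.
have [Q [mQ Q2 Qinv]] := nearly_invariant thP thM nontriv Z h01 v0.
have ve : v <= e by rewrite ge_min lexx.
exists Q; split=> // [|n nM _]; first exact: le_trans ve.
have : mass mu Q <= correlation Q n + D%:R * v.
  have mQD l : measurable (Q `\` th (- z n l) @^-1` Q).
    by apply: measurableD => //; exact: mact.
  apply: (@le_trans _ _ (correlation Q n + mass mu (\bigcup_(l in [set: 'I_D])
      (Q `\` th (- z n l) @^-1` Q)))).
    apply: mass_cover => //; first exact: mmeet.
      by apply: fin_bigcup_measurable => //; exact: finite_finset.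
    move=> x Qx; have [?|] := pselect (shifted_meet th (z n) (fun=> Q) x); first by left.
    by move=> /existsNP[l /not_implyP[_ xl]]; right; exists l.
  rewrite lerD2l; apply: le_trans (mass_bigcup_le mu mQD) _.
  rewrite -[D in leRHS]card_ord mulr_natl -sumr_const; apply: ler_sum => l _.
  apply: (@le_trans _ _ (set_dist mu Q (th (- z n l) @^-1` Q))).
    by rewrite lerDl mass_ge0.
  by apply: Qinv; rewrite abszN; exact: hZ.
have pD : 2^-1 ^+ D <= 4^-1 :> R.
  apply: (@le_trans _ _ (2^-1 ^+ 2)); last by lra.
  by apply: ler_wiXn2l => //; lra.
by move: Q2; rewrite ler_norml mul1r => /andP[? ?]; lra.
Qed.

End Layers.

(** * Sets with small correlations *)
Lemma binomial_gap (R : realType) (b y : R) k : 0 <= b -> 0 <= y ->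
  b ^+ k.+2 + k.+2%:R * y * b ^+ k.+1 + y ^+ 2 * b ^+ k <= (b + y) ^+ k.+2.
Proof.
move=> b0 y0; elim: k => [|k IH]; first by rewrite expr0 expr1; nra.
have bk : 0 <= b ^+ k by rewrite exprn_ge0.
have := ler_wpM2r (addr_ge0 b0 y0) IH.
rewrite -exprSr; apply: le_trans.
rewrite (exprS b k.+2) (exprS b k.+1) (exprS b k) -(natr1 k.+2).
set K := k.+2%:R; have K0 : 0 <= K by exact: ler0n.
have : 0 <= K * y ^+ 2 * (b * b ^+ k) + y ^+ 3 * b ^+ k.
  by rewrite addr_ge0// !mulr_ge0// exprn_ge0.
set w := b ^+ k; rewrite -subr_ge0 => h.
rewrite -subr_ge0; apply: (le_trans h); rewrite le_eqVlt; apply/orP; left.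
by apply/eqP; rewrite -/K; ring.
Qed.

Section UnderSupply.
Context {disp : measure_display} {X : measurableType disp} {R : realType}.
Context (mu : probability X R) (th : int -> X -> X).
Context (thP : mp_action mu th) (thM : mixing_action mu th).
Context (nontriv : nontrivial_space mu) (k : nat).
Let D := k.+2.
Context (z : nat -> 'I_D -> int).
Implicit Types (A B C Q N Y : set X).

Let mact w A : measurable A -> measurable (th w @^-1` A).
Proof. exact: (act_measurable thP). Qed.

Let mmeet n (B : 'I_D -> set X) :
  (forall l, measurable (B l)) -> measurable (shifted_meet th (z n) B).
Proof. exact: (measurable_shifted_meet thP). Qed.

(** One factor replaced by its complement: the place where the periodic set
    must make up for the failure of [Y]. *)
Definition complement_at Y (l m : 'I_D) := if m == l then ~` Y else Y.

Lemma measurable_complement_at Y l m : measurable Y -> measurable (complement_at Y l m).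
Proof. by move=> mY; rewrite /complement_at; case: ifP => // _; exact: measurableC. Qed.

(** [Y] chosen so that [Y] together with an independent set of measure
    [1 / q] has measure one half. *)
Definition under_density (q : nat) : R := (q%:R - 2) / (2 * (q%:R - 1)).

(** Half a lower bound for the second order term of the expansion of
    [(b + y) ^ D], where [b >= 1 / 3] and [y >= 1 / (2 q)]. *)
Definition under_gain (q : nat) : R := 3^-1 ^+ D / (8 * q%:R ^+ 2).

Definition separated (q n : nat) :=
  forall l m, l != m -> ~~ (q%:Z %| z n l - z n m)%Z.

Definition under_good (q : nat) Y (n : nat) := [/\ separated q n,
  `|correlation mu th z Y n - under_density q ^+ D| <= under_gain q / (2 * D.+1%:R) &
  forall l, `|mass mu (shifted_meet th (z n) (complement_at Y l)) -
    under_density q ^+ D.-1 * (1 - under_density q)| <= under_gain q / (2 * D.+1%:R)].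

(** Add to [Y] a nearly [q]-periodic set [C] of measure [1 / q], nearly
    independent of the sets built from [Y].  At shifts that are distinct
    modulo [q] the translates of [C] are nearly disjoint, so at most one factor
    can come from [C]: with [b] the measure of [Y] and [y] that of [C] outside
    [Y], the correlation is nearly [b ^ D + D y b ^ (D - 1)], the first order
    part of [(b + y) ^ D = 2 ^- D]. *)
Lemma under_supply (q : nat) Y : (4 <= q)%N -> measurable Y ->
  mass mu Y = under_density q ->
  supply mu th z (-1) (under_gain q) (under_good q Y).
Proof.
move=> q4 mY Yb M e e0; set b := under_density q in Yb *.
set g := under_gain q; set tol := g / (2 * D.+1%:R).
have q_gt0 : (0 < q)%N by exact: leq_trans q4.
have qR : 4 <= q%:R :> R by rewrite ler_nat.
have q0 : 0 < q%:R :> R by lra.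
pose x : R := q%:R^-1; have x0 : 0 < x by rewrite invr_gt0.
have x4 : x <= 4^-1 by rewrite lef_pV2 ?posrE.
have bE : b + x * (1 - b) = 2^-1.
  by rewrite /b /under_density /x; field; apply/andP; split; lra.
have b3 : 3^-1 <= b.
  by rewrite /b /under_density ler_pdivlMr; nra.
have b2 : b <= 2^-1.
  by rewrite /b /under_density ler_pdivrMr; nra.
pose y := x * (1 - b); have y0 : 0 <= y by rewrite /y; nra.
have g0 : 0 < g by rewrite divr_gt0// ?mulr_gt0 ?exprn_gt0.
have tolD : D%:R * tol + tol = g / 2.
  have d0 : D.+1%:R != 0 :> R by rewrite pnatr_eq0.
  rewrite -[X in _ + X]mul1r -mulrDl natr1 /tol; move: d0; set d := D.+1%:R => d0.
  by field.
have gap : b ^+ D + D%:R * y * b ^+ D.-1 + 2 * g <= 2^-1 ^+ D.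
  have := @binomial_gap R b y k (ltac:(lra)) y0.
  rewrite -bE; apply: le_trans; rewrite lerD2l.
  have -> : 2 * g = x ^+ 2 / 4 * 3^-1 ^+ D.
    by rewrite /g /under_gain /x; field; lra.
  have yx : x ^+ 2 / 4 <= y ^+ 2 by rewrite /y; nra.
  have bk : 3^-1 ^+ D <= b ^+ k.
    apply: (@le_trans _ _ (3^-1 ^+ k)); last by rewrite lerXn2r ?nnegrE//; lra.
    by apply: ler_wiXn2l; [lra|lra|exact: leqW].
  by rewrite ler_pM// ?exprn_ge0// divr_ge0// sqr_ge0.
pose K : R := 2 * D%:R + (D * D)%:R.
have K1 : 1 <= K by rewrite /K -natrM -natrD ler1n.
pose v := Num.min (e / 2) (g / 2 / K).
have K0 : 0 < K by apply: lt_le_trans K1.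
have g2 : 0 < g / 2 by rewrite divr_gt0.
have v0 : 0 < v.
  by rewrite lt_min; apply/andP; split; apply: divr_gt0.
have ve : 2 * v <= e by rewrite mulrC -ler_pdivlMr// ge_min lexx.
have vK : K * v <= g / 2 by rewrite mulrC -ler_pdivlMr// ge_min lexx orbT.
have [Z hZ] := shifts_bounded (fun n l m => z n l - z n m) M.
have [C0 [mC0 C0x C0per]] := nearly_periodic thP thM nontriv Z q_gt0 v0.
pose F n l := shifted_meet th (z n) (complement_at Y l).
have mF n l : measurable (F n l) by apply: mmeet => m; exact: measurable_complement_at.
pose E (i : option ('I_M * 'I_D)) : set X :=
  if i is Some (n, l) then th (z n l) @^-1` F n l else Y.
have mE i : measurable (E i) by case: i => [[n l]|] //=; exact: mact.
have [w hw] := independent_translate thP thM mC0 mE v0.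
pose C := th w @^-1` C0; have mC : measurable C by exact: mact.
have massC : mass mu C = mass mu C0 by exact: (act_mass thP).
have Cx : `|mass mu C - x| <= v by rewrite massC.
have Cper u : (`|u| <= Z)%N -> ~~ (q%:Z %| u)%Z -> mass mu (C `&` th u @^-1` C) <= v.
  move=> uZ qu; rewrite /C (preimage_actC thP).
  rewrite -[X in mass mu X]/(th w @^-1` (C0 `&` th u @^-1` C0)) (act_mass thP).
    exact: C0per.
  by apply: measurableI => //; exact: mact.
pose Q := Y `|` C; have mQ : measurable Q by exact: measurableU.
exists Q; split => //.
  have : mass mu Q = mass mu Y + mass mu C - mass mu (C `&` Y).
    rewrite (_ : Q = Y `|` (C `\` Y)); last first.
      apply/seteqP; split=> a; last by move=> [?|[? _]]; [left|right].
      by move=> Qa; have [?|?] := pselect (Y a); [left|right; split=> //; case: Qa].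
    rewrite massU_disjoint//; last first.
    - by apply/seteqP; split=> a //= [? []].
    - exact: measurableD.
    by rewrite (mass_setID mu mC mY); ring.
  have := hw None; rewrite /= Yb -massC -/C => h ->.
  move: h Cx; rewrite !ler_norml => /andP[? ?] /andP[? ?].
  by apply/andP; split; nra.
move=> n nM [sep cY cF].
have mCl l : measurable (th (- z n l) @^-1` C) by exact: mact.
pose FC l := th (- z n l) @^-1` C `&` F n l.
have mFC l : measurable (FC l) by exact: measurableI.
pose CC (p : 'I_D * 'I_D) := if p.1 == p.2 then set0 else
  th (- z n p.1) @^-1` C `&` th (- z n p.2) @^-1` C.
have mCC p : measurable (CC p) by rewrite /CC; case: ifP => // _; exact: measurableI.
(* A point of the intersection fails to be in [Y] at no place, at one place
   [l], or at two. *)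
have cover : shifted_meet th (z n) (fun=> Q) `<=` shifted_meet th (z n) (fun=> Y) `|`
    (\bigcup_(l in [set: 'I_D]) FC l `|` \bigcup_(p in [set: 'I_D * 'I_D]) CC p).
  move=> a Qa; have [?|] := pselect (shifted_meet th (z n) (fun=> Y) a); first by left.
  move=> /existsNP[l /not_implyP[_ Yl]]; right.
  have Cl : C (th (- z n l) a) by have [] := Qa l I.
  have [[m [ml Ym]]|none] := pselect (exists m, m != l /\ ~ Y (th (- z n m) a)).
    right; exists (l, m) => //; rewrite /CC /= eq_sym (negbTE ml); split=> //.
    by have [] := Qa m I.
  left; exists l => //; split=> // m _; rewrite /complement_at /=.
  have [->|ml] := eqVneq m l; first by [].
  by apply: contra_notP none => Ym; exists m.
have massFC l : mass mu (FC l) <= y * b ^+ D.-1 + tol + 2 * v.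
  have -> : mass mu (FC l) = mass mu (C `&` th (z n l) @^-1` F n l).
    rewrite -(act_mass thP (z n l) (mFC l)); congr (mass mu (_ `&` _)).
    by apply/seteqP; split=> a; rewrite /preimage/= -(actD thP) addNr (act0 thP).
  have := hw (Some (Ordinal nM, l)); rewrite /= -massC -/C (act_mass thP)//.
  have := cF l; rewrite -/(F n l) -/b -/g -/tol.
  have [f0 f1] := (mass_ge0 mu (F n l), mass_le1 mu (mF n l)).
  move: Cx; rewrite !ler_norml => /andP[c1 c2] /andP[f2 f3] /andP[h1 h2].
  have : mass mu C * mass mu (F n l) <= x * mass mu (F n l) + v by nra.
  have : x * mass mu (F n l) <= x * (b ^+ D.-1 * (1 - b)) + tol.
    have tol0 : 0 <= tol by lra.
    by nra.
  have -> : x * (b ^+ D.-1 * (1 - b)) = y * b ^+ D.-1 by rewrite /y; ring.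
  by lra.
have massCC p : mass mu (CC p) <= v.
  rewrite /CC; case: eqVneq => [_|lm]; first by rewrite /mass measure0 ltW.
  rewrite -(act_mass thP (z n p.1)); last exact: measurableI.
  have -> : th (z n p.1) @^-1` (th (- z n p.1) @^-1` C `&` th (- z n p.2) @^-1` C) =
      C `&` th (z n p.1 - z n p.2) @^-1` C.
    by apply/seteqP; split=> a; rewrite /preimage/= -!(actD thP) addNr (act0 thP)
      (addrC (- z n p.2)).
  by apply: Cper; [exact: hZ|exact: sep].
have sumFC : mass mu (\bigcup_(l in [set: 'I_D]) FC l) <=
    D%:R * (y * b ^+ D.-1 + tol + 2 * v).
  apply: le_trans (mass_bigcup_le mu mFC) _.
  have cst (c : R) : \sum_(l < D) c = D%:R * c by rewrite sumr_const card_ord mulr_natl.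
  by rewrite -cst; apply: ler_sum => l _.
have sumCC : mass mu (\bigcup_(p in [set: 'I_D * 'I_D]) CC p) <= (D * D)%:R * v.
  apply: le_trans (mass_bigcup_le mu mCC) _.
  have cst (c : R) : \sum_(p : 'I_D * 'I_D) c = (D * D)%:R * c.
    by rewrite sumr_const card_prod !card_ord mulr_natl.
  by rewrite -cst; apply: ler_sum => p _; exact: massCC.
have cQ : correlation mu th z Q n <= b ^+ D + tol +
    (D%:R * (y * b ^+ D.-1 + tol + 2 * v) + (D * D)%:R * v).
  have mU1 : measurable (\bigcup_(l in [set: 'I_D]) FC l).
    by apply: fin_bigcup_measurable => //; exact: finite_finset.
  have mU2 : measurable (\bigcup_(p in [set: 'I_D * 'I_D]) CC p).
    by apply: fin_bigcup_measurable => //; exact: finite_finset.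
  have := mass_cover mu (mmeet n (fun=> mQ)) (mmeet n (fun=> mY))
    (measurableU _ _ mU1 mU2) cover.
  have := massU mu mU1 mU2; move: cY; rewrite /correlation ler_norml -/b -/g -/tol.
  by move=> /andP[_ ?]; lra.
have : D%:R * (y * b ^+ D.-1 + tol + 2 * v) + (D * D)%:R * v =
    D%:R * y * b ^+ D.-1 + D%:R * tol + K * v by rewrite /K; ring.
by rewrite mulN1r opprB; lra.
Qed.

End UnderSupply.

(** * Rare sets of times and the balance of gains and costs *)
Section Rare.
Context {R : realType}.
Implicit Types (B : nat -> Prop) (eta : R).

Definition frequency B N : R := \sum_(n < N) `[< B n >]%:R.

Definition rare eta B :=
  exists N0, forall N, (N0 <= N)%N -> frequency B N <= eta * N%:R.

Lemma frequency_le B B' N : (forall n, (n < N)%N -> B n -> B' n) ->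
  frequency B N <= frequency B' N.
Proof.
move=> BB'; apply: ler_sum => n _; rewrite ler_nat.
case: asboolP => // Bn; case: asboolP => // B'n.
by case: B'n; exact: BB'.
Qed.

Lemma frequency_bigU (I : finType) (B : I -> nat -> Prop) N :
  frequency (fun n => exists i, B i n) N <= \sum_i frequency (B i) N.
Proof.
rewrite exchange_big/=; apply: ler_sum => n _.
case: asboolP => [[i Bi]|_]; last exact: sumr_ge0.
rewrite (bigD1 i)//= (asboolT Bi) lerDl; exact: sumr_ge0.
Qed.

Lemma frequencyU B B' N :
  frequency (fun n => B n \/ B' n) N <= frequency B N + frequency B' N.
Proof.
rewrite -big_split/=; apply: ler_sum => n _; rewrite -natrD ler_nat.
case: asboolP => // -[Bn|Bn]; rewrite (asboolT Bn) ?leq_addr//.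
by rewrite leq_addl.
Qed.

Lemma frequency_below K N : frequency (fun n => (n < K)%N) N <= K%:R.
Proof.
rewrite /frequency -natr_sum ler_nat.
apply: (@leq_trans (\sum_(n < N) (n < K))%N).
  by apply: leq_sum => n _; case: asboolP => [->|].
elim: N => [|N IH]; first by rewrite big_ord0.
rewrite big_ord_recr/=; case: (ltnP N K) => [NK|_]; last by rewrite addn0.
rewrite addn1; apply: leq_ltn_trans NK.
by rewrite -[leqRHS]card_ord -sum1_card leq_sum// => i _; case: (_ < _)%N.
Qed.

Lemma rare_le eta B B' : (forall n, B n -> B' n) -> rare eta B' -> rare eta B.
Proof.
move=> BB' [N0 h]; exists N0 => N /h; apply: le_trans.
by apply: frequency_le => n _; exact: BB'.
Qed.

Lemma rareU eta eta' B B' :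
  rare eta B -> rare eta' B' -> rare (eta + eta') (fun n => B n \/ B' n).
Proof.
move=> [N0 h] [N1 h']; exists (maxn N0 N1) => N; rewrite geq_max => /andP[/h {}h /h' {}h'].
by apply: (le_trans (frequencyU _ _ _)); rewrite mulrDl lerD.
Qed.

Lemma rare_bigU (I : finType) (eta : I -> R) (B : I -> nat -> Prop) :
  (forall i, rare (eta i) (B i)) -> rare (\sum_i eta i) (fun n => exists i, B i n).
Proof.
move=> /choice[N0 h]; exists (\max_i N0 i)%N => N NN.
apply: (le_trans (frequency_bigU _ _)); rewrite mulr_suml.
by apply: ler_sum => i _; apply: h; apply: leq_trans NN; exact: leq_bigmax.
Qed.

Lemma rare_cesaro (a : nat -> R) (eta e : R) : cesaro_null a -> 0 < eta -> 0 < e ->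
  rare eta (fun n => e <= `|a n|).
Proof.
move=> na eta0 e0; have [N0 h] := na _ (mulr_gt0 eta0 e0).
exists N0 => N /h {}h; rewrite -(ler_pM2r e0) mulrAC; apply: le_trans h.
rewrite mulr_suml; apply: ler_sum => n _.
by case: asboolP => [|_]; rewrite ?mul1r ?mul0r.
Qed.

Lemma rare_cesaro_null (B : nat -> Prop) : (forall eta, 0 < eta -> rare eta B) ->
  cesaro_null (fun n => `[< B n >]%:R : R).
Proof.
move=> rB e /rB[N0 h]; exists N0 => N /h; apply: le_trans.
by apply: ler_sum => n _; rewrite normr_nat.
Qed.

(** Averaging with weights [1 - t j] and [t j] against a value at least [g] adds
    [t j * g], and shrinks the gains already made; with [s] the sum of the
    weights, this loses at most [g * s ^ 2] in all. *)
Lemma averaged_gain (phi t : nat -> R) (b g : R) (k m : nat) :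
  (forall j, 0 <= t j <= 1) -> 0 <= b -> 0 <= g -> - b <= phi k ->
  (forall i, (i < m)%N ->
     (1 - t (k + i)%N) * phi (k + i)%N + t (k + i)%N * g <= phi (k + i).+1) ->
  - b + g * (\sum_(i < m) t (k + i)%N - (\sum_(i < m) t (k + i)%N) ^+ 2) <=
  phi (k + m)%N.
Proof.
move=> t01 b0 g0 pk; elim: m => [|m IH] step.
  by rewrite big_ord0 addn0 expr0n subrr mulr0 addr0.
have {}IH := IH (fun i im => step i (ltnW im)).
rewrite addnS; apply: le_trans (step m (ltnSn m)).
rewrite big_ord_recr/=; set s := \sum_(i < m) _ in IH *.
have /andP[t0 t1] := t01 (k + m)%N; set u := t (k + m)%N in t0 t1 *.
have s0 : 0 <= s by apply: sumr_ge0 => i _; have /andP[] := t01 (k + i)%N.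
have : (1 - u) * (- b + g * (s - s ^+ 2)) <= (1 - u) * phi (k + m)%N.
  by rewrite ler_wpM2l// subr_ge0.
have : 0 <= g * (u * s + u * s ^+ 2 + u ^+ 2).
  by rewrite mulr_ge0// !addr_ge0// mulr_ge0// sqr_ge0.
have : 0 <= u * b by rewrite mulr_ge0.
by rewrite /=; nra.
Qed.

(** Summable sizes of order [1 / j ^ 2], whose tails, of order [1 / j], are much
    larger than the single terms: the steps after a given one outweigh it. *)
Definition step_size (j : nat) : R := j.+2%:R^-1 - j.+3%:R^-1.

Lemma sum_step_size k m :
  \sum_(i < m) step_size (k + i)%N = k.+2%:R^-1 - (k + m).+2%:R^-1.
Proof.
elim: m => [|m IH]; first by rewrite big_ord0 addn0 subrr.
by rewrite big_ord_recr/= IH /step_size addnS addrA subrK.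
Qed.

Lemma step_size_gt0 j : 0 < step_size j.
Proof. by rewrite subr_gt0 ltf_pV2 ?posrE ?ltr0n// ltr_nat. Qed.

Lemma step_size_le1 j : step_size j <= 1.
Proof.
have h1 : j.+2%:R^-1 <= 1 :> R by rewrite invf_le1 ?ltr0n// ler1n.
have h2 : 0 <= j.+3%:R^-1 :> R by rewrite invr_ge0.
by rewrite (le_trans _ h1)// gerBl.
Qed.

(** The level used at step [j] grows so slowly that [4 ^ level] stays below
    the fourth root of [j + 1]. *)
Definition level (j : nat) := trunc_log 256 j.+1.

Lemma level_mono i j : (i <= j)%N -> (level i <= level j)%N.
Proof. by move=> ij; apply: leq_trunc_log. Qed.

Lemma level_unbounded m j : (256 ^ m <= j)%N -> (m <= level j)%N.
Proof. by move=> mj; apply: trunc_log_max => //; rewrite ltnW. Qed.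

(** Here [K] is a stage [k], [w] is [4 ^ level (k ^ 2)] and [d] is the number of
    sets that are intersected.  On the left is the cost of step [k] and of all
    the steps beyond [k ^ 2], of order [d / k ^ 2]; on the right is the gain of
    the steps in between, of order [kappa / (w * k)], which is larger since
    [w ^ 2] is at most [2 k] and [kappa * w] is large compared to [d]. *)
Lemma gain_exceeds_cost (K w kappa d : R) : 4 <= K -> 1 <= d -> 1 <= w ->
  w ^+ 4 <= K ^+ 2 + 1 -> 640 * d < kappa * w ->
  (1 + 3 * d) * ((K + 2)^-1 - (K + 3)^-1) + 6 * d / (K ^+ 2 + 3) <
  kappa / (2 * w) * ((K + 3)^-1 - (K ^+ 2 + 3)^-1 -
                     ((K + 3)^-1 - (K ^+ 2 + 3)^-1) ^+ 2).
Proof.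
move=> K4 d1 w1 wK kw; set s := (K + 3)^-1 - (K ^+ 2 + 3)^-1.
have K0 : 0 < K by lra.
have w0 : 0 < w by lra.
have k0 : 0 < kappa by rewrite -(pmulr_lgt0 _ w0); lra.
have wK2 : w ^+ 2 <= 2 * K.
  rewrite -(@ler_pXn2r _ 2) ?nnegrE ?sqr_ge0//; last by lra.
  by rewrite -exprM; apply: (le_trans wK); rewrite exprMn; nra.
have sl : (8 * K)^-1 <= s.
  have -> : s = (K ^+ 2 - K) / ((K + 3) * (K ^+ 2 + 3)).
    by rewrite /s; field; apply/andP; split; nra.
  by rewrite ler_pdivlMr ?ler_pdivrMl; nra.
have su : s <= 2^-1.
  have : (K + 3)^-1 <= 2^-1 by rewrite lef_pV2 ?posrE; lra.
  have : 0 <= (K ^+ 2 + 3)^-1 by rewrite invr_ge0; nra.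
  by rewrite /s; lra.
have lhs : (1 + 3 * d) * ((K + 2)^-1 - (K + 3)^-1) + 6 * d / (K ^+ 2 + 3) <=
    10 * d / K ^+ 2.
  have h1 : (K + 2)^-1 - (K + 3)^-1 <= (K ^+ 2)^-1.
    have -> : (K + 2)^-1 - (K + 3)^-1 = ((K + 2) * (K + 3))^-1.
      by field; apply/andP; split; lra.
    by rewrite lef_pV2 ?posrE; nra.
  have h2 : (K ^+ 2 + 3)^-1 <= (K ^+ 2)^-1 by rewrite lef_pV2 ?posrE; nra.
  have h3 : 0 < (K ^+ 2)^-1 by rewrite invr_gt0; nra.
  move: h1 h2 h3; set a := (K + 2)^-1 - _; set b := (K ^+ 2 + 3)^-1; set c := (K ^+ 2)^-1.
  by move=> *; nra.
apply: (le_lt_trans lhs).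
have gs : (16 * K)^-1 <= s - s ^+ 2.
  have : (16 * K)^-1 = (8 * K)^-1 / 2 by field; lra.
  have : 0 < (8 * K)^-1 by rewrite invr_gt0; lra.
  by nra.
apply: (@lt_le_trans _ _ (kappa / (2 * w) * (16 * K)^-1)); last first.
  by rewrite ler_wpM2l// divr_ge0//; lra.
have -> : kappa / (2 * w) * (16 * K)^-1 = kappa / (32 * w * K).
  by field; apply/andP; split; lra.
rewrite ltr_pdivlMr; last by nra.
rewrite mulrAC ltr_pdivrMr; last by nra.
have : 320 * d * w < kappa * K by nra.
by nra.
Qed.

End Rare.

(** * The limit of infinitely many layers *)
Section LimitSet.
Context {disp : measure_display} {X : measurableType disp} {R : realType}.
Context (mu : probability X R).

(** The inferior limit.  A point at which nothing changes from time [J] on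
    belongs to it exactly when it belongs to [A J]; the other points have small
    measure. *)
Lemma limit_set (A : nat -> set X) : (forall j, measurable (A j)) ->
  (forall j, set_dist mu (A j) (A j.+1) <= 3 * step_size j) ->
  exists B, measurable B /\ forall J, set_dist mu (A J) B <= 6 / J.+2%:R.
Proof.
move=> mA dA; pose B := \bigcup_n \bigcap_(j in [set j | (n <= j)%N]) A j.
have mB : measurable B.
  by apply: bigcup_measurable => n _; apply: bigcap_measurableType => j _; exact: mA.
exists B; split=> // J.
pose change j := (A j `\` A j.+1) `|` (A j.+1 `\` A j).
have mchange j : measurable (change j) by apply: measurableU; exact: measurableD.
pose V L := [set x | exists2 i, (i < L)%N & change (J + i)%N x].
have VE L : V L.+1 = V L `|` change (J + L)%N.
  apply/seteqP; split=> x.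
    move=> [i]; rewrite ltnS leq_eqVlt => /predU1P[->|iL] xi; first by right.
    by left; exists i.
  by move=> [[i iL xi]|xL]; [exists i => //; exact: leqW|exists L].
have V0 : V 0%N = set0 by apply/seteqP; split=> x // [].
have mV L : measurable (V L).
  by elim: L => [|L IH]; rewrite ?V0// VE; exact: measurableU.
have massV L : mass mu (V L) <= 3 / J.+2%:R.
  apply: (@le_trans _ _ (3 * \sum_(i < L) step_size (R := R) (J + i)%N)).
    elim: L => [|L IH]; first by rewrite V0 /mass measure0 big_ord0 mulr0.
    rewrite VE big_ord_recr/= mulrDr; apply: (le_trans (massU mu (mV L) (mchange _))).
    apply: lerD => //; apply: le_trans (dA _).
    by apply: massU; exact: measurableD.
  by rewrite sum_step_size ler_wpM2l// gerBl invr_ge0.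
have stable x : ~ (\bigcup_L V L) x -> forall i, A (J + i)%N x <-> A J x.
  move=> nV; elim=> [|i IH]; first by rewrite addn0.
  rewrite -IH addnS; split=> xi; apply: contra_notP nV => nxi.
    by exists i.+1 => //; exists i => //; right.
  by exists i.+1 => //; exists i => //; left.
have mU : measurable (\bigcup_L V L) by apply: bigcup_measurable => L _; exact: mV.
have massU : mass mu (\bigcup_L V L) <= 3 / J.+2%:R.
  apply/ler_addgt0Pr => e e0.
  have ndV i j : (i <= j)%N -> V i `<=` V j.
    by move=> ij x [l li xl]; exists l => //; exact: leq_trans ij.
  have [L hL] := mass_nondecreasing mu mV ndV e0.
  by rewrite -lerBlDr; exact: le_trans hL (massV L).
have h1 : mass mu (A J `\` B) <= mass mu (\bigcup_L V L).
  apply: mass_le => //; first exact: measurableD.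
  move=> x [AJ nB]; apply: contra_notP nB => nV; exists J => // j /= Jj.
  by rewrite -(subnKC Jj); apply/(stable _ nV).
have h2 : mass mu (B `\` A J) <= mass mu (\bigcup_L V L).
  apply: mass_le => //; first exact: measurableD.
  move=> x [[n _ An] nA]; apply: contra_notP nA => nV.
  by apply/(stable _ nV n); apply: An => /=; exact: leq_addl.
have := lerD (le_trans h1 massU) (le_trans h2 massU).
by rewrite -mulrDl -natrD.
Qed.

End LimitSet.

Section Scheme.
Context {disp : measure_display} {X : measurableType disp} {R : realType}.
Context (mu : probability X R) (th : int -> X -> X).
Context (thP : mp_action mu th) (thM : mixing_action mu th).
Context (nontriv : nontrivial_space mu) (D : nat) (D0 : (0 < D)%N).
Context (z : nat -> 'I_D -> int) (s kappa : R) (s1 : `|s| = 1) (kappa0 : 0 < kappa).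
Context (G : nat -> nat -> Prop).
Context (sup : forall i, supply mu th z s (kappa / 4 ^+ i) (G i)).
Context (rareG : forall eta : R, 0 < eta -> exists i0, forall K,
  rare eta (fun n => exists i, (i0 <= i <= K)%N /\ ~ G i n)).
Context (mixz : forall A, measurable A ->
  cesaro_null (fun n => correlation mu th z A n - mass mu A ^+ D)).

Let excess A n := s * (correlation mu th z A n - 2^-1 ^+ D).

Let good A := measurable A /\ mass mu A = 2^-1.

(** [m] and [m'] are consecutive horizons.  Beyond [m'] the current set [A] is
    almost always nearly independent and the times almost always good for the
    levels in use; below [m'] the next set [A'] gains. *)
Let is_step (i0 : nat -> nat) (j : nat) (A : set X) (m : nat) (A' : set X) (m' : nat) :=
  [/\ (j.+1 * m < m')%N,
      forall N, (m' <= N)%N ->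
        frequency (R := R) (fun n => step_size j <= `|excess A n|) N <= j.+1%:R^-1 * N%:R,
      forall k N, (k <= j)%N -> (m' <= N)%N ->
        frequency (R := R)
          (fun n => exists i, (i0 k <= i <= level (j ^ 2))%N /\ ~ G i n) N <=
          k.+1%:R^-1 * N%:R,
      set_dist mu A A' <= 3 * step_size j &
      forall n, (n < m')%N -> G (level j) n ->
        (1 - step_size j) * excess A n +
        step_size j * (kappa / 4 ^+ level j / 2) <= excess A' n].

Let step_exists (i0 : nat -> nat) j A m :
  (forall k K, rare (k.+1%:R^-1 : R) (fun n => exists i, (i0 k <= i <= K)%N /\ ~ G i n)) ->
  good A -> exists A' m', good A' /\ is_step i0 j A m A' m'.
Proof.
move=> ri0 [mA A2].
have nA : cesaro_null (excess A).
  by have := cesaro_nullZ s (mixz mA); move/eq_cesaro_null; apply => n; rewrite A2.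
have j0 : 0 < j.+1%:R^-1 :> R by rewrite invr_gt0 ltr0n.
have [N1 hN1] := rare_cesaro nA j0 (step_size_gt0 j).
have /choice[N2 hN2] := fun k => ri0 k (level (j ^ 2)).
pose m' := maxn (j.+1 * m).+1 (maxn N1 (\max_(k < j.+1) N2 k)).
have t01 : 0 < (step_size j : R) <= 1 by rewrite step_size_gt0 step_size_le1.
have g0 : 0 < kappa / 4 ^+ level j by rewrite divr_gt0// exprn_gt0.
have [A' [mA' A'2 dA' hA']] := layer thP thM nontriv m' s1 g0 (sup (level j)) mA A2 t01.
exists A', m'; split=> //; split=> //.
- exact: leq_maxl.
- by move=> N; rewrite !geq_max => /and3P[_ h _]; exact: hN1.
- move=> k N kj; rewrite !geq_max => /and3P[_ _ h]; apply: hN2.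
  by apply: leq_trans h; exact: (leq_bigmax (Ordinal (kj : (k < j.+1)%N))).
Qed.

(** [A j.+1] is obtained from [A j] by a layer that gains at all good times below
    a horizon [M j], chosen after [A j].  Nothing is known of the effect of
    this layer at times between [M j] and [M j.+1], but its cost is of order
    [1 / j ^ 2], and at these times the layers [j + 1] to [j ^ 2] gain. *)
Theorem layered_construction : exists A, measurable A /\ mass mu A = 2^-1 /\
  forall eta : R, 0 < eta ->
    rare eta (fun n => s * (correlation mu th z A n - 2^-1 ^+ D) <= 0).
Proof.
have /choice[i0 ri0] : forall k, exists i0, forall K,
    rare (k.+1%:R^-1 : R) (fun n => exists i, (i0 <= i <= K)%N /\ ~ G i n).
  by move=> k; apply: rareG; rewrite invr_gt0 ltr0n.
have [A0 [mA0 _ A02]] : exists A, [/\ measurable A, A `<=` setT & mass mu A = 2^-1].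
  by apply: (exact_subset thP thM nontriv) => //; rewrite massT; apply/andP; split; lra.
pose state := ({A | good A} * nat)%type.
have step (j : nat) (st : state) : {st' : state |
    is_step i0 j (sval st.1) st.2 (sval st'.1) st'.2}.
  apply: cid; case: st => -[A gA] m.
  have [A' [m' [gA' h]]] := step_exists j m ri0 gA.
  by exists (exist _ A' gA', m').
pose S := fix S j : state :=
  if j is j'.+1 then sval (step j' (S j')) else (exist _ A0 (conj mA0 A02), 0%N).
pose A j := sval (S j).1; pose M j := (S j.+1).2.
have gA j : good (A j) by exact: (svalP (S j).1).
have stepA j : is_step i0 j (A j) (S j).2 (A j.+1) (M j) by exact: (svalP (step j (S j))).
have MS j : (j.+2 * M j < M j.+1)%N by have [] := stepA j.+1.
have Mlt j : (M j < M j.+1)%N.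
  by apply: leq_ltn_trans (MS j); rewrite leq_pmull.
have Mle i j : (i <= j)%N -> (M i <= M j)%N.
  move=> /subnK <-; elim: (j - i)%N => // l IH.
  by rewrite addSn; apply: leq_trans (ltnW (Mlt _)).
have Mge j : (j <= M j)%N.
  by elim: j => // j IH; apply: leq_ltn_trans (Mlt j).
have [B [mB dB]] := limit_set (fun j => (gA j).1)
  (fun j => let: And5 _ _ _ h _ := stepA j in h).
have B2 : mass mu B = 2^-1.
  apply/eqP; rewrite -subr_eq0 -normr_eq0 eq_le normr_ge0 andbT.
  apply/ler_addgt0Pr => e e0; rewrite add0r.
  pose J := Num.bound (6 / e).
  have : `|mass mu (A J) - mass mu B| <= e.
    apply: (le_trans (mass_dist mu (gA J).1 mB)); apply: (le_trans (dB J)).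
    rewrite ler_pdivrMr ?ltr0n// mulrC -ler_pdivrMr//.
    have : 6 / e < J%:R by rewrite archi_boundP// divr_ge0// ltW.
    by move=> /ltW/le_trans; apply; rewrite ler_nat; lia.
  by rewrite (gA J).2 distrC.
exists B; split=> //; split=> //.
have D1 : 1 <= D%:R :> R by rewrite ler1n.
have excess_dist A1 A2 n : measurable A1 -> measurable A2 ->
    `|excess A1 n - excess A2 n| <= D%:R * set_dist mu A1 A2.
  move=> m1 m2; rewrite /excess -mulrBr normrM s1 mul1r.
  rewrite opprB addrA subrK.
  exact: correlation_dist.
(* At a time between [M k] and [M k.+1]: step [k] may spoil the correlation, the
   steps from [k.+1] to [k ^ 2] improve it, the later ones change it little. *)
have main k n (w : R := 4 ^+ level (k ^ 2)) : (4 <= k)%N -> 640 * D%:R < kappa * w ->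
    (n < M k.+1)%N -> `|excess (A k) n| < step_size k ->
    (forall i, (level k <= i <= level (k ^ 2))%N -> G i n) -> 0 < excess B n.
  move=> k4 kw nM small allG.
  have k2 : (k < k ^ 2)%N by rewrite -[X in (X < _)%N]expn1 ltn_exp2l// (leq_trans _ k4).
  have kR : 4 <= k%:R :> R by rewrite ler_nat.
  have w1 : 1 <= w by rewrite /w -natrX ler1n expn_gt0.
  have wk : w ^+ 4 <= k%:R ^+ 2 + 1.
    rewrite /w -exprM mulnC exprM -!natrX natr1 ler_nat.
    exact: trunc_logP.
  have gain := gain_exceeds_cost kR D1 w1 wk kw.
  pose m := (k ^ 2 - k)%N.
  have km : (k.+1 + m)%N = (k ^ 2).+1 by rewrite addSn subnKC// ltnW.
  pose b : R := (1 + 3 * D%:R) * step_size k.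
  have b0 : 0 <= b.
    by rewrite mulr_ge0 ?(ltW (step_size_gt0 k))//; lra.
  have w0 : 0 < w by lra.
  have g0 : 0 <= kappa / (2 * w) by rewrite divr_ge0 ?(ltW kappa0)//; lra.
  have start : - b <= excess (A k.+1) n.
    have := excess_dist _ _ n (gA k).1 (gA k.+1).1.
    have [_ _ _ dk _] := stepA k.
    have : D%:R * set_dist mu (A k) (A k.+1) <= D%:R * (3 * step_size k).
      by rewrite ler_wpM2l.
    move: small; rewrite ltr_norml ler_norml /b => /andP[? ?] ? /andP[? ?]; lra.
  have t01 j : 0 <= step_size (R := R) j <= 1.
    by rewrite (ltW (step_size_gt0 j)) step_size_le1.
  have := averaged_gain (phi := fun j => excess (A j) n) (k := k.+1) (m := m)
    t01 b0 g0 start.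
  rewrite sum_step_size km => /(_ _)/wrap[].
    move=> i im; set j := (k.+1 + i)%N.
    have jk2 : (j <= k ^ 2)%N by rewrite -ltnS -km ltn_add2l.
    have kj : (k < j)%N by rewrite /j addSn ltnS leq_addr.
    have lj : (level k <= level j <= level (k ^ 2))%N by rewrite !level_mono// ltnW.
    have [_ _ _ _ hj] := stepA j.
    apply: le_trans (hj n (leq_trans nM (Mle _ _ kj)) (allG _ lj)).
    rewrite lerD2l ler_wpM2l ?(ltW (step_size_gt0 j))//.
    have -> : kappa / (2 * w) = kappa / w / 2 by field; lra.
    rewrite ler_wpM2r// ler_wpM2l ?(ltW kappa0)// lef_pV2 ?posrE ?exprn_gt0//.
    by rewrite /w ler_weXn2l ?ler1n// level_mono.
  have := excess_dist _ _ n (gA (k ^ 2).+1).1 mB.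
  have : D%:R * set_dist mu (A (k ^ 2).+1) B <= D%:R * (6 / (k ^ 2).+3%:R).
    by rewrite ler_wpM2l.
  rewrite ler_norml => d1 /andP[d2 d3] avg; move: gain d1 avg; rewrite /b /step_size.
  have -> : k%:R + 2 = k.+2%:R :> R by rewrite -natrD addn2.
  have -> : k%:R + 3 = k.+3%:R :> R by rewrite -natrD addn3.
  have -> : k%:R ^+ 2 + 3 = (k ^ 2).+3%:R :> R by rewrite -natrX -natrD addn3.
  set x1 := k.+2%:R^-1; set x2 := k.+3%:R^-1; set x3 := (k ^ 2).+3%:R^-1.
  set y := kappa / (2 * w) * _ => h1 h2 h3.
  lra.
move=> eta eta0.
(* Five terms: the times below [M k], and two kinds of bad times for each of
   the two stages before [N]. *)
pose m0 := Num.bound (5 / eta).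
have m0E : 5 * m0.+1%:R^-1 <= eta.
  rewrite ler_pdivrMr ?ltr0n// mulrC -ler_pdivrMr//.
  have : 5 / eta < m0%:R by rewrite archi_boundP// divr_ge0// ltW.
  by move=> /ltW/le_trans; apply; rewrite ler_nat.
pose c : R := m0.+1%:R^-1; have c0 : 0 <= c by rewrite invr_ge0.
have [L0 hL0] : exists L0 : nat, 640 * D%:R / kappa < L0%:R.
  exists (Num.bound (640 * D%:R / kappa)).
  apply: archi_boundP; apply: divr_ge0; last exact: ltW.
  by apply: mulr_ge0; exact: ler0n.
have [k0 [k0m k04 k0i0 k0L0]] : exists k0, [/\ (m0 <= k0)%N, (4 <= k0)%N,
    (256 ^ i0 m0 <= k0)%N & (256 ^ L0 <= k0)%N].
  exists (maxn (maxn m0 4) (maxn (256 ^ i0 m0) (256 ^ L0))).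
  by rewrite !leq_max !leqnn !orbT.
have k0L i : (k0 <= i)%N -> 640 * D%:R < kappa * 4 ^+ level (i ^ 2).
  move=> k0i; rewrite (mulrC kappa) -ltr_pdivrMr//.
  apply: (lt_le_trans hL0).
  have Li : (L0 <= level (i ^ 2))%N.
    apply: level_unbounded; apply: (leq_trans k0L0); apply: (leq_trans k0i).
    by rewrite -mulnn; case: (i) => // i'; rewrite leq_pmulr.
  move: Li; set l := level _ => Li; rewrite -natrX ler_nat.
  by rewrite ltnW// (leq_ltn_trans Li)// ltn_expl.
pose bad i n := (step_size i <= `|excess (A i) n|) \/
  (exists l, (i0 m0 <= l <= level (i ^ 2))%N /\ ~ G l n).
have freq_bad i N : (k0 <= i)%N -> (M i <= N)%N ->
    frequency (R := R) (bad i) N <= 2 * c * N%:R.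
  move=> k0i MN; have [_ h1 h2 _ _] := stepA i.
  have m0i : (m0 <= i)%N by exact: leq_trans k0m k0i.
  apply: le_trans (frequencyU _ _ _) _.
  rewrite -mulrA mulr_natl mulr2n lerD//; last exact: h2.
  apply: (le_trans (h1 N MN)); rewrite ler_wpM2r// lef_pV2 ?posrE ?ltr0n//.
  by rewrite ler_nat ltnS.
have bad_main i n : (k0 <= i)%N -> (n < M i.+1)%N -> excess B n <= 0 -> bad i n.
  move=> k0i nM; apply: contraPP => /not_orP[/negP small allG].
  rewrite -ltNge in small; apply/negP; rewrite -ltNge; apply: (main i n) => //.
  - exact: leq_trans k04 k0i.
  - exact: k0L.
  - move=> l /andP[il li]; apply: contra_notP allG => nG; exists l; split=> //.
    rewrite li andbT; apply: leq_trans il; apply: level_unbounded.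
    exact: leq_trans k0i0 k0i.
exists (M k0.+1) => N MN.
have exk : exists k, (M k <= N)%N by exists k0.+1.
have bk k : (M k <= N)%N -> (k <= N)%N by apply: leq_trans; exact: Mge.
have [k Mk kmax] := ex_maxnP exk bk.
case: k Mk kmax => [|k] Mk kmax; first by have := kmax _ MN.
have k0k : (k0 <= k)%N by exact: (kmax _ MN).
have NM : (N < M k.+2)%N by rewrite ltnNge; apply/negP => /kmax; rewrite ltnn.
apply: (@le_trans _ _ (frequency (fun n => (n < M k)%N \/ (bad k n \/ bad k.+1 n)) N)).
  apply: frequency_le => n nN exn; have [nMk|Mkn] := ltnP n (M k); first by left.
  right; have [nMk1|Mk1n] := ltnP n (M k.+1); first by left; exact: bad_main.
  by right; apply: bad_main => //; [exact: leqW|exact: ltn_trans NM].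
apply: le_trans (frequencyU _ _ _) _.
have h1 := le_trans (frequencyU (bad k) (bad k.+1) N)
  (lerD (freq_bad k N k0k (leq_trans (ltnW (Mlt k)) Mk)) (freq_bad k.+1 N (leqW k0k) Mk)).
have h2 : (M k)%:R <= c * N%:R.
  rewrite -ler_pdivrMl ?invr_gt0 ?ltr0n// invrK -natrM ler_nat.
  apply: leq_trans Mk; apply: leq_trans (ltnW (MS k)).
  rewrite leq_mul2r; apply/orP; right; apply: leqW; rewrite ltnS.
  exact: leq_trans k0m k0k.
have h0 : frequency (R := R) (fun n => (n < M k)%N) N <= c * N%:R.
  exact: le_trans (frequency_below _ _) h2.
apply: (le_trans (lerD h0 h1)).
rewrite (_ : _ + _ = 5 * c * N%:R); last by ring.
by rewrite ler_wpM2r.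
Qed.

End Scheme.

(** * The exceptional times of the small correlations *)
Section RareExceptions.
Context {disp : measure_display} {X : measurableType disp} {R : realType}.
Context (mu : probability X R) (th : int -> X -> X) (k : nat).
Let D := k.+2.
Context (P : 'I_D -> {poly R}) (Pz : forall l, integer_valued (P l)).
Context (Pd : forall l m, l != m -> nonconstant (P l - P m)).

Let z n l := int_value (P l) n.

Context (mixz : forall B : 'I_D -> set X, (forall l, measurable (B l)) ->
  cesaro_null (fun n => mass mu (shifted_meet th (z n) B) - \prod_(l < D) mass mu (B l))).

(** One exponent serves for the finitely many pairs of polynomials, and larger
    powers of 2 only divide fewer values. *)
Lemma rare_not_separated (eta : R) : 0 < eta ->
  exists i0, forall i, (i0 <= i)%N -> rare eta (fun n => ~ separated z (2 ^ i) n).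
Proof.
move=> eta0; pose I := ('I_D * 'I_D)%type.
have c0 : 0 < eta / #|{: I}|%:R.
  by rewrite divr_gt0// ltr0n card_prod !card_ord.
have /choice[i0 hi0] : forall p : I, exists i, rare (eta / #|{: I}|%:R)
    (fun n => p.1 != p.2 /\ ((2 ^ i)%N%:Z %| z n p.1 - z n p.2)%Z).
  move=> [l m] /=; have [->|lm] := eqVneq l m.
    exists 0%N, 0%N => N _; rewrite /frequency big1 ?mulr_ge0// ?ltW// => n _.
    by case: asboolP => // -[].
  have pz := integer_valuedB (Pz l) (Pz m).
  have [i [N0 h]] := rarely_divisible pz (Pd lm) c0.
  exists i, N0 => N /h; apply: le_trans; apply: ler_sum => n _.
  rewrite ler_nat int_valueB//; case: asboolP => // -[_].
  by rewrite -/(z n l) -/(z n m) => ->.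
exists (\max_p i0 p)%N => i hi.
have := rare_bigU hi0; rewrite sumr_const -[X in rare X]mulr_natr divfK; last first.
  by rewrite pnatr_eq0 card_prod !card_ord.
apply: rare_le => n /existsNP[l /existsNP[m /not_implyP[lm /negP/negPn dv]]].
exists (l, m); split=> //=; apply: dvdz_trans dv.
by apply: dvdn_exp2l; apply: leq_trans hi; exact: (leq_bigmax (l, m)).
Qed.

(** Separation modulo the smallest power of 2 implies it for the larger ones,
    and the finitely many conditions on correlations fail rarely by mixing. *)
Lemma rare_not_under_good (Y : nat -> set X) (eta : R) : 0 < eta ->
  (forall i, measurable (Y i)) ->
  (forall i, mass mu (Y i) = under_density (2 ^ i.+2)) ->
  exists i0, forall K, rare eta (fun n =>
    exists i, (i0 <= i <= K)%N /\ ~ under_good mu th z (2 ^ i.+2) (Y i) n).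
Proof.
move=> eta0 mY Yd; have e2 : 0 < eta / 2 by rewrite divr_gt0.
have [i0 hi0] := rare_not_separated e2.
exists i0 => K.
have tol0 i : 0 < under_gain (R := R) k (2 ^ i.+2) / (2 * k.+3%:R).
  apply: divr_gt0; last by rewrite mulr_gt0// ltr0n.
  apply: divr_gt0; first by rewrite exprn_gt0// invr_gt0.
  by rewrite mulr_gt0// exprn_gt0// ltr0n expn_gt0.
pose err i (o : option 'I_D) n : R := match o with
  | None => correlation mu th z (Y i) n - under_density (2 ^ i.+2) ^+ D
  | Some l => mass mu (shifted_meet th (z n) (complement_at (Y i) l)) -
      under_density (2 ^ i.+2) ^+ D.-1 * (1 - under_density (2 ^ i.+2)) end.
have err_null i o : cesaro_null (err i o).
  case: o => [l|] /=; last first.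
    have := mixz (fun=> mY i); move/eq_cesaro_null; apply => n.
    by rewrite prodr_const card_ord Yd.
  have mC m := measurable_complement_at l m (mY i).
  have := mixz mC; move/eq_cesaro_null; apply => n; congr (_ - _).
  rewrite (bigD1 l)//= /complement_at eqxx mass_setC// Yd mulrC; congr (_ * _).
  rewrite (eq_bigr (fun=> under_density (2 ^ i.+2))) => [|m ml]; last first.
    by rewrite (negbTE ml) Yd.
  rewrite prodr_const; congr (_ ^+ _).
  by rewrite (eq_card (B := predC1 l)) ?cardC1 ?card_ord.
pose J := ('I_K.+1 * option 'I_D)%type.
have c0 : 0 < eta / 2 / #|{: J}|%:R.
  by rewrite divr_gt0// ltr0n card_prod card_option !card_ord.
have rJ (p : J) : rare (eta / 2 / #|{: J}|%:R) (fun n =>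
    under_gain k (2 ^ p.1.+2) / (2 * k.+3%:R) <= `|err p.1 p.2 n|).
  exact: rare_cesaro.
have := rareU (hi0 _ (leqW (leqnSn i0))) (rare_bigU rJ).
rewrite sumr_const -[X in _ + X]mulr_natr divfK; last first.
  by rewrite pnatr_eq0 card_prod card_option !card_ord.
rewrite -splitr; apply: rare_le => n [i [/andP[i0i iK] bad]].
have [sep|nsep] := pselect (separated z (2 ^ i0.+2) n); last by left.
right; apply: contra_notP bad => /forallNP none.
have small o : `|err i o n| <= under_gain k (2 ^ i.+2) / (2 * k.+3%:R).
  have iK1 : (i < K.+1)%N by [].
  by have := none (Ordinal iK1, o) => /negP; rewrite -ltNge => /ltW.
split; [|exact: small None|by move=> l; exact: small (Some l)].
move=> l m lm; have := sep l m lm; apply: contra; apply: dvdz_trans.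
by apply: dvdn_exp2l; rewrite !ltnS.
Qed.

End RareExceptions.

Section Assembly.
Context {disp : measure_display} {X : measurableType disp} {R : realType}.
Context (mu : probability X R) (th : int -> X -> X).
Context (thP : mp_action mu th) (thM : mixing_action mu th).
Context (nontriv : nontrivial_space mu).

Lemma supply_le D (z : nat -> 'I_D -> int) (s g g' : R) (G : nat -> Prop) :
  g' <= g -> supply mu th z s g G -> supply mu th z s g' G.
Proof.
move=> gg' sup M e e0; have [Q [mQ Q2 hQ]] := sup M e e0.
by exists Q; split=> // n nM Gn; apply: le_trans gg' _; exact: hQ.
Qed.

Lemma under_density_01 q : (4 <= q)%N -> 0 <= (under_density q : R) <= 1.
Proof.
move=> q4; have qR : 4 <= q%:R :> R by rewrite ler_nat.
rewrite /under_density; apply/andP; split.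
  by rewrite divr_ge0//; lra.
by rewrite ler_pdivrMr; lra.
Qed.

Lemma under_gainE k i :
  under_gain (R := R) k (2 ^ i.+2) = (3^-1 ^+ k.+2 / 128) / 4 ^+ i.
Proof.
rewrite /under_gain.
have -> : (2 ^ i.+2)%N%:R ^+ 2 = 16 * 4 ^+ i :> R.
  have e : ((2 ^ i.+2) ^ 2 = 16 * 4 ^ i)%N.
    by rewrite -(addn2 i) expnD expnMn mulnC (expnAC 2 i 2).
  by rewrite -natrX e natrM natrX.
have i0 : 4 ^+ i != 0 :> R by rewrite expf_neq0// pnatr_eq0.
by field.
Qed.

End Assembly.

Theorem theorem1p4 (R : realType) (disp : measure_display)
    (X : measurableType disp) (mu : probability X R) (T : X -> X)
    (hstd : standard_space mu)
    (hnontriv : nontrivial_space mu)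
    (hT : invertible_measure_preserving mu T)
    (hwm : weakly_mixing mu T)
    (d : nat) (hd : (1 <= d)%N)
    (p : 'I_d -> {poly R})
    (hint : forall i, integer_valued (p i))
    (hnc : forall i, nonconstant (p i))
    (hdiff : forall i j, i != j -> nonconstant (p i - p j)) :
  (exists A : set X, measurable A /\
     density_one R
       [set n : nat | (mu (poly_return T p n A) < mu A ^+ d.+1)%E]) /\
  (exists A : set X, measurable A /\
     density_one R
       [set n : nat | (mu (poly_return T p n A) > mu A ^+ d.+1)%E]).
Proof.
have [th [thP thE]] := action_of hT.
have thM := weakly_mixing_action thP thE hwm.
case: d hd p hint hnc hdiff => // k _ p hint hnc hdiff.
pose P (l : 'I_k.+2) : {poly R} := oapp p 0 (unlift ord0 l).
have Pz l : integer_valued (P l).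
  rewrite /P; case: unliftP => [i _|_] /=; first exact: hint.
  by move=> x; rewrite horner0 rpred0.
have nonconstN (q : {poly R}) : nonconstant q -> nonconstant (- q).
  by rewrite /nonconstant size_polyN.
have Pd l m : l != m -> nonconstant (P l - P m).
  rewrite /P; case: unliftP => [i ->|->]; case: unliftP => [j ->|->] /= lm.
  - by apply: hdiff; apply: contraNneq lm => ->.
  - by rewrite subr0; exact: hnc.
  - by rewrite sub0r; apply: nonconstN; exact: hnc.
  - by [].
pose z n l := int_value (P l) n.
have returnE A n : poly_return T p n A = shifted_meet th (z n) (fun=> A).
  apply/seteqP; split=> x.
    move=> [Ax xA] l _; rewrite /z /P /=; case: unliftP => [i _|_] /=.
      by have := xA i I; rewrite thE.
    by rewrite int_value0 oppr0 (act0 thP).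
  move=> xA; split.
    have := xA ord0 I; rewrite /z /P /= unlift_none /=.
    by rewrite int_value0 oppr0 (act0 thP).
  move=> i _; have := xA (lift ord0 i) I; rewrite /z /P /= liftK /=.
  by rewrite thE.
have mixz := fun B => polynomial_mixing_sets thP thM (B := B) Pz Pd.
have mixc A : measurable A ->
    cesaro_null (fun n => correlation mu th z A n - mass mu A ^+ k.+2).
  move=> mA; have := mixz (fun=> A) (fun=> mA); move/eq_cesaro_null; apply => n.
  by rewrite prodr_const card_ord.
have mret A n : measurable A -> measurable (poly_return T p n A).
  by move=> mA; rewrite returnE; apply: (measurable_shifted_meet thP).
have massret A n : mass mu (poly_return T p n A) = correlation mu th z A n.
  by rewrite returnE.
have muret A n : measurable A -> mu (poly_return T p n A) = (correlation mu th z A n)%:E.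
  by move=> mA; rewrite massE ?massret//; exact: mret.
have mupow A : measurable A -> (mu A ^+ k.+2)%E = (mass mu A ^+ k.+2)%:E.
  by move=> mA; rewrite EFin_expe -massE.
split.
- have q4 i : (4 <= 2 ^ i.+2)%N by rewrite (@leq_exp2l 2 2).
  have /choice[Y hY] : forall i, exists Y, [/\ measurable Y, Y `<=` setT &
      mass mu Y = under_density (2 ^ i.+2)].
    move=> i; apply: (exact_subset thP thM hnontriv) => //.
    by rewrite massT; exact: under_density_01.
  have mY i : measurable (Y i) by have [] := hY i.
  have Yd i : mass mu (Y i) = under_density (2 ^ i.+2) by have [] := hY i.
  have kappa0 : 0 < 3^-1 ^+ k.+2 / 128 :> R by rewrite divr_gt0// exprn_gt0.
  have sup i : supply mu th z (-1) (3^-1 ^+ k.+2 / 128 / 4 ^+ i)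
      (under_good mu th z (2 ^ i.+2) (Y i)).
    by rewrite -under_gainE; exact: (under_supply thP thM hnontriv).
  have s1 : `|-1| = 1 :> R by rewrite normrN1.
  have rareG eta (eta0 : 0 < eta) := rare_not_under_good Pz Pd mixz eta0 mY Yd.
  have [A [mA [A2 hA]]] := layered_construction thP thM hnontriv (ltn0Sn _)
    s1 kappa0 sup rareG mixc.
  exists A; split=> //; apply/density_oneP.
  apply: (cesaro_null_le (rare_cesaro_null hA)) => n.
  rewrite !normr_nat ler_nat; case: (boolP (n \in _)) => //= nA.
  case: asboolP => // nB; exfalso; apply: nB; move: nA.
  rewrite notin_setE => nlt.
  have {nlt} : ~ (mu (poly_return T p n A) < mu A ^+ k.+2)%E by [].
  by rewrite muret// mupow// A2 lte_fin mulN1r => /negP; rewrite -leNgt; lra.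
have kappa0 : 0 < 8^-1 :> R by [].
have sup i : supply mu th z 1 (8^-1 / 4 ^+ i) (fun=> True).
  apply: supply_le (over_supply thP thM hnontriv _ _) => //.
  by rewrite ler_pdivrMr ?exprn_gt0// ler_pMr// exprn_ege1// ler1n.
have s1 : `|1| = 1 :> R by rewrite normr1.
have rareG (eta : R) : 0 < eta -> exists i0, forall K,
    rare eta (fun n => exists i, (i0 <= i <= K)%N /\ ~ True).
  move=> eta0; exists 0%N => K; exists 0%N => N _.
  rewrite /frequency big1 ?mulr_ge0// ?ltW// => n _.
  by case: asboolP => // -[i []].
have [A [mA [A2 hA]]] := layered_construction thP thM hnontriv (ltn0Sn _)
  s1 kappa0 sup rareG mixc.
exists A; split=> //; apply/density_oneP.
apply: (cesaro_null_le (rare_cesaro_null hA)) => n.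
rewrite !normr_nat ler_nat; case: (boolP (n \in _)) => //= nA.
case: asboolP => // nB; exfalso; apply: nB; move: nA.
rewrite notin_setE => nlt.
have {nlt} : ~ (mu (poly_return T p n A) > mu A ^+ k.+2)%E by [].
by rewrite muret// mupow// A2 lte_fin mul1r => /negP; rewrite -leNgt; lra.
Qed.
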